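(* Consider the real scalar fast fading channel described in the context with i.i.d. fading of a regular fading distribution. Let $\epsilon>0$ be fixed and let $\mu^*(n,\epsilon)$ be the infimum of $\mu(S,\epsilon)$ over all $n$-dimensional infinite constellations $S$. Then, as $n\to\infty$, $$\mu^*(n,\epsilon)=1+\sqrt{\frac{2+\mathrm{Var}(\ln(H^2))}{n}}Q^{-1}(\epsilon)+O\!\left(\frac{\ln n}{n}\right).$$
   Context: Channel: $Y_i=H_iX_i+Z_i$, $\{H_i\}$ i.i.d. nonnegative with $E H_i^2=1$ and a regular fading distribution (PDF $f$ with $f(h)\propto h^{\alpha-1}$ for all small $h>0$, some $\alpha>0$), $\{Z_i\}$ i.i.d. $N(0,\sigma^2)$, all independent, receiver knows $\mathbf H=\mathrm{diag}(H_1,\dots,H_n)$. An IC is a countable $S\subset\mathbb R^n$ with density $\gamma=\limsup_{a}|S\cap\{|x_i|<a/2\}|/a^n$ and NLD $\delta(S)=\frac1n\ln\gamma$; its average error probability $P_e(S)$ is $E\{\limsup_a$ average over received points $s_{rc}\in\mathbf HS$ lying in $\mathbf H\cdot\{|x_i|<a/2\}$ of $\Pr\{s_{rc}+\mathbf z\notin W(s_{rc})\mid\mathbf H\}\}$, $W$ the Voronoi cell in $\mathbf HS$. The volume-to-noise ratio of $S$ at error probability $\epsilon$ is $\mu(S,\epsilon)=\frac{e^{-2\delta(S)+E\{\ln(H^2)\}}}{2\pi e\sigma^2(\epsilon)}$, where $\sigma^2(\epsilon)$ is the noise variance for which the average error probability of $S$ equals $\epsilon$. $Q$ is the standard Gaussian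 complementary CDF. *)

(* Defs.v *)
From HB Require Import structures.
From mathcomp Require Import all_boot all_order all_algebra.
From mathcomp Require Import all_classical all_reals all_analysis.
Set Implicit Arguments. Unset Strict Implicit. Unset Printing Implicit Defensive.
Import Order.TTheory GRing.Theory Num.Theory.
Local Open Scope classical_set_scope.
Local Open Scope ring_scope.

Section Defs.
Context {R : realType}.

Definition sqnorm {n} (x : 'rV[R]_n) : R := \sum_(i < n) x ord0 i ^+ 2.

Definition cube n (a : R) : set 'rV[R]_n := [set x | forall i, `|x ord0 i| < a / 2].

Definition elimsup_pinfty (g : R -> \bar R) : \bar R :=
  ereal_inf [set ereal_sup (g @` [set a | M < a]) | M in [set: R]].

Definition IC_density n (S : set 'rV[R]_n) : \bar R :=
  elimsup_pinfty (fun a => let v : R := (a ^+ n)^-1 in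
                           (counting (S `&` @cube n a) * v%:E)%E).

(* normalized log density delta(S) = (1/n) ln gamma (for 0 < gamma < +oo) *)
Definition NLD n (S : set 'rV[R]_n) : R := ln (fine (IC_density S)) / n%:R.

Definition voronoi n (C : set 'rV[R]_n) (y : 'rV[R]_n) : set 'rV[R]_n :=
  [set x | forall y', C y' -> sqnorm (x - y) <= sqnorm (x - y')].

Definition fade n (h : 'I_n -> R) (s : 'rV[R]_n) : 'rV[R]_n :=
  \row_i (h i * s ord0 i).

Definition Qfun (x : R) : R := fine (normal_prob 0 1 `[x, +oo[%classic).

Context {d : measure_display} {T : measurableType d} (P : probability T R).

Definition noise_vec n (Z : nat -> T -> R) (sigma2 : R) (w : T) : 'rV[R]_n :=
  \row_(i < n) (Num.sqrt sigma2 * Z i w).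

(* Pr{ s_rc + z notin W(s_rc) | H = h }, s_rc = h s *)
Definition cond_err n (Z : nat -> T -> R) (sigma2 : R) (S : set 'rV[R]_n)
    (h : 'I_n -> R) (s : 'rV[R]_n) : \bar R :=
  P [set w | ~ voronoi (fade h @` S) (fade h s) (fade h s + @noise_vec n Z sigma2 w)].

Definition avg_err n (Z : nat -> T -> R) (sigma2 : R) (S : set 'rV[R]_n)
    (h : 'I_n -> R) (a : R) : \bar R :=
  let A := S `&` @cube n a in
  match counting A with
  | EFin c => if 0 < c then ((\esum_(s in A) cond_err Z sigma2 S h s) * (c^-1)%:E)%E
              else 0%E
  | _ => 0%E
  end.

Definition Pe n (H Z : nat -> T -> R) (sigma2 : R) (S : set 'rV[R]_n) : \bar R :=
  (\int[P]_w elimsup_pinfty (avg_err Z sigma2 S (fun i : 'I_n => H i w)))%E.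

Definition sigma2_eps n (H Z : nat -> T -> R) (S : set 'rV[R]_n) (eps : R) : \bar R :=
  ereal_sup [set s2%:E | s2 in [set s2 : R | 0 < s2 /\ (Pe H Z s2 S <= eps%:E)%E]].

(* E ln(H^2) and Var ln(H^2) (H_0 is distributed as H) *)
Definition ElnH2 (H : nat -> T -> R) : R :=
  fine (\int[P]_w (ln (H 0%N w ^+ 2))%:E)%E.
Definition VarlnH2 (H : nat -> T -> R) : R :=
  fine (\int[P]_w ((ln (H 0%N w ^+ 2) - ElnH2 H) ^+ 2)%:E)%E.

Definition VNR n (H Z : nat -> T -> R) (S : set 'rV[R]_n) (eps : R) : \bar R :=
  match sigma2_eps H Z S eps with
  | EFin s2 => (expR (- 2 * NLD S + ElnH2 H) / (2 * pi * expR 1 * s2))%:E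
  | +oo%E => 0%E
  | -oo%E => +oo%E
  end.

(* n-dimensional infinite constellations: countable, with finite positive
   density, and for which sigma^2(eps) exists *)
Definition IC_admissible n (H Z : nat -> T -> R) (eps : R) (S : set 'rV[R]_n) : Prop :=
  countable S /\ (0 < IC_density S < +oo)%E /\
  exists s2 : R, 0 < s2 /\ (Pe H Z s2 S <= eps%:E)%E.

Definition mu_star n (H Z : nat -> T -> R) (eps : R) : \bar R :=
  ereal_inf [set VNR H Z S eps | S in @IC_admissible n H Z eps].

Definition mutually_independent (X : nat -> T -> R) : Prop :=
  forall (I : seq nat) (B : nat -> set R), uniq I -> (forall i, measurable (B i)) ->
    P (\bigcap_(i in [set i | i \in I]) (X i @^-1` B i)) =
    (\prod_(i <- I) P (X i @^-1` B i))%E.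

End Defs.

(* Main.v *)
(** Given the fading, compare the squared norm of the normalized noise with
    r(t)^2 = n + sum_i (ln H_i^2 - E ln H^2) + sqrt V t, where V = 2 + Var (ln H^2).  The radius is
    tuned so that exp (r(t)^2 / 2) / prod_i H_i, which up to the factor (2 pi)^(n/2) bounds the
    volume of the ellipsoid {x : |H x| <= r(t)}, does not depend on the fading, and so that
    Pr{|Z|^2 <= r(t)^2} is the distribution function at t of a sum of n i.i.d. standardized
    variables, that is Phi (t / sqrt n) + O(1 / sqrt n) by the Berry-Esseen theorem.  The latter is
    proved by Lindeberg's exchange of summands against Gaussian smoothings of a step function.

    Converse: outside the ball of radius r(t) the noise density is at most
    (2 pi)^(-n/2) exp (- r(t)^2 / 2), so the average probability of a correct decision outside the
    ball is at most this bound divided by the density of the faded constellation.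
    Achievability: the points of a period are chosen greedily in a box, so that each new point falls
    in the ellipsoids around the noisy previous ones with small expected probability; guard gaps make
    the interference between periods negligible.
    In both directions the choice t = sqrt n q + O(1), with an additional O(ln n) in the log-density,
    keeps the error within O(1 / sqrt n) of eps. *)
Require Import Defs.
From HB Require Import structures.
From mathcomp Require Import all_boot all_order all_algebra.
From mathcomp Require Import all_classical all_reals all_analysis.
From mathcomp Require Import measurable_realfun.
From mathcomp Require Import zify ring lra.
Import Order.TTheory GRing.Theory Num.Theory.
Import numFieldNormedType.Exports.
Local Open Scope classical_set_scope.
Local Open Scope ring_scope.
Set Implicit Arguments.
Unset Strict Implicit.
Unset Printing Implicit Defensive.

(** * Product measures and laws of random vectors *)

(** An error O(1 / sqrt n) in probability is affordable: by the positive slope of the normal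
    distribution function at [q] it shifts t by O(1), hence the logarithm of the volume-to-noise
    ratio by O(1 / n). The term ln n / n arises from giving the auxiliary probability [del] the
    value 1 / sqrt n. Constant factors in volumes and densities are harmless for the same reason.

    Obtaining this rate from Gaussian smoothing is delicate. The error of one exchange is
    proportional to the supremum of the smoothed function, so the exchange is applied to the
    difference of two distribution functions, which is already small by induction.

    Fading gains may be arbitrarily small. Hence the third moment of ln H^2 has to be extracted from
    the power law of the density near 0, by its self-similarity under halving, and the guard gap is
    2 r / eta, with a threshold [eta] for the gains that depends on n; a long period makes the cost
    of the gap in density negligible. The greedy choice uses confusion probabilities averaged over
    fading and noise, so that one constellation serves all channel states. *)

Section affine.
Context {R : realType}.
Notation mu := (@lebesgue_measure R).

Lemma measurable_affine (a b : R) :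
  measurable_fun setT ((fun x => a * x + b) : R -> measurableTypeR R).
Proof. by apply: measurable_funD => //; exact: measurable_funM. Qed.

(** By uniqueness of the Lebesgue measure it is enough to compare both sides on half-open intervals,
    where the positive slope keeps the order of the endpoints. *)
Lemma lebesgue_measure_affine (a b : R) (A : set R) : 0 < a -> measurable A ->
  mu A = (a%:E * mu ((fun x : R => (a * x + b)%R) @^-1` A))%E.
Proof.
move=> a0 mA; have a1 := ltW a0.
pose g := (fun x => a * x + b) : R -> measurableTypeR R.
have mg : measurable_fun setT g := measurable_affine a b.
pose m := mscale (NngNum a1) (pushforward mu g).
rewrite -[RHS]/(m mg A).
apply: lebesgue_measure_unique => // _ [[c e]] _ <- /=.
rewrite /m/= /mscale/= /pushforward.
have -> : g @^-1` `]c, e] = `](c - b) / a, (e - b) / a]%classic.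
  apply/seteqP; split => x /=; rewrite !in_itv/=; rewrite ltr_pdivrMr// ler_pdivlMr//
   ltrBlDr lerBrDr mulrC//.
rewrite !lebesgue_measure_itv/= !lte_fin ltr_pM2r ?invr_gt0// ltrD2r.
case: ifP => _; last by rewrite mule0.
rewrite -!EFinB -EFinM; congr EFin; field.
by rewrite gt_eqF.
Qed.

Lemma ge0_integral_affine (a b : R) (f : R -> \bar R) : 0 < a ->
  measurable_fun setT f -> (forall x, 0 <= f x)%E ->
  (\int[mu]_x f x = a%:E * \int[mu]_x f (a * x + b)%R)%E.
Proof.
move=> a0 mf f0; have a1 := ltW a0.
pose g := (fun x => a * x + b) : R -> measurableTypeR R.
have mg : measurable_fun setT g := measurable_affine a b.
pose m := mscale (NngNum a1) (pushforward mu g).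
transitivity (\int[m mg]_x f x)%E.
  by apply: eq_measure_integral => A mA _; exact: lebesgue_measure_affine.
rewrite ge0_integral_mscale//= ge0_integral_pushforward//.
Qed.
End affine.

Section tuple_product_measure.
Context {d} {T : measurableType d} {R : realType}.
Local Open Scope ereal_scope.

Definition tcons n (p : T * n.-tuple T) : n.+1.-tuple T :=
  [the n.+1.-tuple T of p.1 :: p.2].

Lemma measurable_tcons n : measurable_fun setT (@tcons n).
Proof. by apply: measurable_cons; [exact: measurable_fst|exact: measurable_snd]. Qed.

Variable mu : {sigma_finite_measure set T -> \bar R}.

Section step.
Variables (n : nat) (m : {sigma_finite_measure set (n.-tuple T) -> \bar R}).

(** Powers of a measure are built one factor at a time, as images of binary products under [tcons],
    so that Tonelli's theorem for pairs applies factor by factor. Only sigma-finiteness is carried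
    along, since both probability laws and the Lebesgue measure are raised to powers. *)
Definition tstep : set (n.+1.-tuple T) -> \bar R := pushforward (mu \x m) (@tcons n).

Let tstep0 : tstep set0 = 0.
Proof. by rewrite /tstep /pushforward preimage_set0 measure0. Qed.

Let tstep_ge0 A : 0 <= tstep A.
Proof. by rewrite /tstep /pushforward measure_ge0. Qed.

Let tstep_sigma_additive : semi_sigma_additive tstep.
Proof.
move=> F mF tF mUF; rewrite /tstep /pushforward preimage_bigcup.
have mpre A : measurable A -> measurable (@tcons n @^-1` A).
  by move=> mA; rewrite -[X in measurable X]setTI; exact: measurable_tcons.
apply: measure_semi_sigma_additive.
- by move=> k; exact: mpre.
- apply/trivIsetP => /= i j _ _ ij; rewrite -preimage_setI.
  by move/trivIsetP : tF => /(_ _ _ _ _ ij) ->//; rewrite preimage_set0.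
- by rewrite -preimage_bigcup; exact: mpre.
Qed.

HB.instance Definition _ :=
  isMeasure.Build _ _ _ tstep tstep0 tstep_ge0 tstep_sigma_additive.

Let tuncons (t : n.+1.-tuple T) : T * n.-tuple T := (thead t, [tuple of behead t]).

Let measurable_tuncons : measurable_fun setT tuncons.
Proof.
apply: measurable_fun_pair; last exact: measurable_behead.
exact: measurable_tnth.
Qed.

Let tconsK : cancel (@tcons n) tuncons.
Proof.
move=> [x t]; rewrite /tuncons /tcons/= theadE; congr pair.
exact: val_inj.
Qed.

Let tstep_sigma_finite : sigma_finite setT tstep.
Proof.
have /sigma_finiteP[F [TF ndF Foo]] := sigma_finiteT mu.
have /sigma_finiteP[G [TG ndG Goo]] := sigma_finiteT m.
exists (fun k => tuncons @^-1` (F k `*` G k)).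
  rewrite -preimage_bigcup -(preimage_setT tuncons); congr (_ @^-1` _).
  rewrite -setXTT TF TG predeqE => -[x y]; split.
    move=> [/= [i _ Fnx] [k _ Gky]]; exists (maxn i k) => //; split.
    - by move: x Fnx; exact/subsetPset/ndF/leq_maxl.
    - by move: y Gky; exact/subsetPset/ndG/leq_maxr.
  by move=> [i _ []/= ? ?]; split; exists i.
move=> k; have [? ?] := Foo k; have [? ?] := Goo k; split.
  by rewrite -[X in measurable X]setTI; apply: measurable_tuncons => //; exact: measurableX.
rewrite /tstep /pushforward -comp_preimage.
have -> : tuncons \o @tcons n = id by apply/funext => p; exact: tconsK.
by rewrite preimage_id product_measure1E// lte_mul_pinfty// ge0_fin_numE.
Qed.

HB.instance Definition _ := Measure_isSigmaFinite.Build _ _ _ tstep tstep_sigma_finite.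

Lemma ge0_integral_tstep (f : n.+1.-tuple T -> \bar R) :
  measurable_fun setT f -> (forall t, 0 <= f t) ->
  \int[tstep]_t f t = \int[mu]_x \int[m]_t f (tcons (x, t)).
Proof.
move=> mf f0.
rewrite -(@fubini_tonelli1 _ _ _ _ _ mu m (f \o @tcons n))//; last first.
- by move=> x; exact: f0.
- by apply: measurableT_comp => //; exact: measurable_tcons.
by rewrite -[RHS](@ge0_integral_pushforward _ _ _ _ _ _ (measurable_tcons (n:=n)) (mu \x m) setT f).
Qed.

End step.

Definition tuple0_measure : {sigma_finite_measure set (0.-tuple T) -> \bar R} :=
  \d_([tuple] : 0.-tuple T).

Fixpoint tprod n : {sigma_finite_measure set (n.-tuple T) -> \bar R} :=
  if n is n'.+1 then tstep (tprod n') else tuple0_measure.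

Lemma ge0_integral_tprodS n (f : n.+1.-tuple T -> \bar R) :
  measurable_fun setT f -> (forall t, 0 <= f t) ->
  \int[tprod n.+1]_t f t = \int[mu]_x \int[tprod n]_t f (tcons (x, t)).
Proof. exact: ge0_integral_tstep. Qed.

Lemma ge0_integral_tprod0 (f : 0.-tuple T -> \bar R) :
  measurable_fun setT f -> \int[tprod 0]_t f t = f [tuple].
Proof. by move=> mf; rewrite /= integral_dirac// diracT mul1e. Qed.

Lemma measurable_ge0_integral_tprod d' (S : measurableType d') n
    (f : S * n.-tuple T -> \bar R) : measurable_fun setT f -> (forall t, 0 <= f t) ->
  measurable_fun setT (fun s => \int[tprod n]_t f (s, t)).
Proof. by move=> mf f0; exact: measurable_fun_fubini_tonelli_F. Qed.

End tuple_product_measure.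

Section vector_law.
Context {d} {T : measurableType d} {R : realType}.
Local Notation mR := (measurableTypeR R).
Variables (P : probability T R) (X : nat -> T -> mR).
Variable (mu : probability mR R).
Hypothesis mX : forall i, measurable_fun setT (X i).
Hypothesis indX : mutually_independent P X.
Hypothesis lawX : forall i B, measurable B -> P (X i @^-1` B) = mu B.
Local Open Scope ereal_scope.

(** The starting index [m] lets the recursion pass to the tail of the sequence. *)
Fixpoint rvec k m (w : T) : k.-tuple mR :=
  if k is k'.+1 then tcons (X m w, rvec k' m.+1 w) else [tuple].

Lemma tnth_rvec k m w (i : 'I_k) : tnth (rvec k m w) i = X (m + i) w.
Proof.
elim: k m i => [|k IH] m i; first by case: i.
case: (unliftP ord0 i) => [j ->|->]; last by rewrite addn0.
by rewrite tnthS IH /= /bump add1n addSnnS.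
Qed.

Lemma measurable_rvec k m : measurable_fun setT (rvec k m).
Proof.
apply/measurable_fun_tnthP => i.
rewrite (_ : _ \o _ = X (m + i)) //.
by apply/funext => w /=; rewrite tnth_rvec.
Qed.

Let evt (I : seq nat) (B : nat -> set mR) := \bigcap_(i in [set i | i \in I]) (X i @^-1` B i).

Let measurable_evt I B : (forall i, measurable (B i)) -> measurable (evt I B).
Proof.
move=> mB; rewrite /evt bigcap_mkcond; apply: bigcapT_measurable => i.
case: ifPn => // _; rewrite -[X in measurable X]setTI; exact: mX.
Qed.

(** Independence is given for finite families of events. An event on coordinates before [m] is
    carried along, so that the induction can move coordinate [m] from the vector into this past. *)
Let rvec_law_past k m I (B : nat -> set mR) A : uniq I -> all (fun i => (i < m)%N) I ->
  (forall i, measurable (B i)) -> measurable A ->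
  P (rvec k m @^-1` A `&` evt I B) = tprod mu k A * P (evt I B).
Proof.
elim: k m I B A => [|k IH] m I B A uI Im mB mA.
  rewrite /= diracE; case: (boolP (_ \in A)) => /= hA.
    rewrite mul1e; congr (P _); apply/seteqP; split => [x []//|x ?]; split => //.
    by move: hA; rewrite inE.
  rewrite mul0e (_ : _ `&` _ = set0) ?measure0//.
  apply/seteqP; split => // x [] /= xA _.
  by move/negP: hA; apply; rewrite inE.
have mE := measurable_evt I mB.
set c := P (evt I B).
have cfin : c \is a fin_num by exact: fin_num_measure.
have c0 : 0 <= c by exact: measure_ge0.
pose g w := (X m w, rvec k m.+1 w).
have mg : measurable_fun setT g.
  by apply: measurable_fun_pair; [exact: mX|exact: measurable_rvec].
have gA : rvec k.+1 m @^-1` A = g @^-1` (@tcons _ _ k @^-1` A) by [].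
have mtA : measurable (@tcons _ _ k @^-1` A).
  by rewrite -[X in measurable X]setTI; exact: measurable_tcons.
have mpre E : measurable E -> measurable (g @^-1` E).
  by move=> mE'; rewrite -[X in measurable X]setTI; exact: mg.
(* A null past cannot be conditioned on, but then both sides vanish. *)
have [c00|c00] := eqVneq c 0.
  rewrite c00 mule0; apply/eqP; rewrite eq_le measure_ge0 andbT -c00.
  by apply: le_measure; rewrite ?inE//; apply: measurableI => //; rewrite gA; exact: mpre.
have rc0 : (0 <= (fine c)^-1)%R by rewrite invr_ge0 fine_ge0.
(* The conditional law, given the past, of coordinate [m] and the later ones. On rectangles the
   induction hypothesis identifies it with the product measure, and this determines it. *)
pose m' := mscale (NngNum rc0) (pushforward (mrestr P mE) g).
have m'E E : m' mg E = (fine c)^-1%:E * P (g @^-1` E `&` evt I B) by [].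
have fc0 : fine c != 0%R by rewrite fine_eq0.
have key : forall U V, measurable U -> measurable V -> m' mg (U `*` V) = mu U * tprod mu k V.
  move=> U V mU mV; rewrite m'E.
  pose B' i := if i == m then U else B i.
  have mB' i : measurable (B' i) by rewrite /B'; case: ifP.
  have uI' : uniq (m :: I).
    by rewrite /= uI andbT; apply/negP => /(allP Im); rewrite ltnn.
  have ImN i : i \in I -> i != m.
    by move=> /(allP Im) im; rewrite neq_ltn im.
  have evtE : evt (m :: I) B' = X m @^-1` U `&` evt I B.
    apply/seteqP; split => w.
      move=> h; split.
        by have := h m; rewrite /B' eqxx; apply; rewrite /= mem_head.
      move=> i /= iI; have := h i; rewrite /B' (negPf (ImN _ iI)); apply => /=.
      by rewrite in_cons iI orbT.
    move=> [hU hI] i /=; rewrite in_cons /B'; case: eqVneq => [->//|im /=].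
    by move=> iI; exact: hI.
  have -> : g @^-1` (U `*` V) `&` evt I B = rvec k m.+1 @^-1` V `&` evt (m :: I) B'.
    rewrite evtE; apply/seteqP; split => w /=; rewrite /g/=; tauto.
  rewrite (IH m.+1 (m :: I) B' V)//; last first.
    by rewrite /= ltnSn; apply/allP => i /(allP Im) /ltnW.
  have -> : P (evt (m :: I) B') = mu U * c.
    rewrite /evt (indX uI' mB') big_cons {1}/B' eqxx lawX//; congr (_ * _).
    rewrite /c /evt (indX uI mB) big_seq [RHS]big_seq; apply: eq_bigr => i iI.
    by rewrite /B' (negPf (ImN _ iI)).
  have ca : c * (fine c)^-1%:E = 1 by rewrite -[X in X * _](fineK cfin) -EFinM divff.
  by rewrite muleC -!muleA ca mule1 muleC.
have := product_measure_unique key mtA.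
rewrite -[X in _ = X -> _]/(m' mg _) m'E -gA => h.
have -> : tprod mu k.+1 A = (mu \x tprod mu k) (@tcons _ _ k @^-1` A) by [].
by rewrite h muleAC -(fineK cfin) -EFinM mulVf// mul1e.
Qed.

Lemma rvec_law k m A : measurable A -> P (rvec k m @^-1` A) = tprod mu k A.
Proof.
move=> mA; have := @rvec_law_past k m [::] (fun=> setT) A isT isT (fun=> measurableT) mA.
by rewrite /evt (_ : \bigcap_(i in _) _ = setT) ?setIT ?probability_setT ?mule1//; apply/seteqP; split.
Qed.

Lemma ge0_integral_rvec k m (f : k.-tuple mR -> \bar R) :
  measurable_fun setT f -> (forall t, 0 <= f t) ->
  \int[P]_w f (rvec k m w) = \int[tprod mu k]_t f t.
Proof.
move=> mf f0.
rewrite -[LHS](@ge0_integral_pushforward _ _ _ _ _ _ (@measurable_rvec k m) P setT f)//.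
apply: eq_measure_integral => [|? A mA _]; first exact: measurable_rvec.
exact: rvec_law.
Qed.
End vector_law.

(** * Gaussian densities *)

Section exp_remainder.
Context {R : realType}.

(** Without its first three terms the exponential series consists of t^(k+3) / (k+3)!, each at most
    |t|^3 |t|^k / k! in absolute value. *)
Lemma expR_remainder2 (t : R) :
  `|expR t - (1 + t + t ^+ 2 / 2)| <= `|t| ^+ 3 * expR `|t|.
Proof.
have sh (n : nat) : `|series (exp_coeff t) (n + 3)%N - (1 + t + t ^+ 2 / 2)| <=
    `|t| ^+ 3 * series (exp_coeff `|t|) n.
  rewrite /series/= !big_mkord.
  rewrite addnC big_split_ord/= !big_ord_recl big_ord0 /= addr0.
  rewrite /exp_coeff /= !fact0 /bump/= !addn0.
  have -> : t ^+ 0 / 1 + (t ^+ 1 / 1%:R + t ^+ (1 + 1) / 2`!%:R) = 1 + t + t ^+ 2 / 2.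
    by rewrite expr0 expr1 !divr1 addrA.
  rewrite addrAC subrr add0r mulr_sumr.
  apply: le_trans (ler_norm_sum _ _ _) _.
  apply: ler_sum => i _.
  rewrite normrM normrX normfV exprD -mulrA [`|_%:R|]ger0_norm//.
  rewrite ler_wpM2l ?exprn_ge0// ler_wpM2l ?exprn_ge0//.
  rewrite lef_pV2 ?posrE ?ltr0n ?fact_gt0// ler_nat.
  by rewrite leq_fact// leq_addl.
have cv (x : R) : series (exp_coeff x) n @[n --> \oo] --> expR x.
  by rewrite /expR; exact: is_cvg_series_exp_coeff.
have c1 : `|series (exp_coeff t) (n + 3)%N - (1 + t + t ^+ 2 / 2)| @[n --> \oo] -->
    `|expR t - (1 + t + t ^+ 2 / 2)|.
  apply: cvg_norm; apply: cvgB; last exact: cvg_cst.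
  by rewrite (cvg_shiftn 3).
have c2 : `|t| ^+ 3 * series (exp_coeff `|t|) n @[n --> \oo] --> `|t| ^+ 3 * expR `|t|.
  by apply: cvgM; [exact: cvg_cst|exact: cv].
by apply: (ler_cvg_to c1 c2); near=> n; exact: sh.
Unshelve. all: by end_near. Qed.

End exp_remainder.

(** The parameter [m] is the variance, which adds up under convolution. *)
HB.lock Definition gauss {R : realType} (m u : R) : R :=
  (Num.sqrt (2 * pi * m))^-1 * expR (- u ^+ 2 / (2 * m)).

Section gauss.
Context {R : realType}.
Notation mu := (@lebesgue_measure R).

Lemma gaussE (m u : R) : gauss m u = (Num.sqrt (2 * pi * m))^-1 * expR (- u ^+ 2 / (2 * m)).
Proof. by rewrite gauss.unlock. Qed.

Lemma gauss_normal_pdf (m : R) : 0 < m -> gauss m = normal_pdf 0 (Num.sqrt m).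
Proof.
move=> m0; rewrite normal_pdfE ?gt_eqF ?sqrtr_gt0//.
apply/funext => u; rewrite gaussE /normal_peak /normal_fun subr0.
rewrite sqr_sqrtr ?ltW// -(mulr_natl (m * pi)) -(mulr_natl m).
by congr ((Num.sqrt _)^-1 * _); ring.
Qed.

Lemma gauss_ge0 (m u : R) : 0 <= gauss m u.
Proof. by rewrite gaussE mulr_ge0// ?invr_ge0 ?expR_ge0. Qed.

Lemma measurable_gauss (m : R) : measurable_fun setT (gauss m).
Proof.
rewrite (_ : gauss m = fun u => (Num.sqrt (2 * pi * m))^-1 * expR (- u ^+ 2 / (2 * m))); last first.
  by apply/funext => u; rewrite gaussE.
apply: measurable_funM => //; apply: measurableT_comp => //.
by apply: measurable_funM => //; apply: measurableT_comp => //; exact: measurable_funX.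
Qed.

Lemma integral_gauss (m : R) : 0 < m -> (\int[mu]_u (gauss m u)%:E = 1)%E.
Proof. by move=> m0; rewrite gauss_normal_pdf// integral_normal_pdf. Qed.

Lemma integrable_gauss (m : R) : 0 < m -> mu.-integrable setT (EFin \o gauss m).
Proof. by move=> m0; rewrite gauss_normal_pdf//; exact: integrable_normal_pdf. Qed.

Lemma gauss_scale (m u : R) : 0 < m -> gauss m u = gauss 1 (u / Num.sqrt m) / Num.sqrt m.
Proof.
move=> m0; rewrite !gaussE mulr1 sqrtrM ?mulr_ge0 ?pi_ge0// invfM mulrAC; congr (_ * expR _ / _).
rewrite expr_div_n sqr_sqrtr ?ltW//; field.
by rewrite gt_eqF.
Qed.

Lemma gauss_peak (m u : R) : 0 < m -> gauss m u <= (Num.sqrt (2 * pi * m))^-1.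
Proof.
move=> m0; rewrite !gaussE ler_piMr ?invr_ge0//.
by rewrite expR_le1 mulNr oppr_le0 mulr_ge0 ?sqr_ge0// invr_ge0 mulr_ge0 ?ltW.
Qed.

(** Completing the square in [u]: the second factor on the right is the conditional density of one
    Gaussian summand given the sum [w]. *)
Lemma gauss_square (a b u w : R) : 0 < a -> 0 < b ->
  gauss a (w - u) * gauss b u =
  gauss (a + b) w * gauss (a * b / (a + b)) (u - b / (a + b) * w).
Proof.
move=> a0 b0; have ab0 : 0 < a + b by exact: addr_gt0.
have p0 := pi_gt0 R.
rewrite !gaussE mulrACA [RHS]mulrACA -!expRD -!invfM.
rewrite -!sqrtrM ?mulr_ge0 ?ltW//; congr ((Num.sqrt _)^-1 * expR _).
- by field; rewrite gt_eqF.
- by field; rewrite !gt_eqF.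
Qed.

Lemma gauss_conv (a b w : R) : 0 < a -> 0 < b ->
  (\int[mu]_u (gauss a (w - u) * gauss b u)%:E = (gauss (a + b) w)%:E)%E.
Proof.
move=> a0 b0; have ab0 : 0 < a + b by exact: addr_gt0.
have c0 : 0 < a * b / (a + b) by rewrite divr_gt0// mulr_gt0.
under eq_integral do rewrite gauss_square// EFinM.
rewrite ge0_integralZl//=; last 3 first.
- apply/measurable_EFinP; apply: measurableT_comp; first exact: measurable_gauss.
  exact: measurable_funB.
- by move=> u _; rewrite lee_fin gauss_ge0.
- by rewrite lee_fin gauss_ge0.
rewrite -[RHS]mule1 -(integral_gauss c0); congr (_ * _)%E.
rewrite (@ge0_integral_affine _ 1 (- (b / (a + b) * w)) (EFin \o gauss (a * b / (a + b))))//.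
- by rewrite mul1e; apply: eq_integral => u _; rewrite /= mul1r.
- by apply/measurable_EFinP; exact: measurable_gauss.
- by move=> u; rewrite /= lee_fin gauss_ge0.
Qed.

(** The 14 is twice the 7 of the small-shift estimate below, the factor 2 coming from [gauss4E];
    [expR 4] bounds exp (2 |y| + 1 - 3 y^2 / 8). *)
Let C0 : R := 14 * expR 4.

(** The spare exponential absorbs polynomials and exp (2 |y|), at the price of a fourfold variance
    in the bounds. *)
Let gauss4E (y : R) : gauss 1 y = 2 * gauss 4 y * expR (- (3 / 8) * y ^+ 2).
Proof.
rewrite !gaussE (_ : 2 * pi * 4 = 2 ^+ 2 * (2 * pi * 1)); last by ring.
rewrite (sqrtrM _ (sqr_ge0 2)) sqrtr_sqr ger0_norm//.
have -> : expR (- y ^+ 2 / (2 * 1)) = expR (- y ^+ 2 / (2 * 4)) * expR (- (3 / 8) * y ^+ 2) :> R.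
  by rewrite -expRD; congr expR; field.
by field; rewrite gt_eqF// sqrtr_gt0 mulr1 mulr_gt0// pi_gt0.
Qed.

(** For |s| >= 1 every term is of order |s|^3 on its own; for |s| < 1 the quotient of the two
    densities is exp (s y - s^2 / 2), which is expanded. The right-hand side is kept integrable in
    [y], for use under the integral sign. *)
Let gauss1_remainder (y s : R) :
  `|gauss 1 (y - s) - gauss 1 y * (1 + s * y + s ^+ 2 / 2 * (y ^+ 2 - 1))| <=
  C0 * `|s| ^+ 3 * (gauss 1 (y - s) + gauss 4 y).
Proof.
have g1 := gauss_ge0 1 y; have g2 := gauss_ge0 1 (y - s); have g4 := gauss_ge0 4 y.
have e4 : 1 + 4 <= expR 4 :> R by exact: expR_ge1Dx.
have ys : y <= `|y| := ler_norm y.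
have y2 : `|y| ^+ 2 = y ^+ 2 by rewrite -normrX ger0_norm// sqr_ge0.
set a : R := `|y|; have a0 : 0 <= a by exact: normr_ge0.
have [s1|s1] := lerP 1 `|s|.
  have s3 : 1 <= `|s| ^+ 3 by rewrite exprn_ege1.
  have s13 : `|s| <= `|s| ^+ 3 by rewrite -[leLHS]expr1 ler_weXn2l.
  have s23 : `|s| ^+ 2 <= `|s| ^+ 3 by rewrite ler_weXn2l.
  have hb : `|1 + s * y + s ^+ 2 / 2 * (y ^+ 2 - 1)| <= `|s| ^+ 3 * (2 * (1 + y ^+ 2)).
    apply: le_trans (ler_normD _ _) _; rewrite (le_trans (lerD (ler_normD _ _) (lexx _)))//.
    rewrite normr1 [`|s * y|]normrM [`|_ * (y ^+ 2 - 1)|]normrM [`|s ^+ 2 / 2|]normrM normrX.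
    rewrite normfV [`|2|]ger0_norm//.
    have h1 : `|y ^+ 2 - 1| <= y ^+ 2 + 1.
      by rewrite (le_trans (ler_normB _ _))// normr1 ger0_norm// sqr_ge0.
    have h2 : `|s| * a <= `|s| ^+ 3 * ((1 + y ^+ 2) / 2).
      apply: ler_pM => //; rewrite -y2; have := sqr_ge0 (a - 1); rewrite /a; nra.
    have h3 : `|s| ^+ 2 / 2 * `|y ^+ 2 - 1| <= `|s| ^+ 3 / 2 * (y ^+ 2 + 1).
      by apply: ler_pM => //; rewrite ?divr_ge0 ?exprn_ge0// ler_pM2r.
    have h4 : 0 <= `|s| ^+ 3 * y ^+ 2 by apply: mulr_ge0; [exact: exprn_ge0|exact: sqr_ge0].
    move: h2 h3; rewrite -/a; nra.
  have he : (1 + y ^+ 2) * expR (- (3 / 8) * y ^+ 2) <= 8 / 3.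
    have := expR_ge1Dx (3 / 8 * y ^+ 2); rewrite mulNr expRN => h.
    rewrite ler_pdivrMr ?expR_gt0//; have := sqr_ge0 y; nra.
  apply: le_trans (ler_normB _ _) _; rewrite [`|gauss 1 y * _|]normrM (ger0_norm g1) (ger0_norm g2).
  have h5 : gauss 1 y * `|1 + s * y + s ^+ 2 / 2 * (y ^+ 2 - 1)| <= `|s| ^+ 3 * (32 / 3 * gauss 4 y).
    apply: le_trans (ler_wpM2l g1 hb) _; rewrite gauss4E.
    rewrite [leLHS](_ : _ = `|s| ^+ 3 * (4 * gauss 4 y * ((1 + y ^+ 2) * expR (- (3 / 8) * y ^+ 2)))); last by ring.
    rewrite ler_wpM2l ?exprn_ge0//.
    rewrite [leRHS](_ : _ = 4 * gauss 4 y * (8 / 3)); last by field.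
    by rewrite ler_wpM2l// mulr_ge0.
  have h6 : gauss 1 (y - s) <= `|s| ^+ 3 * gauss 1 (y - s) by rewrite ler_peMl.
  rewrite (le_trans (lerD h6 h5))// -mulrDr /C0 [leRHS]mulrAC mulrC ler_wpM2r ?exprn_ge0//.
  nra.
have sn0 := normr_ge0 s.
set b := a + 1 / 2; have b0 : 0 <= b by rewrite /b; lra.
set t := s * y - s ^+ 2 / 2.
have gtE : gauss 1 (y - s) = gauss 1 y * expR t.
  rewrite !gaussE -[RHS]mulrA -expRD; by congr (_ * expR _); rewrite /t; field.
have s2 : `|s| ^+ 2 = s ^+ 2 by rewrite -normrX ger0_norm// sqr_ge0.
have tb : `|t| <= `|s| * b.
  rewrite /t (le_trans (ler_normB _ _))// [`|s * y|]normrM [`|s ^+ 2 / 2|]normrM normrX normfV [`|2|]ger0_norm// -/a /b expr2.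
  nra.
have tb1 : `|t| <= b by rewrite (le_trans tb)// ler_piMl// ltW.
have hr : `|expR t - (1 + t + t ^+ 2 / 2)| <= `|s| ^+ 3 * (6 * expR (2 * b)).
  apply: le_trans (expR_remainder2 t) _.
  have h1 : `|t| ^+ 3 <= `|s| ^+ 3 * b ^+ 3 by rewrite -exprMn lerXn2r// ?nnegrE// mulr_ge0.
  have h2 : expR `|t| <= expR b by rewrite ler_expR.
  apply: le_trans (ler_pM _ _ h1 h2) _; rewrite ?exprn_ge0 ?expR_ge0//.
  rewrite -mulrA ler_wpM2l ?exprn_ge0// (_ : 2 * b = b + b); last by ring.
  rewrite expRD mulrA ler_wpM2r ?expR_ge0//.
  have := expR_ge1Dxn 2 b0; rewrite (_ : 3`! = 6)//; lra.
(* These are the terms of order three and four in s contained in t + t^2 / 2. *)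
have hp : `|s ^+ 4 / 8 - s ^+ 3 * y / 2| <= `|s| ^+ 3 * expR (2 * b).
  apply: le_trans (ler_normB _ _) _.
  rewrite [`|_ / 8|]normrM [`|_ / 2|]normrM [`|_ * y|]normrM !normfV !normrX [`|8|]ger0_norm// [`|2|]ger0_norm// -/a.
  have := expR_ge1Dx (2 * b); have s3 : 0 <= `|s| ^+ 3 by rewrite exprn_ge0.
  rewrite (exprS _ 3) /b; nra.
have hbr : `|expR t - (1 + s * y + s ^+ 2 / 2 * (y ^+ 2 - 1))| <= `|s| ^+ 3 * (7 * expR (2 * b)).
  rewrite (_ : _ - _ = (expR t - (1 + t + t ^+ 2 / 2)) + (s ^+ 4 / 8 - s ^+ 3 * y / 2)); last first.
    by rewrite /t; field.
  apply: le_trans (ler_normD _ _) _; apply: le_trans (lerD hr hp) _.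
  by rewrite -mulrDr; apply: ler_wpM2l; rewrite ?exprn_ge0//; lra.
rewrite gtE -mulrBr [`|gauss 1 y * _|]normrM (ger0_norm g1).
apply: le_trans (ler_wpM2l g1 hbr) _.
apply: (@le_trans _ _ (C0 * `|s| ^+ 3 * gauss 4 y)); last first.
  rewrite ler_wpM2l// ?lerDr ?mulr_ge0 ?expR_ge0 ?exprn_ge0//.
rewrite gauss4E.
have hE : expR (- (3 / 8) * y ^+ 2) * expR (2 * b) <= expR 4.
  rewrite -expRD ler_expR /b -y2 -/a; have := sqr_ge0 (3 * a - 8); nra.
rewrite [leLHS](_ : _ = `|s| ^+ 3 * gauss 4 y * (14 * (expR (- (3 / 8) * y ^+ 2) * expR (2 * b)))); last by ring.
rewrite [leRHS](_ : _ = `|s| ^+ 3 * gauss 4 y * (14 * expR 4)); last by rewrite /C0; ring.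
by rewrite ler_wpM2l ?mulr_ge0 ?exprn_ge0//; lra.
Qed.

Definition gauss_const : R := C0.

Lemma gauss_remainder (m v x : R) : 0 < m ->
  `|gauss m (v - x) - gauss m v * (1 + x * (v / m) + x ^+ 2 / 2 * (v ^+ 2 / m ^+ 2 - m^-1))| <=
  gauss_const * (`|x| ^+ 3 / Num.sqrt m ^+ 3) * (gauss m (v - x) + gauss (4 * m) v).
Proof.
move=> m0; set r := Num.sqrt m; have r0 : 0 < r by rewrite sqrtr_gt0.
have rm : m = r ^+ 2 by rewrite sqr_sqrtr// ltW.
have g4 : gauss (4 * m) v = gauss 4 (v / r) / r.
  rewrite !gaussE -/r (_ : 2 * pi * (4 * m) = 2 * pi * 4 * m); last by ring.
  rewrite sqrtrM ?mulr_ge0 ?pi_ge0// invfM -/r [RHS]mulrAC; congr (_ * expR _).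
  by rewrite rm; field; rewrite gt_eqF.
rewrite g4 (gauss_scale v m0) (gauss_scale (v - x) m0) -/r.
have := gauss1_remainder (v / r) (x / r).
rewrite -mulrBl => h.
rewrite -mulrDl (mulrA _ _ r^-1) (mulrAC (gauss 1 (v / r))) -mulrBl [`|_ / r|]normrM normfV (gtr0_norm r0).
rewrite ler_pM2r ?invr_gt0//.
rewrite normrM normfV (gtr0_norm r0) expr_div_n in h.
have -> : 1 + x * (v / m) + x ^+ 2 / 2 * (v ^+ 2 / m ^+ 2 - m^-1) =
  1 + x / r * (v / r) + (x / r) ^+ 2 / 2 * ((v / r) ^+ 2 - 1).
  by rewrite [m]rm; field; rewrite gt_eqF.
by rewrite -!expr_div_n /gauss_const; move: h; rewrite !expr_div_n.
Qed.

Lemma gauss_exp_decay (m v : R) : 0 < m ->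
  gauss m v = 2 * gauss (4 * m) v * expR (- (3 / 8) * (v ^+ 2 / m)).
Proof.
move=> m0; have r0 : 0 < Num.sqrt m by rewrite sqrtr_gt0.
rewrite !gaussE (_ : 2 * pi * (4 * m) = 2 ^+ 2 * (2 * pi * m)); last by ring.
rewrite (sqrtrM _ (sqr_ge0 2)) sqrtr_sqr ger0_norm//.
have -> : expR (- v ^+ 2 / (2 * m)) =
    expR (- v ^+ 2 / (2 * (4 * m))) * expR (- (3 / 8) * (v ^+ 2 / m)) :> R.
  by rewrite -expRD; congr expR; field; rewrite gt_eqF.
by field; rewrite gt_eqF// sqrtr_gt0 !mulr_gt0// pi_gt0.
Qed.

(** The spare exponential of [gauss_exp_decay] beats the power; passing to an even exponent allows
    comparison with a single term of the exponential series. *)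
Lemma gauss_pow_bound (m : R) n : 0 < m ->
  exists2 K : R, 0 <= K & forall v, `|v| ^+ n * gauss m v <= K * gauss (4 * m) v.
Proof.
move=> m0.
pose K0 : R := (8 / 3 * m) ^+ n.+1 * (n.+1)`!%:R.
have K00 : 0 <= K0 by rewrite mulr_ge0// exprn_ge0// !mulr_ge0// ltW.
exists (2 * (1 + K0)); first by rewrite mulr_ge0// addr_ge0.
move=> v; rewrite gauss_exp_decay//.
set e := expR _; set g := gauss _ _; have g0 : 0 <= g := gauss_ge0 _ _.
have e0 : 0 <= e by exact: expR_ge0.
rewrite (_ : _ * _ = (`|v| ^+ n * e) * (2 * g)); last by ring.
rewrite (_ : 2 * _ * _ = (1 + K0) * (2 * g)); last by ring.
rewrite ler_wpM2r// ?mulr_ge0//.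
have e1 : e <= 1 by rewrite expR_le1 mulNr oppr_le0 mulr_ge0// divr_ge0 ?sqr_ge0// ltW.
have h1 : `|v| ^+ n <= 1 + `|v| ^+ (2 * n.+1).
  have [v1|v1] := lerP `|v| 1.
    by rewrite (le_trans (exprn_ile1 _ (normr_ge0 v) v1))// lerDl exprn_ge0.
  apply: (@le_trans _ _ (`|v| ^+ (2 * n.+1))); last by rewrite lerDr.
  by rewrite ler_weXn2l ?ltW//; lia.
have x0 : 0 <= 3 / 8 * (v ^+ 2 / m) by rewrite mulr_ge0// divr_ge0 ?sqr_ge0// ltW.
have h2 : `|v| ^+ (2 * n.+1) * e <= K0.
  have := expR_ge1Dxn n x0; rewrite /e mulNr expRN => h.
  rewrite ler_pdivrMr ?expR_gt0//.
  have hv : `|v| ^+ (2 * n.+1) = (8 / 3 * m) ^+ n.+1 * (3 / 8 * (v ^+ 2 / m)) ^+ n.+1.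
    rewrite exprM -exprMn; congr (_ ^+ _); rewrite -normrX ger0_norm ?sqr_ge0//.
    by field; rewrite gt_eqF.
  have f0 : (0 : R) < (n.+1)`!%:R by rewrite ltr0n fact_gt0.
  rewrite hv /K0 -[leRHS]mulrA; apply: ler_wpM2l.
    by rewrite exprn_ge0// mulr_ge0// ltW.
  rewrite -ler_pdivrMl// mulrC; apply: le_trans h; lra.
rewrite (le_trans (ler_wpM2r e0 h1))// mulrDl mul1r; exact: lerD.
Qed.

Lemma integrable_gauss_pow (m : R) n : 0 < m ->
  mu.-integrable setT (EFin \o (fun v => v ^+ n * gauss m v)).
Proof.
move=> m0; have [K K0 hK] := gauss_pow_bound n m0.
have m40 : 0 < 4 * m by rewrite mulr_gt0.
apply: (@le_integrable _ _ _ mu setT _ _ (fun v => K%:E * (EFin \o gauss (4 * m)) v)%E) => //.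
- apply/measurable_EFinP; apply: measurable_funM; last exact: measurable_gauss.
  exact: measurable_funX.
- move=> v _; rewrite /= lee_fin [`|_ * gauss m _|]normrM [`|_ * gauss _ _|]normrM [`|v ^+ n|]normrX.
  by rewrite (ger0_norm K0) !(ger0_norm (gauss_ge0 _ _)).
- by apply: integrableZl => //; exact: integrable_gauss.
Qed.

Lemma Rintegral_gauss (m : R) : 0 < m -> \int[mu]_v gauss m v = 1.
Proof. by move=> m0; rewrite /Rintegral integral_gauss. Qed.
End gauss.

(** * Integration against a density *)

Section density.
Context {d} {T : measurableType d} {R : realType}.
Variables (mu nu : {sigma_finite_measure set T -> \bar R}) (f : T -> R).
Hypothesis mf : measurable_fun setT f.
Hypothesis f0 : forall x, 0 <= f x.
Hypothesis nuE : forall A, measurable A -> nu A = (\int[mu]_(x in A) (f x)%:E)%E.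
Local Open Scope ereal_scope.

(** Layer-cake argument: [g] is the integral over t of the indicators of its superlevel sets, for
    which the claim is the hypothesis on [nu], and Tonelli's theorem exchanges the integrals. *)
Lemma ge0_integral_density (g : T -> R) : measurable_fun setT g -> (forall x, 0 <= g x)%R ->
  \int[nu]_x (g x)%:E = \int[mu]_x (g x * f x)%:E.
Proof.
move=> mg g0.
pose h (p : T * R) : R := (if (0 <= p.2)%R && (p.2 < g p.1)%R then 1 else 0)%R.
have mh : measurable_fun setT h.
  apply: measurable_fun_ifT => //=; apply: measurable_and.
    exact: measurable_fun_ler.
  apply: measurable_fun_ltr => //; exact: measurableT_comp.
have h0 p : (0 <= h p)%R by rewrite /h; case: ifP.
have gE x : (g x)%:E = \int[lebesgue_measure]_t (h (x, t))%:E.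
  rewrite -[LHS](_ : lebesgue_measure `[0%R, g x[%classic = _); last first.
    rewrite lebesgue_measure_itv/= lte_fin; case: ltP => [_|]; first by rewrite sube0.
    by move=> gx; congr EFin; apply/eqP; rewrite eq_le g0 gx.
  transitivity (\int[lebesgue_measure]_t (\1_(`[0%R, g x[%classic : set R) t)%:E).
    by rewrite integral_indic// setIT.
  apply: eq_integral => t _; rewrite indicE /h/=; congr (_%:E).
  case: (boolP ((0 <= t)%R && (t < g x)%R)) => ht.
    by rewrite mem_set//= in_itv.
  by rewrite memNset//= in_itv/=; exact/negP.
under eq_integral do rewrite gE.
rewrite (@fubini_tonelli _ _ _ _ _ nu lebesgue_measure (EFin \o h))//; last exact/measurable_EFinP.
transitivity (\int[lebesgue_measure]_t \int[mu]_x (h (x, t) * f x)%:E).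
  apply: eq_integral => t _.
  pose A := [set x | (0 <= t)%R && (t < g x)%R].
  have mA : measurable A.
    rewrite (_ : A = (fun x => (0 <= t)%R && (t < g x)%R) @^-1` [set true]); last first.
      by apply/seteqP; split => x /=.
    rewrite -[X in measurable X]setTI; apply: measurable_and => //.
    exact: measurable_fun_ltr.
  have hA x : h (x, t) = \1_A x.
    rewrite indicE /h/= /A; case: ifP => h'; first by rewrite mem_set.
    by rewrite memNset//= h'.
  under eq_integral do rewrite /= hA.
  transitivity (nu A); first by rewrite integral_indic// setIT.
  rewrite nuE// integral_mkcond; apply: eq_integral => x _.
  rewrite patchE hA indicE; case: ifP => _; first by rewrite mul1r.
  by rewrite mul0r.
rewrite -(@fubini_tonelli _ _ _ _ _ mu lebesgue_measure (fun p => (h p * f p.1)%:E)); first last.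
- by move=> p; rewrite lee_fin mulr_ge0.
- apply/measurable_EFinP; apply: measurable_funM => //; exact: measurableT_comp.
apply: eq_integral => x _ /=.
under eq_integral do rewrite EFinM.
rewrite ge0_integralZr//; first by rewrite -gE -EFinM.
- by apply/measurable_EFinP; apply: measurable_fun_pair2 mh.
- by move=> t _; rewrite lee_fin.
- by rewrite lee_fin.
Qed.
End density.
Section real_integrable.
Context {d} {T : measurableType d} {R : realType} (m : {measure set T -> \bar R}).
Implicit Types f g : T -> R.

Lemma integrable_scale (c : R) f : m.-integrable setT (EFin \o f) ->
  m.-integrable setT (EFin \o (fun v => c * f v)).
Proof. by move=> i; have := integrableZl measurableT c i. Qed.

Lemma integrable_add f g : m.-integrable setT (EFin \o f) -> m.-integrable setT (EFin \o g) ->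
  m.-integrable setT (EFin \o (fun v => f v + g v)).
Proof. by move=> i j; have := integrableD measurableT i j. Qed.

Lemma integrable_sub f g : m.-integrable setT (EFin \o f) -> m.-integrable setT (EFin \o g) ->
  m.-integrable setT (EFin \o (fun v => f v - g v)).
Proof. by move=> i j; have := integrableB measurableT i j. Qed.

Lemma integrable_abs f : m.-integrable setT (EFin \o f) ->
  m.-integrable setT (EFin \o (fun v => `|f v|)).
Proof. exact: integrable_norm. Qed.

Lemma integrable_dominated f g : measurable_fun setT f -> (forall v, `|f v| <= g v) ->
  m.-integrable setT (EFin \o g) -> m.-integrable setT (EFin \o f).
Proof.
move=> mf fg ig; apply: (@le_integrable _ _ _ m setT _ _ (EFin \o g)) => //.
  exact/measurable_EFinP.
by move=> v _; rewrite /= lee_fin (le_trans (fg v))// ler_norm.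
Qed.
End real_integrable.

(** * Moments of the Gaussian density *)

Section gauss_moments.
Context {R : realType}.
Notation mu := (@lebesgue_measure R).

Lemma integral_gauss_shift (m x : R) : 0 < m -> (\int[mu]_v (gauss m (v - x))%:E = 1)%E.
Proof.
move=> m0; rewrite -[RHS](integral_gauss m0).
have mg : measurable_fun setT (EFin \o gauss m).
  by apply/measurable_EFinP; exact: measurable_gauss.
have g0 v : (0 <= (EFin \o gauss m) v)%E by rewrite lee_fin gauss_ge0.
rewrite [RHS](ge0_integral_affine (- x) ltr01 mg g0) mul1e.
by apply: eq_integral => v _; rewrite /= mul1r.
Qed.

Lemma integrable_gauss_shift (m x : R) : 0 < m ->
  mu.-integrable setT (EFin \o (fun v => gauss m (v - x))).
Proof.
move=> m0; apply/integrableP; split.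
  apply/measurable_EFinP; apply: measurableT_comp; first exact: measurable_gauss.
  exact: measurable_funB.
under eq_integral do rewrite /= ger0_norm ?gauss_ge0//.
by rewrite integral_gauss_shift// ltry.
Qed.

Lemma Rintegral_gauss_shift (m x : R) : 0 < m -> \int[mu]_v gauss m (v - x) = 1.
Proof.
by move=> m0; rewrite /Rintegral integral_gauss_shift.
Qed.

Lemma integrable_bounded_mul (f g : R -> R) (B : R) : measurable_fun setT f ->
  (forall v, `|f v| <= B) -> mu.-integrable setT (EFin \o g) ->
  mu.-integrable setT (EFin \o (fun v => f v * g v)).
Proof.
move=> mf fB ig.
have mg : measurable_fun setT g by apply/measurable_EFinP; exact: measurable_int ig.
apply: (@le_integrable _ _ _ mu setT _ _ (fun v => B%:E * (EFin \o g) v)%E) => //.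
- by apply/measurable_EFinP; exact: measurable_funM.
- move=> v _; rewrite /= lee_fin !normrM ler_wpM2r// (le_trans (fB v))//; exact: ler_norm.
- exact: integrableZl.
Qed.

Definition gmom (m : R) (f : R -> R) (k : nat) : R :=
  \int[mu]_v (f v * (v ^+ k * gauss m v)).

(** Integrability is assumed term by term, instead of boundedness of [f], because the case f(v) =
    v^2 is used for the fourth moment. *)
Lemma gauss_taylor (m x : R) (f : R -> R) : 0 < m -> measurable_fun setT f ->
  (forall k, mu.-integrable setT (EFin \o (fun v => f v * (v ^+ k * gauss m v)))) ->
  mu.-integrable setT (EFin \o (fun v => f v * gauss m (v - x))) ->
  mu.-integrable setT (EFin \o (fun v => f v * gauss (4 * m) v)) ->
  `|\int[mu]_v (f v * gauss m (v - x)) -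
    (gmom m f 0 + x / m * gmom m f 1 + x ^+ 2 / 2 * (gmom m f 2 / m ^+ 2 - gmom m f 0 / m))| <=
  gauss_const * (`|x| ^+ 3 / Num.sqrt m ^+ 3) *
  (\int[mu]_v `|f v * gauss m (v - x)| + \int[mu]_v `|f v * gauss (4 * m) v|).
Proof.
move=> m0 mf iG ix i4.
pose r v := gauss m (v - x) - gauss m v * (1 + x * (v / m) + x ^+ 2 / 2 * (v ^+ 2 / m ^+ 2 - m^-1)).
set K := gauss_const * _.
pose a0 := 1 - x ^+ 2 / 2 / m; pose a1 := x / m; pose a2 := x ^+ 2 / 2 / m ^+ 2.
pose F k v := f v * (v ^+ k * gauss m v).
have iF k : mu.-integrable setT (EFin \o F k) by exact: iG.
have iZ c k : mu.-integrable setT (EFin \o (fun v => c * F k v)).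
  exact: integrable_scale.
have iD := @integrable_add _ _ _ mu.
have frE v : f v * r v = f v * gauss m (v - x) + (- a0 * F 0%N v + (- a1 * F 1%N v + - a2 * F 2%N v)).
  by rewrite /r /F /a0 /a1 /a2 expr0 expr1; field; rewrite gt_eqF.
have ifr : mu.-integrable setT (EFin \o (fun v => f v * r v)).
  rewrite (_ : (fun v => f v * r v) = (fun v => f v * gauss m (v - x) +
    (- a0 * F 0%N v + (- a1 * F 1%N v + - a2 * F 2%N v)))); last exact/funext/frE.
  exact: (iD _ _ ix (iD _ _ (iZ _ _) (iD _ _ (iZ _ _) (iZ _ _)))).
have -> : \int[mu]_v (f v * gauss m (v - x)) -
    (gmom m f 0 + x / m * gmom m f 1 + x ^+ 2 / 2 * (gmom m f 2 / m ^+ 2 - gmom m f 0 / m)) =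
    \int[mu]_v (f v * r v).
  under [RHS]eq_Rintegral do rewrite frE.
  rewrite RintegralD//; last exact: (iD _ _ (iZ _ _) (iD _ _ (iZ _ _) (iZ _ _))).
  rewrite RintegralD//; last exact: (iD _ _ (iZ _ _) (iZ _ _)).
  rewrite RintegralD// !RintegralZl// -/(gmom m f 0) -/(gmom m f 1) -/(gmom m f 2) /a0 /a1 /a2.
  by field; rewrite gt_eqF.
apply: le_trans (le_normr_Rintegral _ ifr) _ => //.
have ia (g : R -> R) : mu.-integrable setT (EFin \o g) -> mu.-integrable setT (EFin \o (fun v => `|g v|)).
  exact: integrable_abs.
have iK : mu.-integrable setT (EFin \o (fun v => `|f v * gauss m (v - x)| + `|f v * gauss (4 * m) v|)).
  by apply: iD; exact: ia.
rewrite -RintegralD//; [|exact: ia|exact: ia].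
rewrite -RintegralZl//.
apply: le_Rintegral => //.
- exact: ia.
- exact: integrable_scale.
- move=> v _; rewrite /= !normrM [`|gauss m (v - x)|]ger0_norm ?gauss_ge0//.
  rewrite [`|gauss (4 * m) v|]ger0_norm ?gauss_ge0// -mulrDr mulrCA ler_wpM2l//.
  exact: gauss_remainder.
Qed.

Lemma gauss_taylor_bounded (m x B : R) (f : R -> R) : 0 < m -> measurable_fun setT f ->
  (forall v, `|f v| <= B) ->
  `|\int[mu]_v (f v * gauss m (v - x)) -
    (gmom m f 0 + x / m * gmom m f 1 + x ^+ 2 / 2 * (gmom m f 2 / m ^+ 2 - gmom m f 0 / m))| <=
  2 * gauss_const * B * (`|x| ^+ 3 / Num.sqrt m ^+ 3).
Proof.
move=> m0 mf fB; have m40 : 0 < 4 * m by rewrite mulr_gt0.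
have i1 k := integrable_bounded_mul mf fB (integrable_gauss_pow k m0).
have i2 := integrable_bounded_mul mf fB (integrable_gauss_shift x m0).
have i3 := integrable_bounded_mul mf fB (integrable_gauss m40).
apply: le_trans (gauss_taylor m0 mf i1 i2 i3) _.
have h (g : R -> R) : (forall v, 0 <= g v) -> mu.-integrable setT (EFin \o g) ->
    mu.-integrable setT (EFin \o (fun v => f v * g v)) ->
    \int[mu]_v `|f v * g v| <= B * \int[mu]_v g v.
  move=> g0 ig ifg; rewrite -RintegralZl//; apply: le_Rintegral => //.
  - exact: integrable_norm.
  - exact: integrable_scale.
  - by move=> v _; rewrite /= normrM (ger0_norm (g0 v)) ler_wpM2r.
have h1 := h _ (fun v => gauss_ge0 m (v - x)) (integrable_gauss_shift x m0) i2.
have h2 := h _ (gauss_ge0 (4 * m)) (integrable_gauss m40) i3.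
rewrite Rintegral_gauss_shift// mulr1 in h1; rewrite Rintegral_gauss// mulr1 in h2.
rewrite (_ : 2 * _ * _ * _ = gauss_const * (`|x| ^+ 3 / Num.sqrt m ^+ 3) * (B + B)); last by ring.
apply: ler_wpM2l; last exact: lerD.
by apply: mulr_ge0; [apply: mulr_ge0; rewrite ?expR_ge0|apply: divr_ge0; apply: exprn_ge0].
Qed.

(** Divide by x and let x tend to 0, twice. This reads off the coefficients of a Taylor expansion
    and so yields the Gaussian moments without integration by parts. *)
Lemma quadratic_cubic_bound (a b K : R) :
  (forall x, 0 < x <= 1 -> `|a * x + b * x ^+ 2| <= K * x ^+ 3) ->
  a = 0 /\ b = 0.
Proof.
move=> h.
have lim0 (c K' : R) : (forall x : R, 0 < x <= 1 -> `|c| <= K' * x) -> c = 0.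
  move=> hc; apply/eqP; rewrite -normr_le0; apply/ler_addgt0Pr => e e0; rewrite add0r.
  have K1 : 0 < `|K'| + 1 by rewrite ltr_wpDl.
  pose x := Num.min 1 (e / (`|K'| + 1)).
  have x0 : 0 < x by rewrite lt_min ltr01 divr_gt0.
  have x1 : x <= 1 by rewrite ge_min lexx.
  apply: (le_trans (hc x _)); first by rewrite x0.
  apply: (@le_trans _ _ ((`|K'| + 1) * x)).
    by rewrite ler_wpM2r ?(ltW x0)// (le_trans (ler_norm K'))// lerDl.
  by rewrite mulrC -ler_pdivlMr// ge_min lexx orbT.
have K0 : 0 <= K.
  by have := h 1; rewrite ltr01 lexx !expr1n !mulr1 => /(_ isT); apply: le_trans.
have a0 : a = 0.
  apply: (lim0 a (`|b| + K)) => x /andP[x0 x1].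
  have hx : `|a * x + b * x ^+ 2| <= K * x ^+ 3 by apply: h; rewrite x0.
  have e : a * x = (a * x + b * x ^+ 2) - b * x ^+ 2 by ring.
  have : `|a * x| <= K * x ^+ 3 + `|b| * x ^+ 2.
    rewrite e (le_trans (ler_normB _ _))// lerD// normrM normrX (gtr0_norm x0)//.
  rewrite normrM (gtr0_norm x0) => hh.
  have x2 : x ^+ 3 <= x ^+ 2 by rewrite ler_wiXn2l// ltW.
  rewrite -(ler_pM2r x0) (le_trans hh)//.
  rewrite (_ : _ * x * x = `|b| * x ^+ 2 + K * x ^+ 2); last by ring.
  by rewrite addrC lerD// ler_wpM2l.
split=> //; apply: (lim0 b K) => x /andP[x0 x1].
have := h x; rewrite x0 x1 a0 mul0r add0r normrM normrX (gtr0_norm x0) => /(_ isT) hx.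
have x20 : 0 < x ^+ 2 by rewrite exprn_gt0.
by rewrite -(ler_pM2r x20) (le_trans hx)// -mulrA -exprS.
Qed.

(** For f = 1 the shifted integral is 1 for every shift, so the coefficients of x and x^2 in its
    Taylor expansion, which involve the first two moments, must vanish. *)
Lemma gauss_moments12 (m : R) : 0 < m ->
  \int[mu]_v (v * gauss m v) = 0 /\ \int[mu]_v (v ^+ 2 * gauss m v) = m.
Proof.
move=> m0.
have n1 : forall v : R, `|(fun=> 1 : R) v| <= 1 by move=> v; rewrite normr1.
have h1 := fun x => @gauss_taylor_bounded m x 1 (fun=> 1) m0 (measurable_cst _) n1.
have e (g : R -> R) : \int[mu]_v (1 * g v) = \int[mu]_v g v.
  by apply: eq_Rintegral => v _; rewrite mul1r.
pose M1 := \int[mu]_v (v * gauss m v); pose M2 := \int[mu]_v (v ^+ 2 * gauss m v).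
have [|a0 b0] := @quadratic_cubic_bound (M1 / m) ((M2 / m ^+ 2 - m^-1) / 2)
    (2 * gauss_const / Num.sqrt m ^+ 3).
  move=> x /andP[x0 x1]; have := h1 x; rewrite /gmom !e Rintegral_gauss_shift//.
  rewrite Rintegral_gauss//.
  rewrite -/M2 -[\int[mu]_v (v ^+ 1 * gauss m v)]/M1.
  rewrite mulr1 (_ : 1 - (_ + _) = - (M1 / m * x + (M2 / m ^+ 2 - m^-1) / 2 * x ^+ 2)); last by field; rewrite gt_eqF.
  move=> h; rewrite -normrN (le_trans h)// (gtr0_norm x0) -[leRHS]mulrA [_^-1 * _]mulrC//.
split.
  by move/eqP: a0; rewrite mulf_eq0 invr_eq0 (gt_eqF m0) orbF => /eqP.
have h : M2 / m ^+ 2 = m^-1 by move: b0; clear; lra.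
by rewrite -[LHS]/M2 -[M2](@divfK _ (m ^+ 2)) ?expf_neq0 ?gt_eqF// h expr2 mulrA mulVf ?mul1r ?gt_eqF.
Qed.

Lemma integral_shift (f : R -> \bar R) (x : R) : measurable_fun setT f ->
  (\int[mu]_v f (v - x)%R = \int[mu]_v f v)%E.
Proof.
move=> mf.
have h (g : R -> \bar R) : measurable_fun setT g -> (forall v, 0 <= g v)%E ->
    (\int[mu]_v g (v - x)%R = \int[mu]_v g v)%E.
  move=> mg g0; rewrite [RHS](ge0_integral_affine (- x) ltr01 mg g0) mul1e.
  by apply: eq_integral => v _; rewrite mul1r.
rewrite integralE [RHS]integralE; congr (_ - _)%E.
  transitivity (\int[mu]_v (f^\+)%E (v - x)%R)%E.
    by apply: eq_integral => v _; rewrite !funeposE.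
  exact: (h (f^\+)%E (measurable_funepos mf) (fun v => funepos_ge0 f v)).
transitivity (\int[mu]_v (f^\-)%E (v - x)%R)%E.
  by apply: eq_integral => v _; rewrite !funenegE.
exact: (h (f^\-)%E (measurable_funeneg mf) (fun v => funeneg_ge0 f v)).
Qed.

Lemma integrable_shift (g : R -> R) (x : R) : mu.-integrable setT (EFin \o g) ->
  mu.-integrable setT (EFin \o (fun v => g (v - x))).
Proof.
move=> /integrableP[mg ig]; apply/integrableP; split.
  by apply: (measurableT_comp mg); exact: measurable_funB.
rewrite (integral_shift x (f := abse \o (EFin \o g)))//.
exact: measurableT_comp.
Qed.

Lemma Rintegral_shift (g : R -> R) (x : R) : measurable_fun setT g ->
  \int[mu]_v g (v - x) = \int[mu]_v g v.
Proof.
by move=> mg; congr fine; rewrite (integral_shift x (f := EFin \o g))//; exact/measurable_EFinP.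
Qed.

(** For f(v) = v^2 the shifted integral is exactly 1 + x^2. Comparison of the coefficients of x^2
    with the Taylor expansion gives (M4 - 1) / 2 = 1. *)
Lemma gauss_moment4 : \int[mu]_v (v ^+ 4 * gauss 1 v) = 3.
Proof.
have l01 : 0 < 1 :> R by [].
have [M1 M2] := gauss_moments12 l01.
have m40 : 0 < 4 * 1 :> R by rewrite mulr_gt0.
have mg (m : R) k : measurable_fun setT (fun v : R => v ^+ k * gauss m v).
  by apply: measurable_funM; [exact: measurable_funX|exact: measurable_gauss].
pose f (v : R) := v ^+ 2.
have mf : measurable_fun setT f by exact: measurable_funX.
have i1 k : mu.-integrable setT (EFin \o (fun v => f v * (v ^+ k * gauss 1 v))).
  rewrite (_ : (fun v => _) = (fun v => v ^+ (2 + k) * gauss 1 v)); last first.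
    by apply/funext => v; rewrite /f mulrA exprD.
  exact: integrable_gauss_pow.
have ish x k := integrable_shift x (integrable_gauss_pow k l01).
have fE x v : f v * gauss 1 (v - x) = (v - x) ^+ 2 * gauss 1 (v - x) +
    ((2 * x) * ((v - x) ^+ 1 * gauss 1 (v - x)) + x ^+ 2 * ((v - x) ^+ 0 * gauss 1 (v - x))).
  by rewrite /f expr0 expr1; ring.
have i2 x : mu.-integrable setT (EFin \o (fun v => f v * gauss 1 (v - x))).
  rewrite (funext (fE x)).
  by apply: integrable_add => //; apply: integrable_add; apply: integrable_scale.
have I2 x : \int[mu]_v (f v * gauss 1 (v - x)) = 1 + x ^+ 2.
  under eq_Rintegral do rewrite fE.
  rewrite RintegralD//; last by apply: integrable_add; apply: integrable_scale.
  rewrite RintegralD//; [|exact: integrable_scale|exact: integrable_scale].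
  have J k : \int[mu]_v ((v - x) ^+ k * gauss 1 (v - x)) = \int[mu]_v (v ^+ k * gauss 1 v).
    exact: (Rintegral_shift x (mg 1 k)).
  rewrite (RintegralZl _ measurableT (ish x 1%N)) (RintegralZl _ measurableT (ish x 0%N)) !J M2.
  rewrite -[\int[mu]_v (v ^+ 1 * gauss 1 v)]/(\int[mu]_v (v * gauss 1 v)) M1.
  rewrite (_ : \int[mu]_v (v ^+ 0 * gauss 1 v) = 1) ?mulr0 ?add0r ?mulr1//.
  by rewrite -[RHS](Rintegral_gauss l01); apply: eq_Rintegral => v _; rewrite expr0 mul1r.
have i3 : mu.-integrable setT (EFin \o (fun v => f v * gauss (4 * 1) v)).
  exact: integrable_gauss_pow.
have abs (m x : R) : \int[mu]_v `|f v * gauss m (v - x)| = \int[mu]_v (f v * gauss m (v - x)).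
  by apply: eq_Rintegral => v _; rewrite ger0_norm// mulr_ge0 ?sqr_ge0 ?gauss_ge0.
have abs' (m : R) : \int[mu]_v `|f v * gauss m v| = \int[mu]_v (f v * gauss m v).
  by apply: eq_Rintegral => v _; rewrite ger0_norm// mulr_ge0 ?sqr_ge0 ?gauss_ge0.
have h x := gauss_taylor l01 mf i1 (i2 x) i3.
pose M3 := \int[mu]_v (f v * (v * gauss 1 v)); pose M4 := \int[mu]_v (v ^+ 4 * gauss 1 v).
have G0 : gmom 1 f 0 = 1.
  by rewrite -[RHS]M2; apply: eq_Rintegral => v _; rewrite expr0 mul1r.
have G1 : gmom 1 f 1 = M3 by [].
have G2 : gmom 1 f 2 = M4 by apply: eq_Rintegral => v _; rewrite /f mulrA -exprD.
have c0 : 0 <= gauss_const :> R by rewrite /gauss_const mulr_ge0// expR_ge0.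
have [|_ b0] := @quadratic_cubic_bound (- M3) (1 - (M4 - 1) / 2) (gauss_const * 6).
  move=> x /andP[x0 x1]; have := h x.
  rewrite G0 G1 G2 abs abs' I2 (gauss_moments12 m40).2 sqrtr1 expr1n (gtr0_norm x0) !divr1.
  rewrite (_ : 1 + x ^+ 2 - _ = - M3 * x + (1 - (M4 - 1) / 2) * x ^+ 2); last by field.
  move=> /le_trans; apply; rewrite !expr1n divr1 [leLHS]mulrAC.
  rewrite ler_wpM2r ?exprn_ge0 ?(ltW x0)// ler_wpM2l//.
  have x21 : x ^+ 2 <= 1 by rewrite exprn_ile1// ltW.
  by move: x21; clear; lra.
by move: b0; rewrite -/M4; clear; lra.
Qed.
End gauss_moments.

(** * The Berry-Esseen theorem *)

Section density_signed.
Context {d} {T : measurableType d} {R : realType}.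
Variables (mu nu : {sigma_finite_measure set T -> \bar R}) (f : T -> R).
Hypothesis mf : measurable_fun setT f.
Hypothesis f0 : forall x, 0 <= f x.
Hypothesis nuE : forall A, measurable A -> nu A = (\int[mu]_(x in A) (f x)%:E)%E.

Lemma integrable_density (g : T -> R) : measurable_fun setT g ->
  mu.-integrable setT (EFin \o (fun x => g x * f x)) -> nu.-integrable setT (EFin \o g).
Proof.
move=> mg /integrableP[_ ig]; apply/integrableP; split; first exact/measurable_EFinP.
have := @ge0_integral_density _ _ _ mu nu f mf f0 nuE (fun x => `|g x|).
move=> /= ->//; last exact: measurableT_comp.
move: ig; congr (_ < _)%E; apply: eq_integral => x _.
by rewrite /= normrM (ger0_norm (f0 x)).
Qed.

Lemma Rintegral_density (g : T -> R) : measurable_fun setT g ->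
  mu.-integrable setT (EFin \o (fun x => g x * f x)) ->
  \int[nu]_x g x = \int[mu]_x (g x * f x).
Proof.
move=> mg ig; have ing := integrable_density mg ig.
pose p x : R := `|g x| + g x; pose n x : R := `|g x| - g x.
have p0 x : 0 <= p x by rewrite /p -lerBlDr sub0r -normrN ler_norm.
have n0 x : 0 <= n x by rewrite /n subr_ge0 ler_norm.
have mp : measurable_fun setT p by apply: measurable_funD => //; exact: measurableT_comp.
have mn : measurable_fun setT n by apply: measurable_funB => //; exact: measurableT_comp.
have E (h : T -> R) : measurable_fun setT h -> (forall x, 0 <= h x) ->
    \int[nu]_x h x = \int[mu]_x (h x * f x).
  by move=> mh h0; congr fine; exact: (ge0_integral_density mf f0 nuE).
have iagf : mu.-integrable setT (EFin \o (fun x => `|g x| * f x)).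
  rewrite (_ : (fun x => _) = (fun x => `|g x * f x|)); last first.
    by apply/funext => x; rewrite normrM (ger0_norm (f0 x)).
  exact: integrable_abs.
have h1 : \int[nu]_x p x - \int[nu]_x n x = 2 * \int[nu]_x g x.
  rewrite -RintegralB//; last 2 first.
  - by apply: integrable_add => //; exact: integrable_abs.
  - by apply: integrable_sub => //; exact: integrable_abs.
  by rewrite -RintegralZl//; apply: eq_Rintegral => x _; rewrite /p /n; ring.
have h2 : \int[mu]_x (p x * f x) - \int[mu]_x (n x * f x) = 2 * \int[mu]_x (g x * f x).
  rewrite -RintegralB//; last 2 first.
  - rewrite (_ : (fun x => _) = (fun x => `|g x| * f x + g x * f x)); last first.
      by apply/funext => x; rewrite /p mulrDl.
    exact: integrable_add.
  - rewrite (_ : (fun x => _) = (fun x => `|g x| * f x - g x * f x)); last first.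
      by apply/funext => x; rewrite /n mulrBl.
    exact: integrable_sub.
  by rewrite -RintegralZl//; apply: eq_Rintegral => x _; rewrite /p /n; ring.
have : 2 * \int[nu]_x g x = 2 * \int[mu]_x (g x * f x) by rewrite -h1 -h2 !E.
by apply: mulfI.
Qed.
End density_signed.

(** * Gaussian smoothing *)

Section smoothing.
Context {R : realType}.
Notation mu := (@lebesgue_measure R).
Local Notation mR := (measurableTypeR R).

Implicit Types (f g : R -> R) (m a b z x B c : R).

Definition smooth (m : R) (f : R -> R) (z : R) : R := \int[mu]_u (f (z - u) * gauss m u).

Definition bounded_mf (f : R -> R) := measurable_fun setT f /\ exists B : R, forall v, `|f v| <= B.

Lemma bounded_mfD f g : bounded_mf f -> bounded_mf g -> bounded_mf (fun x => f x + g x).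
Proof.
move=> [mf [B hB]] [mg [C hC]]; split; first exact: measurable_funD.
by exists (B + C) => v; rewrite (le_trans (ler_normD _ _))// lerD.
Qed.

Lemma bounded_mf_cst c : bounded_mf (fun=> c).
Proof. by split => //; exists `|c|. Qed.

Lemma bounded_mf_comp f z : bounded_mf f -> bounded_mf (fun u => f (z - u)).
Proof.
move=> [mf [B hB]]; split; last by exists B.
by apply: measurableT_comp => //; exact: measurable_funB.
Qed.

Lemma smooth_integrable m f z : 0 < m -> bounded_mf f ->
  mu.-integrable setT (EFin \o (fun u => f (z - u) * gauss m u)).
Proof.
move=> m0 bf; have [mf [B hB]] := bounded_mf_comp z bf.
exact: (integrable_bounded_mul mf hB (integrable_gauss m0)).
Qed.

Lemma smoothD m f g z : 0 < m -> bounded_mf f -> bounded_mf g ->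
  smooth m (fun x => f x + g x) z = smooth m f z + smooth m g z.
Proof.
move=> m0 bf bg; rewrite /smooth -RintegralD//; [|exact: smooth_integrable..].
by apply: eq_Rintegral => u _; rewrite mulrDl.
Qed.

Lemma smooth_cst m c z : 0 < m -> smooth m (fun=> c) z = c.
Proof.
move=> m0; rewrite /smooth RintegralZl//; last exact: integrable_gauss.
by rewrite Rintegral_gauss// mulr1.
Qed.

Lemma smooth_le m f g z : 0 < m -> bounded_mf f -> bounded_mf g -> (forall v, f v <= g v) ->
  smooth m f z <= smooth m g z.
Proof.
move=> m0 bf bg fg; apply: le_Rintegral => //; [exact: smooth_integrable..|].
by move=> u _; rewrite ler_wpM2r// gauss_ge0.
Qed.

Lemma smooth_norm m f B z : 0 < m -> measurable_fun setT f -> (forall v, `|f v| <= B) ->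
  `|smooth m f z| <= B.
Proof.
move=> m0 mf hB; have bf : bounded_mf f by split=> //; exists B.
have fN v : - B <= f v by have := hB v; rewrite ler_norml => /andP[].
have fB v : f v <= B by have := hB v; rewrite ler_norml => /andP[].
have h1 := smooth_le z m0 (bounded_mf_cst (- B)) bf fN.
have h2 := smooth_le z m0 bf (bounded_mf_cst B) fB.
by rewrite ler_norml; apply/andP; split; [move: h1|move: h2]; rewrite smooth_cst.
Qed.

Lemma smoothE m f z : 0 < m -> bounded_mf f -> (forall x, 0 <= f x) ->
  (smooth m f z)%:E = (\int[mu]_u (f (z - u) * gauss m u)%:E)%E.
Proof.
move=> m0 bf f0; rewrite /smooth /Rintegral fineK//.
exact: (integrable_fin_num measurableT (smooth_integrable z m0 bf)).
Qed.

Lemma smooth_shift m f z x : measurable_fun setT f ->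
  smooth m f (z - x) = \int[mu]_v (f (z - v) * gauss m (v - x)).
Proof.
move=> mf; rewrite /smooth -(@Rintegral_shift _ (fun u => f (z - x - u) * gauss m u) x).
  by apply: eq_Rintegral => v _; congr (f _ * _); ring.
apply: measurable_funM; last exact: measurable_gauss.
by apply: measurableT_comp => //; exact: measurable_funB.
Qed.

Lemma measurable_smooth m f : 0 < m -> bounded_mf f -> measurable_fun setT (smooth m f).
Proof.
move=> m0.
have pos g : bounded_mf g -> (forall x, 0 <= g x) -> measurable_fun setT (smooth m g).
  move=> bg g0; apply/measurable_EFinP.
  rewrite (_ : EFin \o smooth m g = fun z => (\int[mu]_u (g (z - u) * gauss m u)%:E)%E); last first.
    by apply/funext => z; rewrite /= smoothE.
  apply: (@measurable_fun_fubini_tonelli_F _ _ _ _ _ mu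
    (fun p : R * mR => (g (p.1 - p.2) * gauss m p.2)%:E)).
    apply/measurable_EFinP; apply: measurable_funM.
      by apply: measurableT_comp bg.1 _; apply: measurable_funB.
    by apply: measurableT_comp => //; exact: measurable_gauss.
  by move=> p; rewrite lee_fin mulr_ge0 ?gauss_ge0.
move=> bf; have [mf [B hB]] := bf.
(* Adding the bound makes the function nonnegative, where Tonelli's theorem gives measurability. *)
have bfB : bounded_mf (fun x => f x + B) := bounded_mfD bf (bounded_mf_cst B).
rewrite (_ : smooth m f = fun z => smooth m (fun x => f x + B) z - B); last first.
  by apply/funext => z; rewrite smoothD ?smooth_cst ?addrK//; exact: bounded_mf_cst.
apply: measurable_funB => //; apply: pos => // x.
by have := hB x; rewrite ler_norml => /andP[h _]; rewrite -lerBlDr sub0r.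
Qed.

Lemma bounded_mf_smooth m f : 0 < m -> bounded_mf f -> bounded_mf (smooth m f).
Proof.
move=> m0 bf; split; first exact: measurable_smooth.
by have [mf [B hB]] := bf; exists B => v; exact: smooth_norm.
Qed.

(** Once the integrals are exchanged this is the convolution of two Gaussian densities. The exchange
    is made for nonnegative functions, hence again the shift by a bound. *)
Lemma smooth_semigroup a b f z : 0 < a -> 0 < b -> bounded_mf f ->
  smooth a (smooth b f) z = smooth (a + b) f z.
Proof.
move=> a0 b0; have ab0 : 0 < a + b by exact: addr_gt0.
have pos g : bounded_mf g -> (forall x, 0 <= g x) ->
    smooth a (smooth b g) z = smooth (a + b) g z.
  move=> bg g0; have mg := bg.1.
  have s0 x : 0 <= smooth b g x.
    by apply: Rintegral_ge0 => u _; rewrite mulr_ge0 ?gauss_ge0.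
  apply: EFin_inj; rewrite !smoothE//; last exact: bounded_mf_smooth.
  have h0 (p : mR * mR) : (0 <= (g (z - p.2) * (gauss b (p.2 - p.1) * gauss a p.1))%:E)%E.
    by rewrite lee_fin !mulr_ge0 ?gauss_ge0.
  transitivity (\int[mu]_x \int[mu]_w (g (z - w) * (gauss b (w - x) * gauss a x))%:E)%E.
    apply: eq_integral => x _; rewrite EFinM (smoothE _ b0 bg g0) -ge0_integralZr//; last 3 first.
    - apply/measurable_EFinP; apply: measurable_funM; last exact: measurable_gauss.
      by apply: measurableT_comp => //; exact: measurable_funB.
    - by move=> u _; rewrite lee_fin mulr_ge0 ?gauss_ge0.
    - by rewrite lee_fin gauss_ge0.
    rewrite -(@integral_shift _ (fun u => (g (z - x - u) * gauss b u)%:E * (gauss a x)%:E)%E x).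
      by apply: eq_integral => w _; rewrite -EFinM -mulrA; congr ((g _ * _)%:E); ring.
    apply: emeasurable_funM => //; apply/measurable_EFinP; apply: measurable_funM; last exact: measurable_gauss.
    by apply: measurableT_comp => //; exact: measurable_funB.
  rewrite (@fubini_tonelli _ _ _ _ _ mu mu
    (fun p : mR * mR => (g (z - p.2) * (gauss b (p.2 - p.1) * gauss a p.1))%:E))//; last first.
    apply/measurable_EFinP; apply: measurable_funM; last apply: measurable_funM.
    - by apply: measurableT_comp => //; exact: measurable_funB.
    - by apply: measurableT_comp (measurable_gauss _) _; exact: measurable_funB.
    - by apply: measurableT_comp (measurable_gauss _) _.
  apply: eq_integral => w _ /=.
  under eq_integral do rewrite EFinM.
  rewrite ge0_integralZl//; last 3 first.
  - apply/measurable_EFinP; apply: measurable_funM; last exact: measurable_gauss.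
    by apply: measurableT_comp (measurable_gauss _) _; exact: measurable_funB.
  - by move=> u _; rewrite lee_fin mulr_ge0 ?gauss_ge0.
  - by rewrite lee_fin.
  by rewrite (gauss_conv _ b0 a0) (addrC b a) -EFinM.
move=> bf; have [mf [B hB]] := bf.
have bc := bounded_mf_cst B.
have := pos (fun x => f x + B) (bounded_mfD bf bc).
have -> : smooth b (fun x => f x + B) = fun x => smooth b f x + B.
  by apply/funext => x; rewrite smoothD ?smooth_cst.
rewrite !smoothD// ?smooth_cst//; last exact: bounded_mf_smooth.
move=> h; apply: (addIr B); apply: h => x.
by have := hB x; rewrite ler_norml => /andP[h _]; rewrite -lerBlDr sub0r.
Qed.
End smoothing.

(** * Exchange of one summand for a Gaussian one *)

Section lindeberg_step.
Context {R : realType}.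
Notation mu := (@lebesgue_measure R).
Local Notation mR := (measurableTypeR R).
Implicit Types (f g : R -> R) (m a b z x B c : R).

Definition abs_moment3 (nu : probability mR R) : R := \int[nu]_x `|x| ^+ 3.

Definition standardized (nu : probability mR R) : Prop :=
  [/\ nu.-integrable setT (EFin \o (fun x : mR => `|x| ^+ 3)),
      \int[nu]_x x = 0 & \int[nu]_x x ^+ 2 = 1].

Lemma bounded_integrable (nu : probability mR R) f : bounded_mf f ->
  nu.-integrable setT (EFin \o f).
Proof.
move=> [mf [B hB]]; apply: (@integrable_dominated _ mR R nu f (fun=> B) mf hB).
exact: finite_measure_integrable_cst.
Qed.

Section integrals.
Variable nu : probability mR R.
Hypothesis nu3 : nu.-integrable setT (EFin \o (fun x : mR => `|x| ^+ 3)).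

Let i1 : nu.-integrable setT (EFin \o (fun=> 1 : R)).
Proof. exact: finite_measure_integrable_cst. Qed.

Lemma integrable_moment1 : nu.-integrable setT (EFin \o (fun x : mR => x : R)).
Proof.
apply: (@integrable_dominated _ _ _ nu _ (fun x : mR => 1 + `|x| ^+ 3)) => //.
  move=> x; have [x1|x1] := lerP `|x| 1; first by rewrite (le_trans x1)// lerDl exprn_ge0.
  by rewrite (@le_trans _ _ (`|x| ^+ 3)) ?lerDr// -[leLHS]expr1 ler_weXn2l// ltW.
exact: integrable_add.
Qed.

Lemma integrable_moment2 : nu.-integrable setT (EFin \o (fun x : mR => (x : R) ^+ 2)).
Proof.
apply: (@integrable_dominated _ _ _ nu _ (fun x : mR => 1 + `|x| ^+ 3)) => //.
  move=> x; rewrite normrX; have [x1|x1] := lerP `|x| 1.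
    by rewrite (le_trans (exprn_ile1 _ (normr_ge0 _) x1))// lerDl exprn_ge0.
  by rewrite (@le_trans _ _ (`|x| ^+ 3)) ?lerDr// ler_weXn2l// ltW.
exact: integrable_add.
Qed.
End integrals.

(** The law enters the main term only through its mean 0 and variance 1, so this term is common to
    all standardized laws. *)
Lemma smooth_expand (nu : probability mR R) m f B z : 0 < m -> standardized nu ->
  measurable_fun setT f -> (forall v, `|f v| <= B) ->
  let G := gmom m (fun v => f (z - v)) in
  `|\int[nu]_x smooth m f (z - x) - (G 0%N + (G 2%N / m ^+ 2 - G 0%N / m) / 2)| <=
  2 * gauss_const * B * abs_moment3 nu / Num.sqrt m ^+ 3.
Proof.
move=> m0 [nu3 nu1 nu2] mf hB /=; have bf : bounded_mf f by split => //; exists B.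
set G := gmom _ _.
pose h x : R := smooth m f (z - x).
have bh : bounded_mf h by exact: bounded_mf_comp (bounded_mf_smooth m0 bf).
pose c1 := G 1%N / m; pose c2 := (G 2%N / m ^+ 2 - G 0%N / m) / 2.
pose r x : R := h x - (G 0%N + c1 * x + c2 * x ^+ 2).
have I1 := integrable_moment1 nu3; have I2 := integrable_moment2 nu3.
have Ih := bounded_integrable nu bh.
have Ic c : nu.-integrable setT (EFin \o (fun=> c)) by exact: bounded_integrable (bounded_mf_cst c).
have Iq : nu.-integrable setT (EFin \o (fun x : mR => c1 * x + c2 * x ^+ 2 : R)).
  by apply: integrable_add; apply: integrable_scale.
have Ir : nu.-integrable setT (EFin \o r).
  rewrite (_ : r = fun x => h x - (G 0%N + (c1 * x + c2 * x ^+ 2))); last first.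
    by apply/funext => x; rewrite /r addrA.
  by apply: integrable_sub => //; exact: integrable_add.
have -> : \int[nu]_x h x - (G 0%N + c2) = \int[nu]_x r x.
  under [RHS]eq_Rintegral do rewrite /r -addrA.
  rewrite RintegralB//; last exact: integrable_add.
  rewrite RintegralD//; rewrite RintegralD//; [|exact: integrable_scale..].
  have C0 : \int[nu]_(_ in setT) G 0%N = G 0%N by rewrite Rintegral_cst//= probability_setT/= mulr1.
  by rewrite (RintegralZl c1 measurableT I1) (RintegralZl c2 measurableT I2) nu1 nu2 C0; ring.
apply: le_trans (le_normr_Rintegral _ Ir) _ => //.
have -> : 2 * gauss_const * B * abs_moment3 nu / Num.sqrt m ^+ 3 =
    \int[nu]_x (2 * gauss_const * B / Num.sqrt m ^+ 3 * `|x| ^+ 3).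
  by rewrite (RintegralZl _ measurableT nu3) /abs_moment3; ring.
apply: le_Rintegral => //.
- exact: integrable_abs.
- exact: integrable_scale.
- move=> x _; rewrite /r /h smooth_shift//.
  have [mg hg] : measurable_fun setT (fun v : R => f (z - v)) /\ forall v : R, `|f (z - v)| <= B.
    by split=> [|v]; [exact: (bounded_mf_comp z bf).1|].
  have := gauss_taylor_bounded x m0 mg hg.
  rewrite -/G (_ : G 0%N + x / m * G 1%N + _ = G 0%N + c1 * x + c2 * x ^+ 2); last first.
    by rewrite /c1 /c2; ring.
  by move=> /le_trans; apply; rewrite le_eqVlt; apply/orP; left; apply/eqP; ring.
Qed.

Let gauss_law : probability mR R := normal_prob 0 1.

Let gauss_lawE A : measurable A -> gauss_law A = (\int[mu]_(x in A) (gauss 1 x)%:E)%E.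
Proof.
move=> mA; rewrite /gauss_law /= /normal_prob.
by have -> : normal_pdf 0 1 = gauss 1 :> (R -> R) by rewrite gauss_normal_pdf ?sqrtr1.
Qed.

Let gauss_law_integral (g : mR -> R) : measurable_fun setT g ->
  mu.-integrable setT (EFin \o (fun x => g x * gauss 1 x)) ->
  \int[gauss_law]_x g x = \int[mu]_x (g x * gauss 1 x).
Proof. exact: (@Rintegral_density _ mR R mu gauss_law _ (measurable_gauss 1) (gauss_ge0 1) gauss_lawE g). Qed.

Let abs3_integrable : mu.-integrable setT (EFin \o (fun x => `|x| ^+ 3 * gauss 1 x)).
Proof.
rewrite (_ : (fun x => _) = (fun x => `|x ^+ 3 * gauss 1 x|)).
  by apply: integrable_abs; exact: integrable_gauss_pow.
by apply/funext => x; rewrite normrM normrX (ger0_norm (gauss_ge0 _ _)).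
Qed.

Lemma standardized_gauss : standardized gauss_law.
Proof.
have [M1 M2] := @gauss_moments12 R 1 ltr01.
have mn : measurable_fun setT (fun x : mR => `|x| ^+ 3 : R).
  by apply: measurable_funX; exact: normr_measurable.
split.
- exact: (@integrable_density _ mR R mu gauss_law _ (measurable_gauss 1) (gauss_ge0 1) gauss_lawE _ mn abs3_integrable).
- by rewrite gauss_law_integral//; exact: (integrable_gauss_pow 1 ltr01).
- by rewrite gauss_law_integral//; exact: (integrable_gauss_pow 2 ltr01).
Qed.

(** Both [nu] and the Gaussian law are compared with the common main term of [smooth_expand]; for
    the Gaussian law the semigroup property gives variance m + 1. That the bound is proportional to
    the supremum [B] is what the induction in [berry_esseen] exploits. *)
Lemma smooth_lindeberg (nu : probability mR R) m f B z : 0 < m -> standardized nu ->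
  measurable_fun setT f -> (forall v, `|f v| <= B) ->
  `|\int[nu]_x smooth m f (z - x) - smooth (m + 1) f z| <=
  2 * gauss_const * (abs_moment3 nu + abs_moment3 gauss_law) * B / Num.sqrt m ^+ 3.
Proof.
move=> m0 hnu mf hB; have bf : bounded_mf f by split => //; exists B.
have h1 := smooth_expand z m0 hnu mf hB.
have h2 := smooth_expand z m0 standardized_gauss mf hB.
have bh := bounded_mf_comp z (bounded_mf_smooth m0 bf).
have e : \int[gauss_law]_x smooth m f (z - x) = smooth (m + 1) f z.
  rewrite addrC -smooth_semigroup//.
  by rewrite gauss_law_integral//; [exact: bh.1|exact: smooth_integrable (bounded_mf_smooth m0 bf)].
rewrite e in h2; move: h1 h2 => /=; set c := (X in `|_ - X|).
move=> h1 h2; rewrite (_ : _ - _ = (\int[nu]_x smooth m f (z - x) - c) - (smooth (m + 1) f z - c)); last by ring.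
rewrite (le_trans (ler_normB _ _))// (le_trans (lerD h1 h2))// le_eqVlt; apply/orP; left; apply/eqP; ring.
Qed.

Definition lindeberg_const (nu : probability mR R) : R :=
  2 * gauss_const * (abs_moment3 nu + abs_moment3 gauss_law).

Lemma lindeberg_const_ge0 nu : 0 <= lindeberg_const nu.
Proof.
rewrite /lindeberg_const /gauss_const mulr_ge0 ?mulr_ge0 ?expR_ge0//.
by rewrite addr_ge0// Rintegral_ge0// => x _; rewrite exprn_ge0.
Qed.
End lindeberg_step.

(** * From smoothed to exact distribution functions *)

Section berry_esseen.
Context {R : realType}.
Notation mu := (@lebesgue_measure R).
Local Notation mR := (measurableTypeR R).
Implicit Types (f g : R -> R) (m a b z x B c : R).

Definition step (z : R) : R := if 0 <= z then 1 else 0.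

Lemma step_ge0 z : 0 <= step z. Proof. by rewrite /step; case: ifP. Qed.
Lemma step_le1 z : step z <= 1. Proof. by rewrite /step; case: ifP. Qed.
Lemma step_nd : {homo step : x y / x <= y}.
Proof.
move=> x y xy; rewrite /step; case: ifPn => // x0; last by case: ifP.
by rewrite (le_trans x0).
Qed.

Definition cdflike f := {homo f : x y / x <= y} /\ forall x, 0 <= f x <= 1.

Lemma cdflike_bounded f : cdflike f -> bounded_mf f.
Proof.
move=> [nd h01]; split.
  by apply: nondecreasing_measurable => // x y _ _; exact: nd.
by exists 1 => v; have /andP[h0 h1] := h01 v; rewrite ger0_norm.
Qed.

Lemma cdflike_step : cdflike step.
Proof. by split=> [|x]; [exact: step_nd|rewrite step_ge0 step_le1]. Qed.

Lemma cdflike_smooth m f : 0 < m -> cdflike f -> cdflike (smooth m f).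
Proof.
move=> m0 cf; have bf := cdflike_bounded cf; have [nd h01] := cf; split.
  move=> x y xy; apply: le_Rintegral => //; [exact: smooth_integrable..|].
  by move=> u _; rewrite ler_wpM2r ?gauss_ge0// nd// lerD2r.
move=> x.
have f0 v : 0 <= f v by have /andP[] := h01 v.
have f1 v : f v <= 1 by have /andP[] := h01 v.
have h1 := smooth_le x m0 (bounded_mf_cst 0) bf f0.
have h2 := smooth_le x m0 bf (bounded_mf_cst 1) f1.
by apply/andP; split; [move: h1|move: h2]; rewrite smooth_cst.
Qed.

(** The distribution function of a sum of [k] independent variables of law [nu], obtained by
    repeated convolution; [step] belongs to the empty sum. *)
Fixpoint sum_cdf (nu : probability mR R) (k : nat) : R -> R :=
  if k is k'.+1 then fun z => \int[nu]_x sum_cdf nu k' (z - x) else step.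

Definition normal_cdf (k : nat) : R -> R := if k is 0 then step else smooth k%:R step.

Lemma cdflike_normal k : cdflike (normal_cdf k).
Proof.
case: k => [|k]; first exact: cdflike_step.
by apply: cdflike_smooth => //; exact: cdflike_step.
Qed.

Lemma smooth_normal_cdf m k z : 0 < m -> smooth m (normal_cdf k) z = smooth (m + k%:R) step z.
Proof.
move=> m0; case: k => [|k]; first by rewrite addr0.
by rewrite smooth_semigroup//; exact: cdflike_bounded cdflike_step.
Qed.

Lemma normal_cdf_lipschitz k z t : 0 <= t ->
  normal_cdf k.+1 (z + t) <= normal_cdf k.+1 z + t / Num.sqrt k.+1%:R.
Proof.
move=> t0; have k0 : (0 : R) < k.+1%:R by [].
have bs := cdflike_bounded cdflike_step.
have i1 (w : R) := smooth_integrable w k0 bs.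
rewrite -lerBlDl /= /smooth -RintegralB//.
have ii : mu.-integrable setT (EFin \o (\1_(`]z, z + t]%classic : set R) : R -> R)).
  exact: integrable_indic_itv.
(* The difference of the two steps is the indicator of ]z, z + t], and the Gaussian density of
   variance k + 1 is at most 1 / sqrt (k + 1). *)
apply: (@le_trans _ _ (\int[mu]_u ((Num.sqrt k.+1%:R)^-1 * \1_(`]z, z + t]%classic : set R) u))).
  apply: le_Rintegral => //; [exact: integrable_sub|exact: integrable_scale|].
  move=> u _; rewrite -mulrBl indicE.
  have gk : gauss k.+1%:R u <= (Num.sqrt k.+1%:R)^-1.
    apply: le_trans (gauss_peak u k0) _; rewrite lef_pV2 ?posrE ?sqrtr_gt0//; last first.
      by rewrite !mulr_gt0// pi_gt0.
    rewrite ler_wsqrtr// ler_peMl ?ltW//; have := @pi_ge2 R; lra.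
  rewrite /step; case: (boolP (0 <= z - u)) => zu.
    have -> : 0 <= z + t - u by move: zu t0; lra.
    by rewrite subrr mul0r mulr_ge0// invr_ge0.
  case: (boolP (0 <= z + t - u)) => ztu; last by rewrite subrr mul0r mulr_ge0// invr_ge0.
  rewrite mem_set/=; first by rewrite subr0 mul1r mulr1.
  by rewrite in_itv/=; move: zu ztu; rewrite -ltNge; lra.
rewrite RintegralZl//.
have -> : \int[mu]_u \1_(`]z, z + t]%classic : set R) u = t.
  transitivity (fine (lebesgue_measure (`]z, z + t]%classic : set R))).
    by rewrite /Rintegral integral_indic// setIT.
  rewrite lebesgue_measure_itv/= lte_fin ltrDl; case: ltP => t1.
    by rewrite -EFinB/= addrAC subrr add0r.
  by apply/eqP; rewrite eq_le t0 t1.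
by rewrite mulrC.
Qed.

Section clt.
Variable nu : probability mR R.
Hypothesis hnu : standardized nu.
Notation F := (sum_cdf nu).
Notation K := (lindeberg_const nu).

Lemma cdflike_sum k : cdflike (F k).
Proof.
elim: k => [|k IH] /=; first exact: cdflike_step.
have [nd h01] := IH; have bF := cdflike_bounded IH.
have I z : nu.-integrable setT (EFin \o (fun x => F k (z - x))).
  exact: bounded_integrable (bounded_mf_comp z bF).
split.
  move=> x y xy; apply: le_Rintegral => // u _; apply: nd; by rewrite lerD2r.
move=> z; apply/andP; split; first by apply: Rintegral_ge0 => x _; have /andP[] := h01 (z - x).
have -> : 1 = \int[nu]_x (cst (1 : R)) x by rewrite Rintegral_cst//= probability_setT mulr1.
apply: le_Rintegral => //; first exact: bounded_integrable (bounded_mf_cst 1).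
by move=> x _; have /andP[] := h01 (z - x).
Qed.

Lemma smooth_sum_cdfS m k z : 0 < m -> smooth m (F k.+1) z = \int[nu]_x smooth m (F k) (z - x).
Proof.
move=> m0; have cF := cdflike_sum k; have bF := cdflike_bounded cF; have [mF _] := bF.
have F0 x : 0 <= F k x by have /andP[] := cF.2 x.
have bF1 := cdflike_bounded (cdflike_sum k.+1).
have F10 x : 0 <= F k.+1 x by have /andP[] := (cdflike_sum k.+1).2 x.
have bS := bounded_mf_comp z (bounded_mf_smooth m0 bF).
apply: EFin_inj; rewrite smoothE//.
rewrite /Rintegral fineK; last exact: (integrable_fin_num measurableT (bounded_integrable nu bS)).
transitivity (\int[mu]_u \int[nu]_x (F k (z - u - x) * gauss m u)%:E)%E.
  apply: eq_integral => u _.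
  have I := bounded_integrable nu (bounded_mf_comp (z - u) bF).
  rewrite EFinM [X in (X%:E * _)%E]/= /Rintegral fineK ?(integrable_fin_num measurableT I)//.
  rewrite -ge0_integralZr//.
  - exact: (measurable_int _ I).
  - by move=> x _; rewrite lee_fin.
  - by rewrite lee_fin gauss_ge0.
rewrite (@fubini_tonelli _ _ _ _ _ mu nu (fun p : mR * mR => (F k (z - p.1 - p.2) * gauss m p.1)%:E))//.
- apply: eq_integral => x _; rewrite /= smoothE//.
  by apply: eq_integral => u _; congr ((F k _ * _)%:E); ring.
- apply/measurable_EFinP; apply: measurable_funM; last by apply: measurableT_comp (measurable_gauss _) _.
  apply: (measurableT_comp mF); apply: measurable_funB; last exact: measurable_snd.
  by apply: measurable_funB => //; exact: measurable_fst.
- by move=> p; rewrite lee_fin mulr_ge0 ?gauss_ge0.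
Qed.

Let M3 (m : R) := Num.sqrt m ^+ 3.

(** [F k] is split into its difference with [normal_cdf k], which has a small supremum and is
    exchanged at variance [m], and [normal_cdf k] itself, which is Gaussian and raises the variance
    to m + k. *)
Lemma sum_cdf_step m k z (D : R) : 0 < m -> (forall w, `|F k w - normal_cdf k w| <= D) ->
  `|smooth m (F k.+1) z - smooth (m + 1) (F k) z| <= K * D / M3 m + K / M3 (m + k%:R).
Proof.
move=> m0 hD; rewrite smooth_sum_cdfS//.
have bF := cdflike_bounded (cdflike_sum k).
have bN := cdflike_bounded (cdflike_normal k).
pose Dl w := F k w - normal_cdf k w.
have bD : bounded_mf Dl.
  by split; [exact: measurable_funB bF.1 bN.1|exists D].
have FE : F k = fun w => Dl w + normal_cdf k w by apply/funext => w; rewrite /Dl subrK.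
have m10 : 0 < m + 1 by exact: addr_gt0.
have mk0 : 0 < m + k%:R by rewrite ltr_wpDr.
have sE w : smooth m (F k) w = smooth m Dl w + smooth (m + k%:R) step w.
  by rewrite {1}FE smoothD// smooth_normal_cdf.
have bs := cdflike_bounded cdflike_step.
have -> : \int[nu]_x smooth m (F k) (z - x) =
    \int[nu]_x smooth m Dl (z - x) + \int[nu]_x smooth (m + k%:R) step (z - x).
  under eq_Rintegral do rewrite sE.
  rewrite RintegralD//; apply: bounded_integrable; apply: bounded_mf_comp;
    exact: bounded_mf_smooth.
have -> : smooth (m + 1) (F k) z = smooth (m + 1) Dl z + smooth (m + k%:R + 1) step z.
  by rewrite {1}FE smoothD// smooth_normal_cdf// addrAC.
have h1 := smooth_lindeberg z m0 hnu bD.1 hD.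
have s1 v : `|step v| <= 1 by rewrite ger0_norm ?step_ge0 ?step_le1.
have h2 := smooth_lindeberg z mk0 hnu bs.1 s1.
rewrite mulr1 in h2.
rewrite opprD addrACA.
by rewrite (le_trans (ler_normD _ _))// lerD.
Qed.

(** At step k the Gaussian variables still present have total variance n - (k + 1); the additional
    smoothing [l] keeps the denominators away from 0 up to the last step. *)
Lemma sum_cdf_telescope (l : nat) n j z (D : nat -> R) : (0 < l)%N -> (j <= n)%N ->
  (forall k w, (k < j)%N -> `|F k w - normal_cdf k w| <= D k) ->
  `|smooth ((n - j + l)%N%:R) (F j) z - smooth ((n + l)%N%:R) step z| <=
  \sum_(k < j) (K * D k / M3 (n - k.+1 + l)%N%:R + K / M3 (n + l).-1%:R).
Proof.
move=> l0; elim: j => [|j IH] jn hD.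
  by rewrite subn0 /= subrr normr0 big_ord0.
rewrite big_ord_recr/=; apply: le_trans (ler_distD (smooth ((n - j + l)%N%:R) (F j) z) _ _) _.
rewrite [leRHS]addrC lerD//; last by apply: IH => [|k w kj]; [exact: ltnW|apply: hD; exact: ltnW].
have m0 : (0 : R) < (n - j.+1 + l)%N%:R by rewrite ltr0n addn_gt0 l0 orbT.
have := sum_cdf_step z m0 (fun w => hD j w (ltnSn j)).
have -> : (n - j.+1 + l)%N%:R + 1 = (n - j + l)%N%:R :> R by rewrite natr1; congr (_%:R); lia.
by have -> : (n - j.+1 + l)%N%:R + j%:R = (n + l).-1%:R :> R by rewrite -natrD; congr (_%:R); lia.
Qed.

(** Chebyshev's inequality for the window |u| <= 2 sqrt l, which misses at most a quarter of the
    Gaussian mass; the indicator of its complement is bounded by u^2 / (4 l). *)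
Lemma gauss_concentration (l d D c : R) (f : R -> R) : 0 < l -> bounded_mf f ->
  0 <= c -> 0 <= D + d ->
  (forall u, `|u| <= 2 * Num.sqrt l -> d - c <= f u) -> (forall u, - D <= f u) ->
  d - c - (D + d) / 4 <= \int[mu]_u (f u * gauss l u).
Proof.
move=> l0 bf c0 Dd0 fd fD; have [_ M2] := gauss_moments12 l0.
have r0 : 0 < Num.sqrt l by rewrite sqrtr_gt0.
have rE : Num.sqrt l ^+ 2 = l by rewrite sqr_sqrtr// ltW.
have e : d - c - (D + d) / 4 =
    \int[mu]_u ((d - c) * gauss l u - (D + d) / (4 * l) * (u ^+ 2 * gauss l u)).
  rewrite RintegralB//; [|exact: integrable_scale (integrable_gauss l0)|
    exact: integrable_scale (integrable_gauss_pow 2 l0)].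
  rewrite (RintegralZl _ measurableT (integrable_gauss l0)).
  rewrite (RintegralZl _ measurableT (integrable_gauss_pow 2 l0)) Rintegral_gauss// M2.
  by field; rewrite gt_eqF.
rewrite e; have [mf [B hB]] := bf; apply: le_Rintegral => //.
- apply: integrable_sub; first exact: integrable_scale (integrable_gauss l0).
  exact: integrable_scale (integrable_gauss_pow 2 l0).
- exact: integrable_bounded_mul mf hB (integrable_gauss l0).
move=> u _; rewrite [X in _ - X]mulrA -mulrBl ler_wpM2r ?gauss_ge0//.
have q0 : 0 <= (D + d) / (4 * l) * u ^+ 2.
  by rewrite mulr_ge0 ?sqr_ge0// divr_ge0// mulr_ge0// ltW.
have [ua|ua] := lerP `|u| (2 * Num.sqrt l).
  by apply: le_trans (fd u ua); rewrite lerBlDr lerDl.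
apply: le_trans (fD u).
suff : D + d <= (D + d) / (4 * l) * u ^+ 2 by move: c0; clear; lra.
have u2 : 4 * l <= u ^+ 2.
  rewrite -[u ^+ 2]ger0_norm ?sqr_ge0// normrX -rE.
  have -> : 4 * Num.sqrt l ^+ 2 = (2 * Num.sqrt l) ^+ 2 by ring.
  by rewrite lerXn2r ?nnegrE ?mulr_ge0// ?ltW.
rewrite -[leLHS]mulr1 -mulrA ler_wpM2l// ler_pdivlMl ?mulr1//.
by rewrite mulr_gt0.
Qed.

(** After a shift of z by 2 sqrt l the window of the smoothing lies on one side of z, where
    monotonicity of [G] preserves the gap at z while the normal distribution function varies by at
    most 4 sqrt l / sqrt (n + 1). The factor 1/3 of [D], being less than 1, will let the supremum of
    the gap be absorbed. *)
Lemma desmoothing (l D th : R) (n : nat) (G : R -> R) : 0 < l -> cdflike G ->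
  (forall w, `|G w - normal_cdf n.+1 w| <= D) ->
  (forall w, `|smooth l G w - smooth l (normal_cdf n.+1) w| <= th) ->
  forall z, `|G z - normal_cdf n.+1 z| <=
    D / 3 + 4 / 3 * (th + 4 * (Num.sqrt l / Num.sqrt n.+1%:R)).
Proof.
move=> l0 cG hD hth z; set N := normal_cdf n.+1.
have cN : cdflike N := cdflike_normal n.+1.
have [bG bN] := (cdflike_bounded cG, cdflike_bounded cN).
have r0 : 0 < Num.sqrt l by rewrite sqrtr_gt0.
have n0 : 0 < Num.sqrt n.+1%:R :> R by rewrite sqrtr_gt0.
set a := 2 * Num.sqrt l; set c := 4 * (Num.sqrt l / Num.sqrt n.+1%:R).
have a0 : 0 <= a by rewrite mulr_ge0// ltW.
have c0 : 0 <= c by rewrite mulr_ge0// divr_ge0// ltW.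
have lip x y : x <= y -> y <= x + 2 * a -> N y <= N x + c.
  move=> xy yx; rewrite -(subrK x y) addrC.
  apply: (le_trans (@normal_cdf_lipschitz n x (y - x) _)); first by rewrite subr_ge0.
  rewrite lerD2l ler_pdivrMr// /c mulrA divfK ?gt_eqF//.
  by move: yx; rewrite /a; clear; lra.
have bDl x : bounded_mf (fun u => G (x - u) - N (x - u)).
  have := bounded_mf_comp x bG; have := bounded_mf_comp x bN.
  move=> [m1 [B1 h1]] [m2 [B2 h2]]; split; first exact: measurable_funB.
  by exists (B2 + B1) => v; rewrite (le_trans (ler_normB _ _))// lerD.
have bDl' x : bounded_mf (fun u => N (x - u) - G (x - u)).
  have := bounded_mf_comp x bN; have := bounded_mf_comp x bG.
  move=> [m1 [B1 h1]] [m2 [B2 h2]]; split; first exact: measurable_funB.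
  by exists (B2 + B1) => v; rewrite (le_trans (ler_normB _ _))// lerD.
have sE x : smooth l G x - smooth l N x = \int[mu]_u ((G (x - u) - N (x - u)) * gauss l u).
  rewrite /smooth -RintegralB//; [|exact: smooth_integrable..].
  by apply: eq_Rintegral => u _; rewrite mulrBl.
have sE' x : smooth l N x - smooth l G x = \int[mu]_u ((N (x - u) - G (x - u)) * gauss l u).
  rewrite /smooth -RintegralB//; [|exact: smooth_integrable..].
  by apply: eq_Rintegral => u _; rewrite mulrBl.
have hDz w : - D <= G w - N w <= D by rewrite -ler_norml.
have fin d : d - c - (D + d) / 4 <= th -> d <= D / 3 + 4 / 3 * (th + c) by clear; lra.
rewrite ler_norml; apply/andP; split.
  rewrite lerNl opprB; apply: fin.
  have := hth (z - a); rewrite distrC => /(le_trans (ler_norm _)); apply: le_trans.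
  rewrite sE'; apply: gauss_concentration => //.
  - by have /andP[_] := hDz z; move=> h; move: h; clear; lra.
  - move=> u; rewrite -/a ler_norml => /andP[u1 u2].
    have h1 : G (z - a - u) <= G z by apply: cG.1; move: u1; clear; lra.
    have h2 : N z <= N (z - a - u) + c by apply: lip; move: u1 u2; clear; lra.
    by move: h1 h2; clear; lra.
  - by move=> u; have /andP[_] := hDz (z - a - u); clear; lra.
apply: fin.
have := hth (z + a) => /(le_trans (ler_norm _)); apply: le_trans.
rewrite sE; apply: gauss_concentration => //.
- by have /andP[] := hDz z; clear; lra.
- move=> u; rewrite -/a ler_norml => /andP[u1 u2].
  have h1 : G z <= G (z + a - u) by apply: cG.1; move: u2; clear; lra.
  have h2 : N (z + a - u) <= N z + c by apply: lip; move: u1 u2; clear; lra.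
  by move: h1 h2; clear; lra.
- by move=> u; have /andP[] := hDz (z + a - u).
Qed.

(** Telescoping, by j^(-3/2) <= 4 (j^(-1/2) - (j+1)^(-1/2)): the bound sqrt (j+1) <= 3/2 sqrt j
    gives the constant 15/4. *)
Lemma sum_inv_sqrt3 (l n : nat) : (0 < l)%N ->
  \sum_(k < n) (Num.sqrt (n - k.+1 + l)%N%:R ^+ 3)^-1 <= 4 / Num.sqrt l%:R :> R.
Proof.
move=> l0.
have key (j : nat) : (0 < j)%N ->
    (Num.sqrt j%:R ^+ 3)^-1 <= 4 * ((Num.sqrt j%:R)^-1 - (Num.sqrt j.+1%:R)^-1) :> R.
  move=> j0; set p : R := Num.sqrt j%:R; set q : R := Num.sqrt j.+1%:R.
  have p0 : 0 < p by rewrite sqrtr_gt0 ltr0n.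
  have q0 : 0 < q by rewrite sqrtr_gt0.
  have p2 : p ^+ 2 = j%:R by rewrite sqr_sqrtr.
  have q2 : q ^+ 2 = p ^+ 2 + 1 by rewrite p2 sqr_sqrtr// natr1.
  have p1 : 1 <= p ^+ 2 by rewrite p2 ler1n.
  have pq : p < q by rewrite ltr_sqrt ?ltr0n// ltr_nat.
  have qp : q <= 3 / 2 * p.
    rewrite -(@ler_pXn2r _ 2)// ?nnegrE ?mulr_ge0 ?ltW// exprMn q2.
    by move: p1; clear; nra.
  have -> : p^-1 - q^-1 = (p * q * (p + q))^-1.
    have h : (q - p) * (p + q) = 1.
      have -> : (q - p) * (p + q) = q ^+ 2 - p ^+ 2 by ring.
      by rewrite q2; ring.
    have pq0 : p + q != 0 by rewrite gt_eqF// addr_gt0.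
    have -> : p^-1 - q^-1 = ((q - p) * (p + q)) / (p * q * (p + q)).
      by field; rewrite pq0 !gt_eqF.
    by rewrite h div1r.
  rewrite -[leLHS]div1r ler_pdivrMr ?exprn_gt0// mulrAC ler_pdivlMr ?mulr_gt0 ?addr_gt0//.
  rewrite mul1r (_ : p ^+ 3 = p * p * p); last by ring.
  have h1 : p * q <= 3 / 2 * (p * p) by rewrite mulrCA ler_wpM2l// ltW.
  have h2 : p + q <= 5 / 2 * p by move: qp; clear; lra.
  apply: (@le_trans _ _ ((3 / 2 * (p * p)) * (5 / 2 * p))).
    by apply: ler_pM => //; rewrite ?mulr_ge0 ?addr_ge0// ltW.
  have : 0 <= p * p * p by rewrite !mulr_ge0// ltW.
  by clear; lra.
apply: (@le_trans _ _ (4 * ((Num.sqrt l%:R)^-1 - (Num.sqrt (n + l)%N%:R)^-1))); last first.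
  by rewrite ler_wpM2l// lerBlDr lerDl invr_ge0.
elim: n => [|n IH]; first by rewrite big_ord0 add0n subrr mulr0.
rewrite big_ord_recl/= subn1/= addSn.
under eq_bigr do rewrite /bump/= add1n subSS.
have := key (n + l)%N; rewrite addn_gt0 l0 orbT => /(_ isT) h.
apply: le_trans (lerD h IH) _.
by rewrite -mulrDr ler_wpM2l// addrC addrA subrK.
Qed.
End clt.

(** Strong induction on n. For k >= n / 4 the bound for k summands is at most 2 B / sqrt n; for
    smaller k the trivial bound 1 is enough, since the remaining variance is of order n. The
    exchange errors then add up to a small multiple of B / sqrt n plus a constant over sqrt n. *)
Theorem berry_esseen (nu : probability mR R) : standardized nu ->
  exists2 B : R, 0 <= B & forall (n : nat) z, (0 < n)%N ->
    `|sum_cdf nu n z - normal_cdf n z| <= B / Num.sqrt n%:R.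
Proof.
move=> hnu; set K := lindeberg_const nu; have K0 : 0 <= K := lindeberg_const_ge0 nu.
pose F := sum_cdf nu; pose N := normal_cdf.
have diff1 n w : `|F n w - N n w| <= 1.
  have /andP[f0 f1] := (cdflike_sum nu n).2 w; have /andP[n0 n1] := (cdflike_normal n).2 w.
  by rewrite ler_norml; move: f0 f1 n0 n1; rewrite /F /N; clear; lra.
(* The extra smoothing depends on the law only, and is so strong that the induction hypothesis
   contributes at most B / 4 to the final bound. *)
have [l l0 lK] : exists2 l : nat, (0 < l)%N & 64 * K <= Num.sqrt l%:R.
  exists (Num.truncn ((64 * K) ^+ 2)).+1 => //.
  have k0 : 0 <= 64 * K by rewrite mulr_ge0.
  rewrite -{1}(ger0_norm k0) -sqrtr_sqr ler_wsqrtr//.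
  by rewrite ltW// truncnS_gt.
set s : R := Num.sqrt l%:R; have s0 : 0 < s by rewrite sqrtr_gt0 ltr0n.
pose B : R := 64 * (K + s); have B0 : 0 <= B by rewrite mulr_ge0// addr_ge0// ltW.
exists B => // n; elim/ltn_ind: n => -[//|n] IH z _.
set m := n.+1; have m0 : (0 : R) < m%:R by [].
set t : R := Num.sqrt m%:R; have t0 : 0 < t by rewrite sqrtr_gt0.
have t2 : t ^+ 2 = m%:R by rewrite sqr_sqrtr// ltW.
(* For k = 0 both distribution functions are the same step. *)
pose D k : R := if k is 0%N then 0 else Num.min 1 (B / Num.sqrt k%:R).
have hD k w : (k < m)%N -> `|F k w - N k w| <= D k.
  case: k => [|k] km; first by rewrite /= subrr normr0.
  by rewrite /= le_min diff1 IH.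
have hDk (k : 'I_m) : D k / Num.sqrt (m - k.+1 + l)%N%:R ^+ 3 <=
    2 * B / t / Num.sqrt (m - k.+1 + l)%N%:R ^+ 3 + 4 / t ^+ 3.
  set j := (m - k.+1 + l)%N; have j0 : (0 < j)%N by rewrite addn_gt0 l0 orbT.
  have sj : 0 < Num.sqrt j%:R :> R by rewrite sqrtr_gt0 ltr0n.
  have A1 : 0 <= 2 * B / t / Num.sqrt j%:R ^+ 3.
    apply: divr_ge0; last exact: exprn_ge0 (ltW sj).
    by apply: divr_ge0 (mulr_ge0 (ler0n _ 2) B0) (ltW t0).
  have A2 : 0 <= 4 / t ^+ 3 by rewrite divr_ge0// exprn_ge0// ltW.
  case ke : (k : nat) => [|k']; first by rewrite mul0r addr_ge0.
  rewrite [D _]/= -ke.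
  have k0 : (0 : R) < k%:R by rewrite ltr0n ke.
  have [mk|mk] := leqP m (4 * k)%N.
    rewrite -[leLHS]addr0 lerD// ler_wpM2r ?invr_ge0 ?exprn_ge0 ?(ltW sj)//.
    rewrite ge_min; apply/orP; right.
    rewrite ler_pdivrMr ?sqrtr_gt0// (_ : 2 * B / t * _ = B * (2 * Num.sqrt k%:R / t)); last by ring.
    rewrite ler_peMr// ler_pdivlMr// mul1r /t.
    have -> : 2 * Num.sqrt k%:R = Num.sqrt (2 ^+ 2 * k%:R) :> R.
      by rewrite sqrtrM ?sqr_ge0// sqrtr_sqr ger0_norm.
    by rewrite ler_wsqrtr// -natrX -natrM ler_nat.
  rewrite -[leLHS]add0r lerD//.
  apply: (@le_trans _ _ ((Num.sqrt j%:R ^+ 3)^-1)).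
    by rewrite ler_piMl ?invr_ge0 ?exprn_ge0 ?(ltW sj)// ge_min lexx.
  rewrite -[leLHS]div1r ler_pdivrMr ?exprn_gt0// mulrAC ler_pdivlMr ?exprn_gt0// mul1r.
  have tj : t <= 4 / 3 * Num.sqrt j%:R.
    rewrite -(@ler_pXn2r _ 2)// ?nnegrE ?mulr_ge0 ?(ltW t0) ?(ltW sj)//.
    rewrite exprMn t2 sqr_sqrtr//.
    have : (3 * m <= 4 * j)%N by rewrite /j; move: mk l0; clear; lia.
    rewrite -(ler_nat R) !natrM => h.
    by rewrite (_ : (4 / 3) ^+ 2 = 16 / 9 :> R); [move: h; have := ler0n R j; clear; lra|field].
  apply: (@le_trans _ _ ((4 / 3 * Num.sqrt j%:R) ^+ 3)).
    by rewrite lerXn2r// nnegrE ?mulr_ge0 ?(ltW t0) ?(ltW sj).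
  rewrite exprMn ler_wpM2r ?exprn_ge0 ?(ltW sj)//.
  by rewrite (_ : (4 / 3) ^+ 3 = 64 / 27 :> R); [lra|field].
pose th : R := (8 * K * B / s + 5 * K) / t.
have hth w : `|smooth l%:R (F m) w - smooth l%:R (N m) w| <= th.
  have := @sum_cdf_telescope nu hnu l m m w D l0 (leqnn m) (fun k v km => hD k v km).
  rewrite subnn add0n smooth_normal_cdf ?ltr0n// -natrD (addnC l m) => /le_trans; apply.
  rewrite big_split/= sumr_const card_ord.
  have h2 : K / Num.sqrt (m + l).-1%:R ^+ 3 *+ m <= K / t.
    rewrite -mulr_natr -t2 -mulrA ler_wpM2l//.
    rewrite -[leRHS]mul1r -[X in _ <= X / _](@mulVf _ (t ^+ 3)) ?expf_neq0 ?gt_eqF//.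
    rewrite -mulrA (_ : t ^+ 3 / t = t ^+ 2); last by field; rewrite gt_eqF.
    rewrite ler_wpM2r ?sqr_ge0// lef_pV2 ?posrE ?exprn_gt0 ?sqrtr_gt0 ?ltr0n//; last by move: l0; clear; lia.
    apply: lerXn2r; rewrite ?nnegrE ?(ltW t0) ?sqrtr_ge0// ler_wsqrtr// ler_nat.
    by move: l0; clear; lia.
  apply: le_trans (lerD (lexx _) h2) _.
  have -> : th = K * (8 * B / s / t + 4 / t) + K / t by rewrite /th; field; rewrite !gt_eqF.
  rewrite lerD2r.
  under eq_bigr do rewrite -mulrA.
  rewrite -mulr_sumr ler_wpM2l//.
  apply: le_trans (ler_sum _ (fun k _ => hDk k)) _.
  rewrite big_split/= sumr_const card_ord -mulr_sumr lerD//.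
    have := @sum_inv_sqrt3 l m l0; rewrite -/s => h.
    apply: le_trans (ler_wpM2l _ h) _; first exact: divr_ge0 (mulr_ge0 (ler0n _ 2) B0) (ltW t0).
    by rewrite le_eqVlt; apply/orP; left; apply/eqP; field; rewrite !gt_eqF.
  rewrite -[leLHS]mulr_natr -t2 le_eqVlt; apply/orP; left; apply/eqP; field.
  by rewrite gt_eqF.
(* Desmoothing bounds the supremum by a third of itself plus known terms; as it is finite, the
   inequality can be solved for it. *)
pose Dst := sup (range (fun w => `|F m w - N m w|)).
have hs : has_sup (range (fun w => `|F m w - N m w|)).
  by split; [exists `|F m 0 - N m 0|; exists 0|exists 1 => _ [w _ <-]].
have hDst w : `|F m w - N m w| <= Dst by apply: ub_le_sup; [exact: hs.2|exists w].
have ls : (0 : R) < l%:R by rewrite ltr0n.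
have := desmoothing ls (cdflike_sum nu m) hDst hth; rewrite -/m -/t -/s => hfin.
have : Dst <= Dst / 3 + 4 / 3 * (th + 4 * (s / t)).
  by apply: ge_sup; [exact: hs.1|move=> _ [w _ <-]; exact: hfin].
move=> hDD; apply: le_trans (hDst z) _.
have : Dst <= 2 * th + 8 * (s / t) by move: hDD; clear; lra.
move=> /le_trans; apply.
have hB : 8 * K * B / s <= B / 8.
  by rewrite ler_pdivrMr// mulrAC; move: (ler_wpM2r B0 lK); rewrite -/s; clear; lra.
rewrite (_ : 2 * th + 8 * (s / t) = (2 * (8 * K * B / s + 5 * K) + 8 * s) / t); last first.
  by rewrite /th; field; rewrite !gt_eqF.
rewrite ler_wpM2r ?invr_ge0 ?(ltW t0)//; move: hB K0 s0; rewrite /B; clear; lra.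
Qed.
End berry_esseen.

(** * Functions of pairs of i.i.d. sequences *)

Section pair_sum_law.
Context {R : realType}.
Local Notation mR := (measurableTypeR R).
Variables (eta gam : probability mR R) (X0 : mR * mR -> mR).
Hypothesis mX0 : measurable_fun setT X0.

Definition pair_law : probability mR R :=
  distribution (eta \x gam)%E (mfun_Sub (mem_set mX0)).

Lemma ge0_integral_pair_law (f : mR -> \bar R) : measurable_fun setT f -> (forall x, 0 <= f x)%E ->
  (\int[pair_law]_x f x = \int[eta]_u \int[gam]_s f (X0 (u, s)))%E.
Proof.
move=> mf f0; rewrite /pair_law ge0_integral_distribution//.
rewrite fubini_tonelli1//; last by move=> x; exact: f0.
exact: measurableT_comp.
Qed.

Definition pair_sum n (u s : n.-tuple mR) : R := \sum_(i < n) X0 (tnth u i, tnth s i).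

Lemma pair_sum_cons n (x y : mR) (u s : n.-tuple mR) :
  pair_sum (tcons (x, u)) (tcons (y, s)) = X0 (x, y) + pair_sum u s.
Proof.
by rewrite /pair_sum big_ord_recl !tnth0; congr (_ + _); apply: eq_bigr => i _; rewrite !tnthS.
Qed.

Lemma measurable_pair_sum d (T : measurableType d) n (p q : T -> n.-tuple mR) :
  measurable_fun setT p -> measurable_fun setT q ->
  measurable_fun setT (fun x => pair_sum (p x) (q x)).
Proof.
move=> mp mq; apply: measurable_sum => i; apply: measurableT_comp => //.
by apply: measurable_fun_pair; apply: (measurableT_comp (measurable_tnth i)).
Qed.

Lemma measurable_step : measurable_fun setT (@step R).
Proof. exact: (cdflike_bounded cdflike_step).1. Qed.

(** Tonelli's theorem moves the second entry of the first pair in front of the remaining first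
    entries; the induction hypothesis then applies with a shifted [t]. *)
Lemma tprod_sum_cdf n (t : R) :
  (\int[tprod eta n]_u \int[tprod gam n]_s (step (t - pair_sum u s))%:E =
   (sum_cdf pair_law n t)%:E)%E.
Proof.
have mst d (T : measurableType d) k (p q : T -> k.-tuple mR) (r : T -> R) :
    measurable_fun setT r -> measurable_fun setT p -> measurable_fun setT q ->
    measurable_fun setT (fun x => (step (r x - pair_sum (p x) (q x)))%:E).
  move=> mr mp mq; apply/measurable_EFinP; apply: (measurableT_comp measurable_step).
  by apply: measurable_funB => //; exact: measurable_pair_sum.
have st0 x : (0 <= (step x : R)%:E)%E by rewrite lee_fin step_ge0.
elim: n t => [|n IH] t.
  rewrite (@ge0_integral_tprod0 _ _ _ eta); last first.
    apply: (@measurable_ge0_integral_tprod _ _ _ gam _ _ 0 (fun p => (step (t - pair_sum p.1 p.2))%:E)) => //.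
    by apply: mst.
  rewrite (@ge0_integral_tprod0 _ _ _ gam); last by apply: mst.
  by rewrite /pair_sum big_ord0 subr0.
have cF := cdflike_sum pair_law n; have bF := cdflike_bounded cF.
have F0 x : 0 <= sum_cdf pair_law n x by have /andP[] := cF.2 x.
have mtc k : measurable_fun setT (@tcons _ mR k) := @measurable_tcons _ mR k.
rewrite ge0_integral_tprodS//; last 2 first.
- apply: (@measurable_ge0_integral_tprod _ _ _ gam _ _ n.+1 (fun p => (step (t - pair_sum p.1 p.2))%:E)) => //.
  by apply: mst.
- by move=> u; apply: integral_ge0.
transitivity (\int[eta]_x \int[gam]_y (sum_cdf pair_law n (t - X0 (x, y)))%:E)%E; last first.
  rewrite -(@ge0_integral_pair_law (fun x => (sum_cdf pair_law n (t - x))%:E)).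
  - rewrite [RHS]/= /Rintegral fineK//.
    exact: (integrable_fin_num measurableT (bounded_integrable pair_law (bounded_mf_comp t bF))).
  - by apply/measurable_EFinP; exact: (bounded_mf_comp t bF).1.
  - by move=> x; rewrite lee_fin.
apply: eq_integral => x _.
transitivity (\int[tprod eta n]_u \int[gam]_y \int[tprod gam n]_s (step (t - X0 (x, y) - pair_sum u s))%:E)%E.
  apply: eq_integral => u _.
  rewrite (@ge0_integral_tprodS _ _ _ gam); [|exact: mst|by move=> s; exact: st0].
  apply: eq_integral => y _; apply: eq_integral => s _.
  by rewrite pair_sum_cons opprD addrA.
have mx d (T : measurableType d) (q : T -> mR) : measurable_fun setT q ->
    measurable_fun setT (fun z => t - X0 (x, q z)).
  by move=> mq; apply: measurable_funB => //; apply: measurableT_comp => //; exact: measurable_fun_pair.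
rewrite (@fubini_tonelli _ _ _ _ _ (tprod eta n) gam
  (fun p => \int[tprod gam n]_s (step (t - X0 (x, p.2) - pair_sum p.1 s))%:E)%E).
- by apply: eq_integral => y _; rewrite /= IH.
- apply: (@measurable_ge0_integral_tprod _ _ _ gam _ _ n (fun p =>
    (step (t - X0 (x, p.1.2) - pair_sum p.1.1 p.2))%:E)) => //.
  apply: mst; first by apply: mx; apply: measurableT_comp.
    by apply: measurableT_comp.
  exact: measurable_snd.
- by move=> p; apply: integral_ge0.
Qed.
End pair_sum_law.

Section sum_law.
Context {d} {T : measurableType d} {R : realType}.
Local Notation mR := (measurableTypeR R).
Variables (P : probability T R) (X Y : nat -> T -> mR) (eta gam : probability mR R).
Hypotheses (mX : forall i, measurable_fun setT (X i)) (mY : forall i, measurable_fun setT (Y i)).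
Hypotheses (iX : mutually_independent P X) (iY : mutually_independent P Y).
Hypotheses (lX : forall i B, measurable B -> P (X i @^-1` B) = eta B)
  (lY : forall i B, measurable B -> P (Y i @^-1` B) = gam B).
Variable X0 : mR * mR -> mR.
Hypothesis mX0 : measurable_fun setT X0.

Lemma measurable_sum_le n (w : T) (t : R) :
  measurable [set w' | \sum_(i < n) X0 (X i w, Y i w') <= t].
Proof.
rewrite (_ : [set w' | _] = (fun w' => \sum_(i < n) X0 (X i w, Y i w')) @^-1` `]-oo, t]%classic); last first.
  by apply/seteqP; split => w' /=; rewrite in_itv.
rewrite -[X in measurable X]setTI.
apply: measurable_sum => // i; apply: measurableT_comp => //.
exact: measurable_fun_pair.
Qed.

Let sumE n w w' : \sum_(i < n) X0 (X i w, Y i w') = pair_sum X0 (rvec X n 0 w) (rvec Y n 0 w').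
Proof. by apply: eq_bigr => i _; rewrite !tnth_rvec. Qed.

(** The two sequences are evaluated at independent sample points, as in the iterated integral that
    defines [Pe]. *)
Lemma sum_prob_le n (t : R) :
  (\int[P]_w P [set w' | (\sum_(i < n) X0 (X i w, Y i w') <= t)%R] =
   (sum_cdf (pair_law eta gam mX0) n t)%:E)%E.
Proof.
have ms k (u : k.-tuple mR) : measurable_fun setT (fun s => (step (t - pair_sum X0 u s))%:E).
  apply/measurable_EFinP; apply: (measurableT_comp measurable_step).
  by apply: measurable_funB => //; exact: measurable_pair_sum.
have st0 x : (0 <= (step x : R)%:E)%E by rewrite lee_fin step_ge0.
rewrite -tprod_sum_cdf -(@ge0_integral_rvec _ _ _ P X eta mX iX lX n 0); first last.
- by move=> u; apply: integral_ge0.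
- apply: (@measurable_ge0_integral_tprod _ _ _ gam _ _ n (fun p => (step (t - pair_sum X0 p.1 p.2))%:E)) => //.
  apply/measurable_EFinP; apply: (measurableT_comp measurable_step).
  by apply: measurable_funB => //; apply: measurable_pair_sum.
apply: eq_integral => w _.
rewrite -(@ge0_integral_rvec _ _ _ P Y gam mY iY lY n 0)//.
transitivity (\int[P]_w' (\1_[set w' | (\sum_(i < n) X0 (X i w, Y i w') <= t)%R] w')%:E)%E.
  by rewrite integral_indic ?setIT//; exact: measurable_sum_le.
apply: eq_integral => w' _; rewrite indicE /step subr_ge0 -sumE.
case: (boolP (_ <= t)) => h; first by rewrite mem_set.
by rewrite memNset//; exact/negP.
Qed.
End sum_law.

(** * Moments of the log-fading *)

Section cubes.
Context {R : realType}.

Lemma cube_sub_le (x y : R) : `|x - y| ^+ 3 <= 4 * (`|x| ^+ 3 + `|y| ^+ 3).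
Proof.
apply: (@le_trans _ _ ((`|x| + `|y|) ^+ 3)).
  by rewrite lerXn2r ?nnegrE ?addr_ge0 ?ler_normB.
have := normr_ge0 x; have := normr_ge0 y.
set a := `|x|; set b := `|y| => y0 x0.
have := mulr_ge0 (addr_ge0 x0 y0) (sqr_ge0 (a - b)); nra.
Qed.

Lemma integrable_cube d (T : measurableType d) (m : probability T R) (g : T -> R) :
  measurable_fun setT g -> m.-integrable setT (EFin \o (fun x => `|g x| ^+ 3)) ->
  m.-integrable setT (EFin \o g) /\ m.-integrable setT (EFin \o (fun x => g x ^+ 2)).
Proof.
move=> mg i3.
have i1 : m.-integrable setT (EFin \o (fun=> 1 : R)) by exact: finite_measure_integrable_cst.
have id : m.-integrable setT (EFin \o (fun x => 1 + `|g x| ^+ 3)) by exact: integrable_add.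
have dom x k : (0 < k <= 3)%N -> `|g x ^+ k| <= 1 + `|g x| ^+ 3.
  move=> /andP[k0 k3]; rewrite normrX; have [x1|x1] := lerP `|g x| 1.
    by rewrite (le_trans (exprn_ile1 _ (normr_ge0 _) x1))// lerDl exprn_ge0.
  by rewrite (@le_trans _ _ (`|g x| ^+ 3)) ?lerDr// ler_weXn2l// ltW.
split.
  by apply: (integrable_dominated mg _ id) => x; have := @dom x 1%N; rewrite expr1; exact.
by apply: (integrable_dominated (measurable_funX 2 mg) _ id) => x; exact: dom.
Qed.

Lemma integrable_cube_subc d (T : measurableType d) (m : probability T R) (g : T -> R) (c : R) :
  measurable_fun setT g -> m.-integrable setT (EFin \o (fun x => `|g x| ^+ 3)) ->
  m.-integrable setT (EFin \o (fun x => `|g x - c| ^+ 3)).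
Proof.
move=> mg ig; have ic : m.-integrable setT (EFin \o (fun=> `|c| ^+ 3)).
  exact: finite_measure_integrable_cst.
apply: (integrable_dominated _ _ (integrable_scale 4 (integrable_add ig ic))).
  by apply: measurable_funX; apply: measurableT_comp => //; exact: measurable_funB.
by move=> x; rewrite normrX normr_id cube_sub_le.
Qed.
End cubes.

Section log_moments.
Context {R : realType}.
Local Notation mR := (measurableTypeR R).
Local Notation leb := (@lebesgue_measure R).

(** Monotone convergence. It serves where the bound comes from an inequality that can be solved only
    for a finite integral. *)
Lemma integral_trunc_le d (T : measurableType d) (m : {measure set T -> \bar R}) (g : T -> R) (B : \bar R) :
  measurable_fun setT g -> (forall x, 0 <= g x) ->
  (forall k : nat, (\int[m]_x (Num.min (g x) k%:R)%:E <= B)%E) -> (\int[m]_x (g x)%:E <= B)%E.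
Proof.
move=> mg g0 hB; pose G (k : nat) x := (Num.min (g x) k%:R)%:E.
have mG k : measurable_fun setT (G k).
  by apply/measurable_EFinP; apply: measurable_minr.
have G0 k x : setT x -> (0 <= G k x)%E by rewrite lee_fin le_min g0/=.
have ndG x : setT x -> {homo G^~ x : k l / (k <= l)%N >-> (k <= l)%E}.
  by move=> _ k l kl; rewrite lee_fin le_min ge_min lexx/= ge_min ler_nat kl orbT.
have limG x : limn (G^~ x) = (g x)%:E.
  apply/cvg_lim => //; apply: cvg_near_cst.
  exists (Num.truncn (g x)).+1 => // k /= hk; congr EFin; apply/min_idPl.
  apply: ltW; apply: (lt_le_trans (truncnS_gt _)); by rewrite ler_nat.
under eq_integral do rewrite -limG.
rewrite (monotone_convergence _ measurableT mG G0 ndG).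
apply: lime_le; last exact: nearW.
apply: ereal_nondecreasing_is_cvgn => k l kl; apply: ge0_le_integral => //.
  by move=> x _; exact: G0.
by move=> x _; exact: ndG.
Qed.

Variables (f : R -> R) (alpha c h0 : R) (nu : probability mR R).
Hypotheses (mf : measurable_fun setT f) (f0 : forall h, 0 <= f h).
Hypothesis fneg : forall h, h < 0 -> f h = 0.
Hypothesis nuE : forall A, measurable A -> nu A = (\int[leb]_(x in A) (f x)%:E)%E.
Hypothesis nu2 : (\int[nu]_x (x ^+ 2)%:E)%E = 1%E.
Hypotheses (alpha0 : 0 < alpha) (h00 : 0 < h0).
Hypothesis f_small : forall h, 0 < h < h0 -> f h = c * h `^ (alpha - 1).

(** This is h^(- alpha / 2) near 0: singular enough to dominate powers of ln h, yet integrable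
    against a density behaving like h^(alpha - 1). *)
Let w (h : R) : R := if 0 < h < h0 then expR (- (alpha / 2) * ln h) else 0.

Let mw : measurable_fun setT w.
Proof.
apply: measurable_fun_ifT => //=.
  by apply: measurable_and; exact: measurable_fun_ltr.
apply: measurableT_comp => //; apply: measurable_funM => //; exact: measurable_ln.
Qed.

Let w0 h : 0 <= w h. Proof. by rewrite /w; case: ifP => // _; exact: expR_ge0. Qed.

Let nu_integral (g : R -> R) : measurable_fun setT g -> (forall x, 0 <= g x) ->
  (\int[nu]_x (g x)%:E = \int[leb]_x (g x * f x)%:E)%E.
Proof. exact: (@ge0_integral_density _ mR R leb nu f mf f0 nuE). Qed.

Let theta : R := expR (- (alpha / 2) * ln 2).
Let bound : R := expR (- (alpha / 2) * ln (h0 / 2)).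

(* The substitution [h = u / 2] multiplies the truncated moment by [theta < 1]. *)
Let w_trunc (k : nat) :
  (\int[nu]_x (Num.min (w x) k%:R)%:E <= (bound / (1 - theta))%:E)%E.
Proof.
have th1 : theta < 1.
  rewrite /theta expR_lt1 mulNr oppr_lt0 mulr_gt0 ?divr_gt0//.
  by rewrite ln_gt0// ltr1n.
pose g x := Num.min (w x) k%:R.
have g0 x : 0 <= g x by rewrite le_min w0/=.
have mg : measurable_fun setT g by exact: measurable_minr.
have mgt (p : R -> bool) : measurable_fun setT p -> measurable_fun setT (fun x => if p x then g x else 0).
  by move=> mp; exact: measurable_fun_ifT.
pose ga x : R := if x < h0 / 2 then g x else 0.
pose gb x : R := if h0 / 2 <= x then g x else 0.
have mga : measurable_fun setT ga by apply: mgt; exact: measurable_fun_ltr.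
have mgb : measurable_fun setT gb by apply: mgt; exact: measurable_fun_ler.
have ga0 x : 0 <= ga x by rewrite /ga; case: ifP.
have gb0 x : 0 <= gb x by rewrite /gb; case: ifP.
set J := (\int[nu]_x (g x)%:E)%E.
(* The truncation makes [J] finite, so that J <= theta J + bound can be solved for J. *)
have Jfin : J \is a fin_num.
  rewrite ge0_fin_numE; last by apply: integral_ge0 => x _; rewrite lee_fin.
  apply: (@le_lt_trans _ _ (\int[nu]_x (k%:R : R)%:E)%E).
    apply: ge0_le_integral => //.
    - by move=> x _; rewrite lee_fin.
    - exact/measurable_EFinP.
    - by move=> x _; rewrite lee_fin ge_min lexx orbT.
  by rewrite integral_cst//= probability_setT mule1 ltry.
have Jsplit : J = (\int[nu]_x (ga x)%:E + \int[nu]_x (gb x)%:E)%E.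
  rewrite -ge0_integralD//; first last.
  - exact/measurable_EFinP.
  - by move=> x _; rewrite lee_fin.
  - exact/measurable_EFinP.
  - by move=> x _; rewrite lee_fin.
  apply: eq_integral => x _; rewrite -EFinD; congr EFin; rewrite /ga /gb.
  by case: ltP => _; rewrite ?addr0 ?add0r.
have hb : (\int[nu]_x (gb x)%:E <= bound%:E)%E.
  apply: (@le_trans _ _ (\int[nu]_x (bound : R)%:E)%E).
    apply: ge0_le_integral => //.
    - by move=> x _; rewrite lee_fin.
    - exact/measurable_EFinP.
    - move=> x _; rewrite lee_fin /gb; case: ifP => [hx|_]; last exact: expR_ge0.
      rewrite ge_min /w; case: ifP => [/andP[x0 _]|_]; last by rewrite expR_ge0.
      rewrite /bound ler_expR !mulNr lerN2 ler_pM2l ?divr_gt0// ler_ln ?posrE ?divr_gt0// hx.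
      by [].
  by rewrite integral_cst//= probability_setT mule1.
have mgf : measurable_fun setT (fun x : mR => (ga x * f x)%:E).
  by apply/measurable_EFinP; exact: measurable_funM.
have maff : measurable_fun setT (fun u : mR => (ga (2^-1 * u + 0) * f (2^-1 * u + 0))%:E).
  exact: (measurableT_comp mgf (measurable_affine 2^-1 0)).
have ha : (\int[nu]_x (ga x)%:E <= theta%:E * J)%E.
  rewrite /J !nu_integral//.
  have gaf0 x : (0 <= (ga x * f x)%:E)%E by rewrite lee_fin mulr_ge0.
  have mgf' : measurable_fun setT (fun x : mR => (g x * f x)%:E).
    by apply/measurable_EFinP; exact: measurable_funM.
  have i2 : 0 < 2^-1 :> R by rewrite invr_gt0.
  rewrite (ge0_integral_affine 0 i2 mgf gaf0) -(ge0_integralZl leb measurableT maff)//.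
  rewrite -(ge0_integralZl leb measurableT mgf'); first last.
  - by rewrite lee_fin expR_ge0.
  - by move=> x _; rewrite lee_fin mulr_ge0.
  apply: ge0_le_integral => //.
  - by move=> x _; rewrite -EFinM lee_fin !mulr_ge0 ?invr_ge0.
  - exact: measurable_funeM.
  - exact: measurable_funeM.
  move=> u _; rewrite addr0 -!EFinM lee_fin /ga.
  have -> : (2^-1 * u < h0 / 2) = (u < h0) by rewrite mulrC ltr_pM2r ?invr_gt0.
  case: ifP => [uh|_]; last by rewrite mul0r mulr0 !mulr_ge0// expR_ge0.
  have [u0|u0] := leP u 0.
    have -> : g (2^-1 * u) = 0 by rewrite /g /w ltNge pmulr_rle0 ?invr_gt0// u0/= min_l ?ler0n.
    by rewrite mul0r mulr0; exact: (mulr_ge0 (expR_ge0 _) (mulr_ge0 (g0 u) (f0 u))).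
  have h2 : 0 < 2^-1 * u < h0.
    by rewrite mulr_gt0 ?invr_gt0//=; lra.
  have h1 : 0 < u < h0 by rewrite u0 uh.
  have lnu : ln (2^-1 * u) = ln u - ln 2.
    by rewrite lnM ?posrE ?invr_gt0// lnV ?posrE// addrC.
  have gE : g (2^-1 * u) <= theta^-1 * g u.
    rewrite /g /w h1 h2 lnu.
    have -> : expR (- (alpha / 2) * (ln u - ln 2)) = theta^-1 * expR (- (alpha / 2) * ln u).
      by rewrite /theta -expRN -expRD; congr expR; ring.
    have th0 : 1 <= theta^-1 by rewrite -invr1 lef_pV2 ?posrE ?expR_gt0// ltW.
    rewrite minr_pMr ?(le_trans ler01)// le_min !ge_min lexx/=.
    by rewrite ler_peMl ?orbT.
  (* The factor 1/2 of the substitution, theta^-1 of the weight and 2 theta^2 of the density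
     multiply to theta. *)
  have fE : f (2^-1 * u) = 2 * theta ^+ 2 * f u.
    rewrite !f_small// /powR !gt_eqF ?mulr_gt0 ?invr_gt0// lnu.
    have -> : expR ((alpha - 1) * (ln u - ln 2)) = expR (ln 2) * theta ^+ 2 * expR ((alpha - 1) * ln u).
      by rewrite /theta -expRM_natl -!expRD; congr expR; field.
    by rewrite lnK ?posrE//; ring.
  apply: (@le_trans _ _ (2^-1 * (theta^-1 * g u * (2 * theta ^+ 2 * f u)))).
    by rewrite fE ler_wpM2l ?invr_ge0// ler_wpM2r// !mulr_ge0// ?exprn_ge0 ?expR_ge0.
  rewrite le_eqVlt; apply/orP; left; apply/eqP.
  have : theta != 0 by rewrite gt_eqF// expR_gt0.
  by move=> t0; field.
move: Jsplit hb ha; rewrite -/J -(fineK Jfin).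
move=> E hb ha; rewrite lee_fin ler_pdivlMr ?subr_gt0//.
have : ((fine J)%:E <= theta%:E * (fine J)%:E + bound%:E)%E by rewrite {1}E leeD.
by rewrite -EFinM -EFinD lee_fin; lra.
Qed.

Let w_moment : (\int[nu]_x (w x)%:E < +oo)%E.
Proof. exact: (le_lt_trans (@integral_trunc_le _ mR nu _ _ mw w0 w_trunc) (ltry _)). Qed.

(** A cube is at most six times the exponential. For h >= 1 this bounds |ln h^2|^3 by 6 h^2,
    integrable by E H^2 = 1; for h < 1, applied to (alpha / 2) |ln h|, it gives a multiple of the
    weight [w] below [h0] and a constant above. *)
Lemma integrable_log_cube : nu.-integrable setT (EFin \o (fun x : mR => `|ln (x ^+ 2)| ^+ 3)).
Proof.
pose s := alpha / 2; have s0 : 0 < s by rewrite divr_gt0.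
pose C : R := 48 / s ^+ 3; have C0 : 0 <= C by rewrite divr_ge0// exprn_ge0// ltW.
pose K := C * expR (- s * ln h0); have K0 : 0 <= K by rewrite mulr_ge0// expR_ge0.
have cube (x : R) : 0 <= x -> x ^+ 3 <= 6 * expR x.
  move=> x0; have := expR_ge1Dxn 2 x0; rewrite (_ : 3`!%:R = 6 :> R)//; lra.
have dom (h : R) : `|ln (h ^+ 2)| ^+ 3 * f h <= (C * w h + K + 6 * h ^+ 2) * f h.
  have rest : 0 <= C * w h + K + 6 * h ^+ 2 := (addr_ge0 (addr_ge0 (mulr_ge0 C0 (w0 h)) K0) (mulr_ge0 (ler0n R 6) (sqr_ge0 h))).
  have [hn|hn|->] := ltgtP h 0; first by rewrite fneg// !mulr0.
  - apply: ler_wpM2r => //; rewrite lnXn//.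
    have [h1|h1] := leP 1 h.
      have l0 : 0 <= ln h *+ 2 by rewrite mulrn_wge0// ln_ge0.
      rewrite ger0_norm//; apply: (le_trans (cube _ l0)).
      rewrite -lnXn// lnK ?posrE ?exprn_gt0// lerDr addr_ge0// mulr_ge0//.
    have l0 : 0 <= s * (- ln h) by rewrite mulr_ge0 ?(ltW s0)// oppr_ge0 ln_le0// ltW.
    have h8 : `|ln h *+ 2| ^+ 3 <= C * expR (- s * ln h).
      rewrite normrMn ler0_norm; last by rewrite ln_le0// ltW.
      have := cube _ l0; rewrite mulrN -mulNr.
      have sn0 : s != 0 by rewrite gt_eqF.
      have -> : (- ln h *+ 2) ^+ 3 = 8 / s ^+ 3 * (- s * ln h) ^+ 3 by field.
      have -> : C = 8 / s ^+ 3 * 6 by rewrite /C; field.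
      by rewrite -[X in _ -> _ <= X]mulrA; apply: ler_wpM2l; rewrite divr_ge0// exprn_ge0// ltW.
    apply: (le_trans h8); rewrite /w hn /=.
    case: ltP => [hh|hh].
      by rewrite -addrA lerDl addr_ge0// mulr_ge0// sqr_ge0.
    rewrite mulr0 add0r (@le_trans _ _ K)//; last by rewrite lerDl (mulr_ge0 (ler0n R 6) (sqr_ge0 h)).
    rewrite /K ler_wpM2l// ler_expR !mulNr lerN2 ler_pM2l// ler_ln ?posrE//.
  - rewrite [X in ln X]expr0n /= ln0// normr0 [X in X * _ <= _]expr0n/= mul0r; apply: mulr_ge0 => //.
    exact: (addr_ge0 (addr_ge0 (mulr_ge0 C0 (w0 0)) K0) (mulr_ge0 (ler0n R 6) (sqr_ge0 0))).
have mh : measurable_fun setT (fun h : R => h ^+ 2) by exact: measurable_funX.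
have ml : measurable_fun setT (fun h : R => `|ln (h ^+ 2)| ^+ 3).
  apply: measurable_funX; apply: measurableT_comp => //.
  exact: (measurableT_comp (@measurable_ln R) mh).
have md : measurable_fun setT (fun h : R => C * w h + K + 6 * h ^+ 2).
  apply: measurable_funD; last exact: measurable_funM.
  by apply: measurable_funD => //; exact: measurable_funM.
have d0 h : 0 <= C * w h + K + 6 * h ^+ 2 := (addr_ge0 (addr_ge0 (mulr_ge0 C0 (w0 h)) K0) (mulr_ge0 (ler0n R 6) (sqr_ge0 h))).
apply/integrableP; split; first exact/measurable_EFinP.
under eq_integral do rewrite /= ger0_norm ?exprn_ge0//.
rewrite nu_integral//.
apply: (@le_lt_trans _ _ (\int[nu]_h (C * w h + K + 6 * h ^+ 2)%:E)%E).
  rewrite nu_integral//; apply: ge0_le_integral => //.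
  - by move=> x _; rewrite lee_fin mulr_ge0// exprn_ge0.
  - by apply/measurable_EFinP; exact: measurable_funM.
  - by apply/measurable_EFinP; exact: measurable_funM.
  - by move=> x _; rewrite lee_fin.
have iw : nu.-integrable setT (EFin \o w).
  apply/integrableP; split; first exact/measurable_EFinP.
  by under eq_integral do rewrite /= ger0_norm//.
have i2 : nu.-integrable setT (EFin \o (fun h : mR => h ^+ 2)).
  apply/integrableP; split; first exact/measurable_EFinP.
  by under eq_integral do rewrite /= ger0_norm ?sqr_ge0//; rewrite nu2 ltry.
have iK : nu.-integrable setT (EFin \o (fun _ : mR => K)) by exact: finite_measure_integrable_cst.
have iG := integrable_add (integrable_add (integrable_scale C iw) iK) (integrable_scale 6 i2).
have /integrableP[_] := iG; congr (_ < _)%E; apply: eq_integral => h _.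
by rewrite /= ger0_norm.
Qed.

Definition log_mean : R := \int[nu]_x ln (x ^+ 2).

Lemma measurable_log : measurable_fun setT (fun x : mR => ln (x ^+ 2) : R).
Proof. by apply: (measurableT_comp (@measurable_ln R)); exact: measurable_funX. Qed.

Lemma log_centered : [/\ nu.-integrable setT (EFin \o (fun x : mR => `|ln (x ^+ 2) - log_mean| ^+ 3)),
  \int[nu]_x (ln (x ^+ 2) - log_mean) = 0 & 0 <= \int[nu]_x (ln (x ^+ 2) - log_mean) ^+ 2].
Proof.
have [i1 _] := integrable_cube measurable_log integrable_log_cube.
have ic : nu.-integrable setT (EFin \o (fun=> log_mean)) by exact: finite_measure_integrable_cst.
split.
- exact: (integrable_cube_subc _ measurable_log integrable_log_cube).
- by rewrite (RintegralB measurableT i1 ic) Rintegral_cst//= probability_setT/= mulr1 subrr.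
- by apply: Rintegral_ge0 => x _; exact: sqr_ge0.
Qed.
End log_moments.

(** * Standardization of one pair of fading and noise *)

Section pair_moments.
Context {R : realType}.
Local Notation mR := (measurableTypeR R).

Variables (eta gam : probability mR R) (A b : mR -> R) (va vb : R).
Hypotheses (mA : measurable_fun setT A) (mb : measurable_fun setT b).
Hypothesis A3 : eta.-integrable setT (EFin \o (fun x => `|A x| ^+ 3)).
Hypothesis b3 : gam.-integrable setT (EFin \o (fun x => `|b x| ^+ 3)).
Hypotheses (A1 : \int[eta]_x A x = 0) (A2 : \int[eta]_x A x ^+ 2 = va).
Hypotheses (b1 : \int[gam]_x b x = 0) (b2 : \int[gam]_x b x ^+ 2 = vb).
Hypothesis V0 : 0 < vb + va.

Let m := (eta \x gam)%E.

Lemma integrable_fst (g : mR -> R) : eta.-integrable setT (EFin \o g) ->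
  m.-integrable setT (EFin \o (fun p => g p.1)).
Proof.
move=> /integrableP[mg ig]; apply/integrable12ltyP.
  exact: (measurableT_comp mg measurable_fst).
by under eq_integral do rewrite /= integral_cst//= probability_setT mule1.
Qed.

Lemma integrable_snd (g : mR -> R) : gam.-integrable setT (EFin \o g) ->
  m.-integrable setT (EFin \o (fun p => g p.2)).
Proof.
move=> /integrableP[mg ig]; apply/integrable12ltyP.
  exact: (measurableT_comp mg measurable_snd).
by rewrite /= integral_cst//= probability_setT mule1.
Qed.

Lemma Rintegral_prod (f : mR * mR -> R) : m.-integrable setT (EFin \o f) ->
  (forall x, gam.-integrable setT (EFin \o (fun y => f (x, y)))) ->
  \int[m]_p f p = \int[eta]_x \int[gam]_y f (x, y).
Proof.
move=> im ig; rewrite /Rintegral -(integral12_prod_meas1 im); congr fine.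
apply: eq_integral => x _; rewrite /fubini_F fineK//.
exact: (integrable_fin_num measurableT (ig x)).
Qed.

Let S := Num.sqrt (vb + va).
Let S0 : 0 < S. Proof. by rewrite sqrtr_gt0. Qed.
Let SS : S ^+ 2 = vb + va. Proof. by rewrite sqr_sqrtr// ltW. Qed.

(** With [A] the centred log-fading and [b] the centred noise energy, a sum of such variables is at
    most t exactly when the noise energy is at most [radius2]. *)
Definition pair_fun (p : mR * mR) : mR := (b p.2 - A p.1) / S.

Lemma measurable_pair_fun : measurable_fun setT pair_fun.
Proof.
apply: measurable_funM => //; apply: measurable_funB; exact: measurableT_comp.
Qed.

Let X3 : m.-integrable setT (EFin \o (fun p => `|pair_fun p : R| ^+ 3)).
Proof.
pose g p := (4 / S ^+ 3) * (`|b p.2| ^+ 3 + `|A p.1| ^+ 3).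
apply: (@integrable_dominated _ _ _ m _ g).
- by apply: measurable_funX; apply: measurableT_comp => //; exact: measurable_pair_fun.
- move=> p; rewrite normrX normr_id /pair_fun normrM normfV (gtr0_norm S0) exprMn exprVn /g.
  rewrite [leRHS]mulrAC ler_wpM2r ?invr_ge0 ?exprn_ge0 ?(ltW S0)//.
  exact: cube_sub_le.
- exact: (integrable_scale _ (integrable_add (integrable_snd b3) (integrable_fst A3))).
Qed.

Let bI := integrable_cube mb b3.
Let AI := integrable_cube mA A3.
Let XI := integrable_cube measurable_pair_fun X3.
Let cI (c : R) : gam.-integrable setT (EFin \o (fun=> c)).
Proof. exact: finite_measure_integrable_cst. Qed.

Lemma standardized_pair : standardized (pair_law eta gam measurable_pair_fun).
Proof.
have m3 : measurable_fun setT (fun x : mR => `|x : R| ^+ 3).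
  by apply: measurable_funX; exact: normr_measurable.
have E (g : mR -> R) : measurable_fun setT g ->
    m.-integrable setT (EFin \o (fun p => g (pair_fun p))) ->
    (forall x, gam.-integrable setT (EFin \o (fun y => g (pair_fun (x, y))))) ->
    \int[pair_law eta gam measurable_pair_fun]_x g x = \int[eta]_x \int[gam]_y g (pair_fun (x, y)).
  move=> mg ig iy; rewrite -(Rintegral_prod ig iy) /Rintegral; congr fine.
  by rewrite /pair_law integral_distribution//; exact/measurable_EFinP.
split.
- apply/integrableP; split; first exact/measurable_EFinP.
  rewrite /pair_law ge0_integral_distribution//; last by apply: measurableT_comp => //; exact/measurable_EFinP.
  by have /integrableP[_] := X3.
- rewrite (E (fun x => x)); first last.
  + move=> x; rewrite /pair_fun/=.
    rewrite (_ : (fun y => _) = (fun y => S^-1 * (b y - A x))); last by apply/funext => y; rewrite mulrC.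
    by apply: integrable_scale; apply: integrable_sub => //; exact: bI.1.
  + exact: XI.1.
  + by [].
  transitivity (\int[eta]_x (- S^-1 * A x)).
    apply: eq_Rintegral => x _ /=.
    transitivity (\int[gam]_y (S^-1 * (b y - A x))).
      by apply: eq_Rintegral => y _; rewrite /pair_fun/= mulrC.
    rewrite (RintegralZl _ measurableT (integrable_sub bI.1 (cI _))).
    rewrite (RintegralB measurableT bI.1 (cI _)) b1 Rintegral_cst//= probability_setT/=.
    by rewrite mulr1 sub0r mulrN mulNr.
  by rewrite (RintegralZl _ measurableT AI.1) A1 mulr0.
- rewrite (E (fun x => x ^+ 2)); first last.
  + move=> x; rewrite /pair_fun/=.
    rewrite (_ : (fun y => _) = (fun y => (S ^+ 2)^-1 * (b y ^+ 2 - 2 * A x * b y + A x ^+ 2))); last first.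
      by apply/funext => y; rewrite exprMn exprVn mulrC; congr (_ * _); ring.
    apply: integrable_scale; apply: integrable_add => //; apply: integrable_sub; first exact: bI.2.
    by apply: integrable_scale; exact: bI.1.
  + exact: XI.2.
  + exact: measurable_funX.
  transitivity (\int[eta]_x ((S ^+ 2)^-1 * (vb + A x ^+ 2))).
    apply: eq_Rintegral => x _ /=.
    transitivity (\int[gam]_y ((S ^+ 2)^-1 * (b y ^+ 2 - 2 * A x * b y + A x ^+ 2))).
      apply: eq_Rintegral => y _; rewrite /pair_fun/= exprMn exprVn mulrC; congr (_ * _); ring.
    have i1 := integrable_scale (2 * A x) bI.1; have i2 := integrable_sub bI.2 i1.
    rewrite (RintegralZl _ measurableT (integrable_add i2 (cI _))).
    rewrite (RintegralD measurableT i2 (cI _)) (RintegralB measurableT bI.2 i1).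
    rewrite (RintegralZl _ measurableT bI.1) b1 b2 Rintegral_cst//= probability_setT/=.
    by rewrite mulr0 subr0 mulr1.
  have ec : eta.-integrable setT (EFin \o (fun=> vb)) by exact: finite_measure_integrable_cst.
  rewrite (RintegralZl _ measurableT (integrable_add ec AI.2)) (RintegralD measurableT ec AI.2) A2.
  rewrite Rintegral_cst//= probability_setT/= mulr1 SS mulVf// gt_eqF//.
Qed.
End pair_moments.

Section normal_square.
Context {R : realType}.
Local Notation mR := (measurableTypeR R).
Local Notation leb := (@lebesgue_measure R).
Local Notation gam := (normal_prob 0 1 : probability mR R).

Lemma normal_prob_density A : measurable A -> gam A = (\int[leb]_(x in A) (gauss 1 x)%:E)%E.
Proof.
move=> mA; rewrite /= /normal_prob.
by have -> : normal_pdf 0 1 = gauss 1 :> (R -> R) by rewrite gauss_normal_pdf ?sqrtr1.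
Qed.

Let gI := @integrable_density _ mR R leb gam _ (measurable_gauss 1) (gauss_ge0 1) normal_prob_density.
Let gE := @Rintegral_density _ mR R leb gam _ (measurable_gauss 1) (gauss_ge0 1) normal_prob_density.

Let mX k : measurable_fun setT (fun z : mR => (z : R) ^+ k). Proof. exact: measurable_funX. Qed.

Let powI k : gam.-integrable setT (EFin \o (fun z : mR => (z : R) ^+ k)).
Proof. by apply: gI => //; apply: integrable_gauss_pow. Qed.

Lemma normal_square_cube : gam.-integrable setT (EFin \o (fun z : mR => `|(z : R) ^+ 2 - 1| ^+ 3)).
Proof.
apply: integrable_cube_subc => //.
rewrite (_ : (fun _ => _) = (fun z : mR => (z : R) ^+ 6)); first exact: powI.
by apply/funext => z; rewrite ger0_norm ?sqr_ge0// -exprM.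
Qed.

Lemma normal_square_mean : \int[gam]_z ((z : R) ^+ 2 - 1) = 0.
Proof.
have ic : gam.-integrable setT (EFin \o (fun=> 1 : R)) by exact: finite_measure_integrable_cst.
rewrite (RintegralB measurableT (powI 2) ic) Rintegral_cst//= probability_setT/=.
rewrite (gE (mX 2)); last exact: integrable_gauss_pow.
by have [_ ->] := @gauss_moments12 R 1 ltr01; rewrite mulr1 subrr.
Qed.

Lemma normal_square_variance : \int[gam]_z (((z : R) ^+ 2 - 1) ^+ 2) = 2.
Proof.
have ic : gam.-integrable setT (EFin \o (fun=> 1 : R)) by exact: finite_measure_integrable_cst.
transitivity (\int[gam]_z ((z : R) ^+ 4 - 2 * (z : R) ^+ 2 + 1)).
  by apply: eq_Rintegral => z _; ring.
have i2 := integrable_scale 2 (powI 2); have i4 := integrable_sub (powI 4) i2.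
rewrite (RintegralD measurableT i4 ic) (RintegralB measurableT (powI 4) i2).
rewrite (RintegralZl _ measurableT (powI 2)) Rintegral_cst//= probability_setT/=.
rewrite !gE//; [|exact: integrable_gauss_pow|exact: integrable_gauss_pow].
have [_ ->] := @gauss_moments12 R 1 ltr01; rewrite gauss_moment4; ring.
Qed.
End normal_square.

Section ge0_integral_mono.
Context {d} {T : measurableType d} {R : realType} (m : {measure set T -> \bar R}).
Local Open Scope ereal_scope.
Import HBNNSimple.

(* No measurability is required, unlike in [ge0_le_integral]. *)
Lemma ge0_integral_mono (f g : T -> \bar R) : (forall x, 0 <= f x) ->
  (forall x, f x <= g x) -> \int[m]_x f x <= \int[m]_x g x.
Proof.
move=> f0 fg; rewrite !ge0_integralTE//; last by move=> x; exact: le_trans (fg x).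
apply: ge_ereal_sup => _ [h hf <-]; apply: ereal_sup_ubound.
by exists h => // x; exact: le_trans (fg x).
Qed.
End ge0_integral_mono.

(** * Lebesgue integration over tuples *)

Section tuple_lebesgue.
Context {R : realType}.
Local Notation mR := (measurableTypeR R).
Local Notation leb := (@lebesgue_measure R).
Local Notation gam := (normal_prob 0 1 : probability mR R).

Definition aff n (a : R) (b t : n.-tuple mR) : n.-tuple mR :=
  [tuple a * tnth t i + tnth b i | i < n].

Lemma measurable_aff n a (b : n.-tuple mR) : measurable_fun setT (aff a b).
Proof.
apply/measurable_fun_tnthP => i.
rewrite (_ : _ \o _ = (fun t : n.-tuple mR => a * tnth t i + tnth b i)); last first.
  by apply/funext => t /=; rewrite tnth_mktuple.
exact: (measurableT_comp (measurable_affine a (tnth b i)) (measurable_tnth i)).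
Qed.

Lemma aff_cons n a x (c : mR) (b t : n.-tuple mR) :
  aff a (tcons (c, b)) (tcons (x, t)) = tcons ((a * x + c : mR), aff a b t).
Proof.
apply: eq_from_tnth => i; rewrite tnth_mktuple.
by case: (unliftP ord0 i) => [j ->|->]; rewrite ?tnthS ?tnth0 ?tnth_mktuple.
Qed.

Lemma tcons_eta n (b : n.+1.-tuple mR) : exists c b', b = tcons (c, b').
Proof. by case/tupleP: b => c b; exists c, b; apply: val_inj. Qed.

Lemma ge0_integral_tprod_affine n (a : R) (b : n.-tuple mR) (f : n.-tuple mR -> \bar R) :
  0 < a -> measurable_fun setT f -> (forall t, 0 <= f t)%E ->
  (\int[tprod leb n]_t f t = (a ^+ n)%:E * \int[tprod leb n]_t f (aff a b t))%E.
Proof.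
move=> a0; elim: n b f => [|n IH] b f mf f0.
  rewrite !ge0_integral_tprod0//; last exact: (measurableT_comp mf (measurable_aff _ _)).
  by rewrite expr0 mul1e (tuple0 (aff _ _ _)).
have [c [b' ->]] := tcons_eta b.
have mfa : measurable_fun setT (fun t => f (aff a (tcons (c, b')) t)).
  exact: (measurableT_comp mf (measurable_aff _ _)).
rewrite (ge0_integral_tprodS leb mf f0) (ge0_integral_tprodS leb mfa)//.
have mft : measurable_fun setT (fun p : mR * n.-tuple mR => f (tcons p)).
  exact: (measurableT_comp mf (@measurable_tcons _ mR n)).
have mfx (x : mR) : measurable_fun setT (fun t => f (tcons (x, t))).
  exact: (measurableT_comp mft (pair1_measurable x)).
pose F (x : mR) := (\int[tprod leb n]_t f (tcons (x, t)))%E.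
have mF : measurable_fun setT F.
  exact: (@measurable_ge0_integral_tprod _ _ _ leb _ _ n (fun p => f (tcons p))).
have F0 x : (0 <= F x)%E by exact: integral_ge0.
rewrite (ge0_integral_affine c a0 mF F0) exprS EFinM -muleA; congr (_ * _)%E.
have mFa : measurable_fun setT (fun x : mR => F (a * x + c)).
  exact: (measurableT_comp mF (measurable_affine a c)).
have an0 : 0 <= a ^+ n by rewrite exprn_ge0// ltW.
have aff0 x : (0 <= \int[tprod leb n]_t f (aff a (tcons (c, b')) (tcons (x, t))))%E by exact: integral_ge0.
have FE x : F (a * x + c) = ((a ^+ n)%:E * \int[tprod leb n]_t f (aff a (tcons (c, b')) (tcons (x, t))))%E.
  rewrite /F (IH b' _ (mfx _))//; congr (_ * _)%E.
  by apply: eq_integral => t _; rewrite aff_cons.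
transitivity (\int[leb]_x ((a ^+ n)%:E * \int[tprod leb n]_t f (aff a (tcons (c, b')) (tcons (x, t)))))%E.
  by apply: eq_integral => x _; exact: FE.
rewrite ge0_integralZl//.
apply: (@measurable_ge0_integral_tprod _ _ _ leb _ _ n (fun p => f (aff a (tcons (c, b')) (tcons p)))) => //.
exact: (measurableT_comp mfa (@measurable_tcons _ mR n)).
Qed.

Lemma measurable_prod_tnth n (g : 'I_n -> R -> R) : (forall i, measurable_fun setT (g i)) ->
  measurable_fun setT (fun t : n.-tuple mR => \prod_(i < n) g i (tnth t i)).
Proof.
by move=> mg; apply: measurable_prod => i _; exact: (measurableT_comp (mg i) (measurable_tnth i)).
Qed.

Lemma ge0_integral_tprod_prod n (g : 'I_n -> R -> R) :
  (forall i, measurable_fun setT (g i)) -> (forall i x, 0 <= g i x) ->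
  (\int[tprod leb n]_t (\prod_(i < n) g i (tnth t i))%:E = \prod_(i < n) \int[leb]_x (g i x)%:E)%E.
Proof.
elim: n g => [|n IH] g mg g0.
  rewrite ge0_integral_tprod0 ?big_ord0//.
  by apply/measurable_EFinP; exact: measurable_prod_tnth.
have P0 k (u : 'I_k -> R -> R) (t : k.-tuple mR) : (forall i x, 0 <= u i x) ->
    (0 <= (\prod_(i < k) u i (tnth t i))%:E)%E by move=> u0; rewrite lee_fin prodr_ge0.
rewrite ge0_integral_tprodS//; last 2 first.
- by apply/measurable_EFinP; exact: measurable_prod_tnth.
- by move=> t; exact: P0.
rewrite big_ord_recl.
pose c := (\prod_(i < n) \int[leb]_x (g (lift ord0 i) x)%:E)%E.
have c0 : (0 <= c)%E by apply: prode_ge0 => i _; apply: integral_ge0 => x _; rewrite lee_fin.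
have step (x : mR) : (\int[tprod leb n]_t (\prod_(i < n.+1) g i (tnth (tcons (x, t)) i))%:E = (g ord0 x)%:E * c)%E.
  transitivity (\int[tprod leb n]_t ((g ord0 x)%:E * (\prod_(i < n) g (lift ord0 i) (tnth t i))%:E))%E.
    apply: eq_integral => t _; rewrite big_ord_recl tnth0 EFinM; congr (_ * (_)%:E)%E.
    by apply: eq_bigr => i _; rewrite tnthS.
  have mp : measurable_fun setT (fun t : n.-tuple mR => (\prod_(i < n) g (lift ord0 i) (tnth t i))%:E).
    by apply/measurable_EFinP; exact: (@measurable_prod_tnth n (fun i => g (lift ord0 i)) (fun i => mg _)).
  rewrite (ge0_integralZl (tprod leb n) measurableT mp); first by rewrite (IH (fun i => g (lift ord0 i))).
  - by move=> t _; rewrite lee_fin prodr_ge0.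
  - by rewrite lee_fin.
transitivity (\int[leb]_x ((g ord0 x)%:E * c))%E; first by apply: eq_integral => x _; exact: step.
have mg0 : measurable_fun setT (fun x : mR => (g ord0 x)%:E) by apply/measurable_EFinP; exact: mg.
by rewrite (ge0_integralZr leb measurableT mg0)// => x _; rewrite lee_fin.
Qed.

Lemma integral_tprod1 (mu : probability mR R) n : (\int[tprod mu n]_t 1 = 1)%E.
Proof.
elim: n => [|n IH]; first by rewrite ge0_integral_tprod0.
rewrite ge0_integral_tprodS//; under eq_integral do rewrite IH.
by rewrite integral_cst//= probability_setT mule1.
Qed.

Lemma ge0_integral_tprod_gauss n (f : n.-tuple mR -> R) : measurable_fun setT f ->
  (forall t, 0 <= f t <= 1) ->
  (\int[tprod gam n]_t (f t)%:E = \int[tprod leb n]_t (f t * \prod_(i < n) gauss 1 (tnth t i))%:E)%E.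
Proof.
have f0 k (u : k.-tuple mR -> R) : (forall t, 0 <= u t <= 1) -> forall t, 0 <= u t.
  by move=> h t; have /andP[] := h t.
have mgk k : measurable_fun setT (fun t : k.-tuple mR => \prod_(i < k) gauss 1 (tnth t i)).
  exact: (@measurable_prod_tnth k (fun=> gauss 1) (fun=> measurable_gauss 1)).
have gk0 k (t : k.-tuple mR) : 0 <= \prod_(i < k) gauss 1 (tnth t i).
  by apply: prodr_ge0 => i _; exact: gauss_ge0.
elim: n f => [|n IH] f mf f01.
  rewrite !ge0_integral_tprod0 ?big_ord0 ?mulr1//; [|exact/measurable_EFinP].
  by apply/measurable_EFinP; exact: (measurable_funM mf (mgk _)).
have h0 := f0 _ _ f01.
have mfg : measurable_fun setT (fun t => (f t * \prod_(i < n.+1) gauss 1 (tnth t i))%:E).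
  by apply/measurable_EFinP; exact: (measurable_funM mf (mgk _)).
have mfE : measurable_fun setT (fun t => (f t)%:E) by exact/measurable_EFinP.
rewrite (ge0_integral_tprodS gam mfE); last by move=> t; rewrite lee_fin h0.
rewrite (ge0_integral_tprodS leb mfg); last by move=> t; rewrite lee_fin mulr_ge0.
have mft : measurable_fun setT (fun p : mR * n.-tuple mR => f (tcons p)).
  exact: (measurableT_comp mf (@measurable_tcons _ mR n)).
have mfx (x : mR) : measurable_fun setT (fun t => f (tcons (x, t))).
  exact: (measurableT_comp mft (pair1_measurable x)).
pose F (x : mR) := (\int[tprod gam n]_t (f (tcons (x, t)))%:E)%E.
have F0 x : (0 <= F x)%E by apply: integral_ge0 => t _; rewrite lee_fin.
have mF : measurable_fun setT F.
  apply: (@measurable_ge0_integral_tprod _ _ _ gam _ _ n (fun p => (f (tcons p))%:E)).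
    exact/measurable_EFinP.
  by move=> p; rewrite lee_fin h0.
(* The bound [f <= 1] keeps the inner integral finite, as is needed to apply the density formula for
   real-valued functions. *)
have Ffin x : F x \is a fin_num.
  rewrite ge0_fin_numE//.
  apply: (@le_lt_trans _ _ (\int[tprod gam n]_t 1)%E); last by rewrite integral_tprod1 ltry.
  by apply: ge0_integral_mono => t; rewrite lee_fin; have /andP[] := f01 (tcons (x, t)).
have FE x : F x = (\int[tprod leb n]_t (f (tcons (x, t)) * \prod_(i < n) gauss 1 (tnth t i))%:E)%E.
  by apply: IH => // t; exact: f01.
transitivity (\int[gam]_x (fine (F x))%:E)%E.
  by apply: eq_integral => x _; rewrite fineK.
rewrite (@ge0_integral_density _ mR R leb gam _ (measurable_gauss 1) (gauss_ge0 1) (@normal_prob_density R)); last 2 first.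
- by apply: measurableT_comp mF.
- by move=> x; rewrite fine_ge0.
apply: eq_integral => x _; rewrite EFinM fineK// FE -ge0_integralZr//.
- apply: eq_integral => t _; rewrite -EFinM big_ord_recl tnth0; congr EFin.
  rewrite -mulrA; congr (_ * _); rewrite mulrC; congr (_ * _).
  by apply: eq_bigr => i _; rewrite tnthS.
- by apply/measurable_EFinP; exact: (measurable_funM (mfx x) (mgk _)).
- by move=> t _; rewrite lee_fin mulr_ge0.
- by rewrite lee_fin gauss_ge0.
Qed.
End tuple_lebesgue.

(** * The decoding error of an infinite constellation *)

Section limits.
Context {R : realType}.
Local Open Scope ereal_scope.

Lemma elimsup_ge (g : R -> \bar R) v : (forall M, exists2 a, (M < a)%R & v <= g a) ->
  v <= elimsup_pinfty g.
Proof.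
move=> hg; apply: le_ereal_inf_tmp => _ [M _ <-]; have [a Ma va] := hg M.
by apply: (le_trans va); apply: ereal_sup_ubound; exists a.
Qed.

Lemma elimsup_le (g : R -> \bar R) v M : (forall a, (M < a)%R -> g a <= v) ->
  elimsup_pinfty g <= v.
Proof.
move=> hg; apply: (@le_trans _ _ (ereal_sup (g @` [set a | (M < a)%R]))).
  by apply: ereal_inf_lbound; exists M.
by apply: ge_ereal_sup => _ [a Ma <-]; exact: hg.
Qed.

Lemma elimsup_gtP (g : R -> \bar R) v M : v < elimsup_pinfty g -> exists2 a, (M < a)%R & v < g a.
Proof.
move=> hv; have /ereal_sup_gt [_ [a Ma <-] va] : v < ereal_sup (g @` [set a | (M < a)%R]).
  by apply: (lt_le_trans hv); apply: ereal_inf_lbound; exists M.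
by exists a.
Qed.

Lemma elimsup_ltP (g : R -> \bar R) v : elimsup_pinfty g < v -> exists M, forall a, (M < a)%R -> g a < v.
Proof.
move=> /ereal_inf_lt [_ [M _ <-] hM]; exists M => a Ma; apply: le_lt_trans hM.
by apply: ereal_sup_ubound; exists a.
Qed.

(** Continuity of [P] from above; it serves to cut off large noise and small gains. *)
Lemma vanishing_tail d (T : measurableType d) (P : probability T R) (F : nat -> set T) (del : R) :
  (forall k, measurable (F k)) -> (forall k l, (k <= l)%N -> F l `<=` F k) ->
  \bigcap_k F k = set0 -> (0 < del)%R -> exists k, P (F k) <= del%:E.
Proof.
move=> mF ndF F0 del0.
have : P \o F @ \oo --> P (\bigcap_k F k).
  apply: nonincreasing_cvg_mu => //.
  - by rewrite (le_lt_trans (probability_le1 P (mF 0%N)))// ltry.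
  - exact: bigcapT_measurable.
  - by move=> k l kl; apply/subsetPset; exact: ndF.
rewrite F0 measure0 => /fine_cvgP[_ /cvgrPdist_lt/(_ _ del0)[k _ /(_ k (leqnn k))]] /=.
rewrite sub0r normrN => hk; exists k.
rewrite -(fineK (fin_num_measure P _ (mF k))) lee_fin.
exact: le_trans (ler_norm _) (ltW hk).
Qed.
End limits.

(** * Volume of the decoding regions *)

Section decoding.
Context {R : realType}.
Local Notation mR := (measurableTypeR R).
Local Notation leb := (@lebesgue_measure R).
Local Notation gam := (normal_prob 0 1 : probability mR R).

Lemma measurable_forall_countable d (T : measurableType d) (U : choiceType) (S : set U)
    (F : U -> set T) : countable S -> (forall s, S s -> measurable (F s)) ->
  measurable [set t | forall s, S s -> F s t].
Proof.
move=> /countable_injP[f injf] mF.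
rewrite (_ : [set t | _] = \bigcap_k [set t | forall s, S s -> f s = k -> F s t]); last first.
  by apply/seteqP; split => t /= h; [move=> k _ s Ss _|move=> s Ss; exact: (h (f s))]; exact: h.
apply: bigcapT_measurable => k.
have [[s [Ss fs]]|nos] := pselect (exists s, S s /\ f s = k).
  rewrite (_ : [set t | _] = F s); first exact: mF.
  apply/seteqP; split => t /=; first exact.
  move=> Ft s' Ss' fs'; suff -> : s' = s by [].
  by apply: injf; rewrite ?inE// fs fs'.
rewrite (_ : [set t | _] = setT)//; apply/seteqP; split => // t _ s Ss fs.
by exfalso; apply: nos; exists s.
Qed.

Lemma sum_indic_le1 (T : Type) (U : eqType) (sq : seq U) (E : U -> set T) (t : T) :
  uniq sq -> (forall s s', s \in sq -> s' \in sq -> E s t -> E s' t -> s = s') ->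
  \sum_(s <- sq) (\1_(E s) t : R) <= 1.
Proof.
elim: sq => [|s sq IH]; first by rewrite big_nil.
move=> /= /andP[sn us] hE; rewrite big_cons.
have [Est|nEst] := pselect (E s t); last first.
  rewrite indicE memNset// add0r; apply: IH => // u v hu hv.
  by apply: hE; rewrite inE ?hu ?hv orbT.
rewrite big_seq big1 ?addr0; first by rewrite indicE; case: (_ \in _).
move=> u us'; rewrite indicE memNset// => Eu.
by move: sn; rewrite (hE s u) ?mem_head ?inE ?us' ?orbT.
Qed.

Variables (n : nat) (S : set 'rV[R]_n) (h : 'I_n -> R) (sg : R).
Hypotheses (cS : countable S) (h_gt0 : forall i, 0 < h i) (sg0 : 0 < sg).

(** The Voronoi cell of the faded point, in coordinates centred at this point and in terms of the
    normalized noise [t]; ties count as correct. *)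
Definition correct (s : 'rV[R]_n) : set (n.-tuple mR) :=
  [set t | forall s', S s' -> \sum_i (sg * tnth t i) ^+ 2 <=
    \sum_i (sg * tnth t i + h i * (s ord0 i - s' ord0 i)) ^+ 2].

Lemma measurable_sum_tnth (k : nat) (g : 'I_k -> R -> R) : (forall i, measurable_fun setT (g i)) ->
  measurable_fun setT (fun t : k.-tuple mR => \sum_(i < k) g i (tnth t i)).
Proof.
by move=> mg; apply: measurable_sum => i; exact: (measurableT_comp (mg i) (measurable_tnth i)).
Qed.

Lemma measurable_le_set d (T : measurableType d) (f g : T -> R) :
  measurable_fun setT f -> measurable_fun setT g -> measurable [set t | f t <= g t].
Proof.
move=> mf mg; rewrite (_ : [set t | _] = (fun t => f t <= g t) @^-1` [set true]).
  by rewrite -[X in measurable X]setTI; exact: (measurable_fun_ler mf mg).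
by apply/seteqP; split => t /=.
Qed.

Lemma measurable_correct s : measurable (correct s).
Proof.
apply: (@measurable_forall_countable _ _ _ S (fun s' => [set t | \sum_i (sg * tnth t i) ^+ 2 <=
    \sum_i (sg * tnth t i + h i * (s ord0 i - s' ord0 i)) ^+ 2])) => // s' _.
apply: measurable_le_set.
  apply: (@measurable_sum_tnth n (fun i x => (sg * x) ^+ 2)) => i.
  by apply: measurable_funX; exact: measurable_funM.
apply: (@measurable_sum_tnth n (fun i x => (sg * x + h i * (s ord0 i - s' ord0 i)) ^+ 2)) => i.
by apply: measurable_funX; apply: measurable_funD => //; exact: measurable_funM.
Qed.

Definition box (r : R) : set (n.-tuple mR) := [set t | forall i, `|tnth t i| <= r].

Lemma measurable_box r : measurable (box r).
Proof.
rewrite /box (_ : [set t | _] = \bigcap_(i in [set: 'I_n]) [set t : n.-tuple mR | `|tnth t i| <= r]).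
  apply: fin_bigcap_measurable => // i _; apply: measurable_le_set => //.
  exact: (measurableT_comp (@normr_measurable R setT) (measurable_tnth i)).
by apply/seteqP; split => t /= ht i; [move=> _|]; exact: ht.
Qed.

(** With this offset [aff a] turns a position, in units of [sg], into the noise relative to the
    faded point of [s], dilated by [a]. *)
Definition center (a : R) (s : 'rV[R]_n) : n.-tuple mR :=
  [tuple - (a * (h i * s ord0 i / sg)) | i < n].

Lemma tnth_center a s t i : tnth (aff a (center a s) t) i = a * (tnth t i - h i * s ord0 i / sg).
Proof. by rewrite !tnth_mktuple mulrBr. Qed.

(* Each of the two inequalities puts the unscaled point on its own side of the bisector, so that
   dilating by [a > 1] around each centre makes the two decoding regions disjoint. *)
Lemma correct_unique a s s' t : 1 < a -> S s -> S s' ->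
  correct s (aff a (center a s) t) -> correct s' (aff a (center a s') t) -> s = s'.
Proof.
move=> a1 Ss Ss' /(_ _ Ss') c1 /(_ _ Ss) c2.
pose D i := h i * s ord0 i - h i * s' ord0 i.
have : \sum_i (2 * (a - 1) * D i ^+ 2) <= 0.
  rewrite -subr_ge0 in c1; rewrite -subr_ge0 in c2.
  rewrite -oppr_ge0 -sumrN; have := addr_ge0 c1 c2; rewrite -!sumrB -big_split/=.
  suff -> : \sum_i (- (2 * (a - 1) * D i ^+ 2)) = \sum_(i < n)
     ((sg * tnth (aff a (center a s) t) i + h i * (s ord0 i - s' ord0 i)) ^+ 2 -
      (sg * tnth (aff a (center a s) t) i) ^+ 2 +
     ((sg * tnth (aff a (center a s') t) i + h i * (s' ord0 i - s ord0 i)) ^+ 2 -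
      (sg * tnth (aff a (center a s') t) i) ^+ 2)) by [].
  apply: eq_bigr => i _; rewrite !tnth_center /D; have := sg0; rewrite lt0r => /andP[sgn _].
  by field.
have D0 i : 0 <= 2 * (a - 1) * D i ^+ 2.
  by rewrite mulr_ge0 ?sqr_ge0// mulr_ge0// subr_ge0 ltW.
move=> sumD; have /eqP := le_anti (introT andP (conj sumD (sumr_ge0 _ (fun i _ => D0 i)))).
rewrite psumr_eq0; last by move=> i _; exact: D0.
move=> /allP hD; apply/rowP => i.
have := hD i (mem_index_enum _); rewrite /= mulf_eq0 mulf_eq0 (negbTE (lt0r_neq0 (ltr0Sn _ 1)))/=.
rewrite subr_eq0 (gt_eqF a1)/= sqrf_eq0 /D -mulrBr mulf_eq0 (gt_eqF (h_gt0 i))/= subr_eq0.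
by move/eqP; rewrite !(ord1 ord0).
Qed.

Definition decode r s := correct s `&` box r.

Lemma measurable_decode r s : measurable (decode r s).
Proof. by apply: measurableI; [exact: measurable_correct|exact: measurable_box]. Qed.

(** In common coordinates the regions for dilation factor [a] are disjoint, and truncation by [r]
    confines them to the faded cube with a margin [r]. The dilation replaces an argument about null
    boundaries of Voronoi cells, at the cost of a^n. *)
Lemma volume_sum a r A (sq : seq 'rV[R]_n) : 1 < a -> 0 < r -> 0 < A -> uniq sq ->
  (forall s, s \in sq -> S s /\ cube A s) ->
  (\sum_(s <- sq) \int[tprod leb n]_t (\1_(decode r s) t)%:E <=
   (a ^+ n * \prod_i (h i * A / sg + 2 * r))%:E)%E.
Proof.
move=> a1 r0 A0 us hs; have a0 : 0 < a by exact: lt_trans a1.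
have an0 : 0 <= a ^+ n by rewrite exprn_ge0// ltW.
have mi s : measurable_fun setT (fun t => (\1_(decode r s) t : R)%:E).
  by apply/measurable_EFinP; apply: measurable_indic; exact: measurable_decode.
have i0 s t : (0 <= (\1_(decode r s) t : R)%:E)%E by rewrite lee_fin.
have mia s : measurable_fun setT (fun t => (\1_(decode r s) (aff a (center a s) t) : R)%:E).
  exact: (measurableT_comp (mi s) (measurable_aff _ _)).
rewrite (eq_bigr (fun s => (a ^+ n)%:E * \int[tprod leb n]_t (\1_(decode r s) (aff a (center a s) t))%:E)%E); last first.
  by move=> s _; rewrite (ge0_integral_tprod_affine (center a s) a0 (mi s)).
rewrite -ge0_sume_distrr; last by move=> s _; exact: integral_ge0.
rewrite -ge0_integral_sum//.
rewrite EFinM lee_wpmul2l ?lee_fin//.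
pose rho i := h i * A / (2 * sg) + r.
have rho0 i : 0 < rho i by rewrite addr_gt0// divr_gt0 ?mulr_gt0.
pose g i (x : R) : R := \1_(`[- rho i, rho i]%classic : set R) x.
have mg i : measurable_fun setT (g i) by apply: measurable_indic.
have g0 i x : 0 <= g i x by [].
have <- : (\int[tprod leb n]_t (\prod_i g i (tnth t i))%:E = (\prod_i (h i * A / sg + 2 * r))%:E)%E.
  rewrite ge0_integral_tprod_prod// -prodEFin; apply: eq_bigr => i _.
  transitivity (lebesgue_measure (`[- rho i, rho i]%classic : set R)).
    by rewrite /g integral_indic// setIT.
  rewrite lebesgue_measure_itv/= lte_fin.
  rewrite -subr_gt0 opprK addr_gt0// -EFinD; congr EFin; rewrite /rho.
  by have := sg0; rewrite lt0r => /andP[sgn _]; field.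
apply: ge0_integral_mono => t.
  by apply: sume_ge0.
rewrite sumEFin lee_fin.
have [hb|nhb] := pselect (forall i, `|tnth t i| <= rho i).
  rewrite [leRHS]big1 => [|i _]; last by rewrite /g indicE mem_set//= in_itv/= -ler_norml.
  apply: (@sum_indic_le1 _ _ sq (fun s => [set t | decode r s (aff a (center a s) t)])) => //.
  move=> s s' ss ss' [c1 _] [c2 _]; have [Ss _] := hs _ ss; have [Ss' _] := hs _ ss'.
  exact: correct_unique c1 c2.
rewrite big_seq big1; first by apply: prodr_ge0.
move=> s ss; rewrite indicE memNset// => -[_ bx]; apply: nhb => i.
have [_ /(_ i)] := hs _ ss => hA; have := bx i; rewrite tnth_center normrM (gtr0_norm a0) => ht.
have ht' : `|tnth t i - h i * s ord0 i / sg| <= r.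
  by apply: le_trans ht; rewrite ler_peMl// ltW.
rewrite -(subrK (h i * s ord0 i / sg) (tnth t i)); apply: (le_trans (ler_normD _ _)).
rewrite /rho addrC; apply: lerD => //; have sgn : sg != 0 by rewrite gt_eqF.
rewrite !normrM normfV (gtr0_norm (h_gt0 i)) (gtr0_norm sg0).
have -> : h i * A / (2 * sg) = h i * (A / 2) / sg by field.
by rewrite ler_wpM2r ?invr_ge0 ?(ltW sg0)// ler_wpM2l ?(ltW (h_gt0 i))// ltW.
Qed.

Definition energy_le (rho2 : R) : set (n.-tuple mR) := [set t | \sum_i tnth t i ^+ 2 <= rho2].

Lemma measurable_energy_le rho2 : measurable (energy_le rho2).
Proof.
apply: measurable_le_set => //; apply: (@measurable_sum_tnth n (fun i x => x ^+ 2)) => i.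
exact: measurable_funX.
Qed.

Lemma prod_gauss (t : n.-tuple mR) : \prod_i gauss 1 (tnth t i) =
  (Num.sqrt (2 * pi)) ^- n * expR (- (\sum_i tnth t i ^+ 2) / 2).
Proof.
transitivity (\prod_(i < n) ((Num.sqrt (2 * pi))^-1 * expR (- (tnth t i ^+ 2) / 2))).
  by apply: eq_bigr => i _; rewrite gaussE !mulr1.
by rewrite big_split/= prodr_const card_ord exprVn -expR_sum mulNr mulr_suml -sumrN; congr (_ * expR _);
  apply: eq_bigr => i _; rewrite mulNr.
Qed.

Lemma tprod_gauss_indic (A : set (n.-tuple mR)) : measurable A ->
  (tprod gam n A = \int[tprod leb n]_t (\1_A t * \prod_i gauss 1 (tnth t i))%:E)%E.
Proof.
move=> mA; rewrite -ge0_integral_tprod_gauss; first by rewrite integral_indic// setIT.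
  exact: measurable_indic.
by move=> t; rewrite indicE; case: (_ \in _); rewrite ler01 lexx.
Qed.

(** Truncation to a box is needed besides the ball, because the cells of points near the border of a
    cube may reach far outside it. *)
Lemma correct_prob rho2 r s :
  (tprod gam n (correct s) <= tprod gam n (energy_le rho2) + tprod gam n (~` box r) +
   (Num.sqrt (2 * pi) ^- n * expR (- rho2 / 2))%:E * \int[tprod leb n]_t (\1_(decode r s) t)%:E)%E.
Proof.
have mB := measurable_energy_le rho2; have mX := measurableC (measurable_box r).
have mD := measurable_decode r s.
have mDB := measurableD mD mB.
apply: (@le_trans _ _ (tprod gam n ((energy_le rho2 `|` ~` box r) `|` (decode r s `\` energy_le rho2)))).
  apply: le_measure; rewrite ?inE.
  - exact: measurable_correct.
  - by apply: measurableU => //; exact: measurableU.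
  - move=> t ct; have [tB|tB] := pselect (energy_le rho2 t); first by left; left.
    by have [tX|tX] := pselect (box r t); [right|left; right].
apply: (le_trans (measureU2 _ _ _)) => //; first exact: measurableU.
apply: leeD; first exact: measureU2.
apply: (@le_trans _ _ (\int[tprod leb n]_t (\1_(decode r s `\` energy_le rho2) t * \prod_i gauss 1 (tnth t i))%:E)%E);
  first by rewrite -(tprod_gauss_indic mDB).
rewrite -ge0_integralZl//; first last.
- by apply/measurable_EFinP; exact: measurable_indic.
apply: ge0_integral_mono => t.
  by rewrite lee_fin mulr_ge0//; apply: prodr_ge0 => i _; exact: gauss_ge0.
rewrite -EFinM lee_fin prod_gauss !indicE.
have c0 : 0 <= Num.sqrt (2 * pi) ^- n :> R by rewrite invr_ge0 exprn_ge0// sqrtr_ge0.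
case: (boolP (t \in decode r s `\` energy_le rho2)) => [|_]; last first.
  by rewrite mul0r !mulr_ge0// expR_ge0.
rewrite inE => -[Dt nBt]; rewrite mem_set// mul1r mulr1 ler_wpM2l// ler_expR.
rewrite !mulNr lerN2 ler_pM2r// ltW// ltNge; exact/negP.
Qed.
End decoding.

Section average_error.
Context {d} {T : measurableType d} {R : realType}.
Local Notation mR := (measurableTypeR R).
Local Notation leb := (@lebesgue_measure R).
Local Notation gam := (normal_prob 0 1 : probability mR R).
Variables (P : probability T R) (Z : nat -> T -> R).
Hypothesis mZ : forall i, measurable_fun setT (Z i).
Hypothesis iZ : mutually_independent P Z.
Hypothesis lZ : forall i B, measurable B -> P (Z i @^-1` B) = normal_prob 0 1 B.
Variables (n : nat) (S : set 'rV[R]_n) (h : 'I_n -> R) (s2 : R).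
Hypotheses (cS : countable S) (h_gt0 : forall i, 0 < h i) (s20 : 0 < s2).
Let sg := Num.sqrt s2.
Let sg0 : 0 < sg. Proof. by rewrite sqrtr_gt0. Qed.

Lemma noise_law A : measurable A -> P (rvec Z n 0 @^-1` A) = tprod gam n A.
Proof. exact: (@rvec_law _ _ _ P Z gam mZ iZ lZ n 0). Qed.

Lemma tprod_gauss_fin (A : set (n.-tuple mR)) : measurable A -> tprod gam n A \is a fin_num.
Proof. by move=> mA; rewrite -noise_law// fin_num_measure// -[X in measurable X]setTI; exact: measurable_rvec. Qed.

Lemma energy_probE rho2 :
  P [set w | \sum_(i < n) Z i w ^+ 2 <= rho2] = tprod gam n (energy_le rho2).
Proof.
rewrite -noise_law; last exact: measurable_energy_le.
have E w : \sum_i tnth (rvec Z n 0 w) i ^+ 2 = \sum_(i < n) Z i w ^+ 2.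
  by apply: eq_bigr => i _; rewrite tnth_rvec.
by congr (P _); apply/seteqP; split => w; rewrite /energy_le /= E.
Qed.

Lemma error_setE s : [set w | ~ voronoi (fade h @` S) (fade h s) (fade h s + noise_vec n Z s2 w)] =
  rvec Z n 0 @^-1` (~` correct S h sg s).
Proof.
have E s' w : sqnorm (fade h s + noise_vec n Z s2 w - fade h s') =
    \sum_i (sg * tnth (rvec Z n 0 w) i + h i * (s ord0 i - s' ord0 i)) ^+ 2.
  by apply: eq_bigr => i _; rewrite !mxE tnth_rvec; congr (_ ^+ 2); rewrite -/sg add0n; ring.
have E0 w : sqnorm (fade h s + noise_vec n Z s2 w - fade h s) =
    \sum_i (sg * tnth (rvec Z n 0 w) i) ^+ 2.
  by rewrite E; apply: eq_bigr => i _; rewrite subrr mulr0 addr0.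
apply/seteqP; split => w /=; apply: contra_not => hw.
  by move=> _ [s' Ss' <-]; rewrite E0 E; exact: hw.
by move=> s' Ss'; rewrite -E0 -E; apply: hw; exists s'.
Qed.

Lemma measurable_error_set s :
  measurable [set w | ~ voronoi (fade h @` S) (fade h s) (fade h s + noise_vec n Z s2 w)].
Proof.
rewrite error_setE -[X in measurable X]setTI; apply: measurable_rvec => //.
by apply: measurableC; exact: measurable_correct.
Qed.

Lemma cond_errE s : cond_err P Z s2 S h s = (1 - tprod gam n (correct S h sg s))%E.
Proof.
have mc := measurable_correct h sg cS s.
rewrite /cond_err error_setE -noise_law// -preimage_setC probability_setC//.
by rewrite -[X in measurable X]setTI; exact: measurable_rvec.
Qed.

(** One [del] pays for noise outside the box, the other for the total volume of the decoding regions
    compared with the number of points. *)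
Lemma avg_err_lower (A a r rho2 del : R) : 1 < a -> 0 < r -> 0 < A -> 0 <= del ->
  finite_set (S `&` cube A) -> (0 < size (finmap.enum_fset (fset_set (S `&` cube A))))%N ->
  (tprod gam n (~` box r) <= del%:E)%E ->
  Num.sqrt (2 * pi) ^- n * expR (- rho2 / 2) * (a ^+ n * \prod_i (h i * A / sg + 2 * r)) <=
    del * (size (finmap.enum_fset (fset_set (S `&` cube A))))%:R ->
  ((1 - 2 * del)%:E <= avg_err P Z s2 S h A + P [set w | (\sum_(i < n) Z i w ^+ 2 <= rho2)%R])%E.
Proof.
move=> a1 r0 A0 del0 fA cA bx hW.
pose sq : seq 'rV[R]_n := finmap.enum_fset (fset_set (S `&` cube A)).
have sqE s : s \in sq -> S s /\ cube A s.
  have -> : (s \in sq) = (s \in S `&` cube A) := in_fset_set fA s.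
  by rewrite inE.
have usq : uniq sq by exact: finmap.fset_uniq.
set N := size _ in cA hW; have N0 : 0 < N%:R :> R by rewrite ltr0n.
have -> : avg_err P Z s2 S h A =
    ((\sum_(s <- sq) (1 - tprod gam n (correct S h sg s))) * (N%:R^-1)%:E)%E.
  rewrite /avg_err /counting asboolT// -/N N0; congr (_ * _)%E.
  rewrite esum_fset//.
    rewrite fsbig_finite//= -/sq big_seq [RHS]big_seq; by apply: eq_bigr => s ss; rewrite cond_errE.
rewrite energy_probE.
pose x s := fine (tprod gam n (correct S h sg s)).
pose pB := fine (tprod gam n (energy_le rho2)).
pose pX := fine (tprod gam n (~` box r)).
have xE s : tprod gam n (correct S h sg s) = (x s)%:E.
  by rewrite fineK// tprod_gauss_fin//; exact: measurable_correct.
have BE : tprod gam n (energy_le rho2) = pB%:E.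
  by rewrite fineK// tprod_gauss_fin//; exact: measurable_energy_le.
have XE : tprod gam n (~` box r) = pX%:E.
  by rewrite fineK// tprod_gauss_fin//; apply: measurableC; exact: measurable_box.
rewrite XE lee_fin in bx.
under eq_bigr do rewrite xE -EFinB.
rewrite BE sumEFin -EFinM -EFinD lee_fin.
have hsum : \sum_(s <- sq) x s <= N%:R * (pB + pX) + del * N%:R.
  apply: le_trans (lerD (lexx _) hW); rewrite -lee_fin -sumEFin.
  apply: (@le_trans _ _ (\sum_(s <- sq) (((pB + pX)%:E) +
    (Num.sqrt (2 * pi) ^- n * expR (- rho2 / 2))%:E * \int[tprod leb n]_t (\1_(decode S h sg r s) t)%:E))%E).
    apply: lee_sum => s _; rewrite -xE EFinD -BE -XE.
    exact: correct_prob.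
  have c0 : 0 <= Num.sqrt (2 * pi) ^- n * expR (- rho2 / 2).
    by rewrite mulr_ge0// ?expR_ge0// invr_ge0 exprn_ge0// sqrtr_ge0.
  rewrite big_split/= -ge0_sume_distrr; last first.
    by move=> s _; apply: integral_ge0 => t _; rewrite lee_fin.
  rewrite sumEFin EFinD; apply: leeD.
    by rewrite lee_fin big_const_seq count_predT iter_addr_0 mulr_natl.
  by rewrite [leRHS]EFinM lee_wpmul2l ?lee_fin//; exact: volume_sum.
rewrite sumrB big_const_seq count_predT iter_addr_0 -lerBlDr ler_pdivlMr//.
rewrite (_ : 1 *+ size sq = N%:R :> R)//.
have : N%:R * pX <= N%:R * del by rewrite ler_wpM2l// ltW.
by move: hsum; rewrite mulrDr; set u := \sum_(s <- sq) x s; lra.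
Qed.

Lemma box_tail (del : R) : 0 < del -> exists2 r, 0 < r & (tprod gam n (~` box r) <= del%:E)%E.
Proof.
move=> del0; pose F k : set T := rvec Z n 0 @^-1` (~` box k%:R).
have mF k : measurable (F k).
  rewrite -[X in measurable X]setTI; apply: measurable_rvec => //.
  by apply: measurableC; exact: measurable_box.
have [||k Pk] := @vanishing_tail R _ _ P F del mF _ _ del0.
- move=> k l kl w; rewrite /F /= /box; apply: contra_not => hb i.
  by apply: le_trans (hb i) _; rewrite ler_nat.
- apply/seteqP; split => // w /(_ (\max_(i < n) (Num.truncn `|tnth (rvec Z n 0 w) i|).+1)%N I); apply => i.
  apply: ltW; apply: (lt_le_trans (truncnS_gt _)); rewrite ler_nat.
  exact: (leq_bigmax i).
- exists k.+1%:R => //; apply: le_trans Pk; rewrite -noise_law; last by apply: measurableC; exact: measurable_box.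
  apply: le_measure; rewrite ?inE//; first exact: (mF k.+1).
  by move=> w; apply: contra_not => hb i; apply: le_trans (hb i) _; rewrite ler_nat.
Qed.

(** In [2 * expR 2] the 2 stems from a cube that holds at least half of the points expected from the
    density, one factor e from the dilation and one from the margin [r]. *)
Lemma avg_err_elimsup_lower (gam0 del rho2 : R) : (0 < n)%N -> IC_density S = gam0%:E -> 0 < gam0 -> 0 < del ->
  2 * expR 2 * \prod_i h i * expR (- rho2 / 2) <= del * gam0 * (Num.sqrt (2 * pi) * sg) ^+ n ->
  ((1 - 2 * del)%:E <= elimsup_pinfty (avg_err P Z s2 S h) + P [set w | (\sum_(i < n) Z i w ^+ 2 <= rho2)%R])%E.
Proof.
move=> n0 hS g0 del0 hrho; have [r r0 hr] := box_tail del0.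
set p := P _; have pfin : p \is a fin_num.
  by rewrite /p energy_probE tprod_gauss_fin//; exact: measurable_energy_le.
rewrite -(fineK pfin) -leeBlDr// -EFinB; apply: elimsup_ge => M.
(* The upper density is finite, so cubes contain finitely many points from some size on. *)
have [M0 hM0] : exists M0 : R, forall A, M0 < A -> (counting (S `&` cube A) * ((A ^+ n)^-1)%:E < (gam0 + 1)%:E)%E.
  by apply: elimsup_ltP; rewrite -[X in (X < _)%E]/(IC_density S) hS lte_fin ltrDl.
(* Beyond [A0] the margin 2 r is at most 1/n of each side h_i A / sg, so it enlarges the volume by
   at most (1 + 1/n)^n <= e. *)
pose A0 := \sum_i (2 * r * sg * n%:R / h i).
pose M1 := Num.max (Num.max M M0) (Num.max 0 A0).
have [A hA1 hA2] : exists2 A : R, M1 < A & ((gam0 / 2)%:E < counting (S `&` cube A) * ((A ^+ n)^-1)%:E)%E.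
  apply: elimsup_gtP; rewrite -[X in (_ < X)%E]/(IC_density S) hS lte_fin.
  by rewrite ltr_pdivrMr// mulr_natr mulr2n ltrDl.
move: hA1; rewrite /M1 !gt_max => /andP[/andP[AM AM0] /andP[A_gt0 AA0]].
exists A => //; rewrite EFinB leeBlDr// fineK//.
have An0 : 0 < A ^+ n by rewrite exprn_gt0.
have fA : finite_set (S `&` cube A).
  have := hM0 _ AM0; rewrite /counting; case: asboolP => // _.
  by rewrite mulyr gtr0_sg ?invr_gt0// mul1e.
have cE : counting (S `&` cube A) = (size (finmap.enum_fset (fset_set (S `&` cube A))))%:R%:E :> \bar R.
  by rewrite /counting asboolT.
rewrite cE -EFinM lte_fin ltr_pdivlMr// in hA2.
set N := size _ in hA2; have N0 : (0 < N)%N.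
  rewrite -(ltr_nat R); apply: le_lt_trans hA2; by rewrite mulr_ge0 ?divr_ge0 ?ltW.
pose a : R := expR n%:R^-1.
have n0' : 0 < n%:R :> R by rewrite ltr0n.
have an : a ^+ n = expR 1 by rewrite /a -expRM_natr mulVf// gt_eqF.
apply: (@avg_err_lower A a r rho2 del) => //; first by rewrite /a expR_gt1 invr_gt0.
  exact: ltW.
rewrite -/N an.
have sgn0 : sg != 0 by rewrite gt_eqF.
have hprod : \prod_i (h i * A / sg + 2 * r) <= expR 1 * (\prod_i h i * (A / sg) ^+ n).
  have -> : expR 1 * (\prod_i h i * (A / sg) ^+ n) = \prod_(i < n) (a * (h i * (A / sg))).
    by rewrite big_split/= prodr_const card_ord an big_split/= prodr_const card_ord.
  apply: ler_prod => i _; apply/andP; split.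
    by rewrite addr_ge0 ?mulr_ge0// ?invr_ge0 ltW.
  have hi0 := h_gt0 i.
  have ti : 2 * r * sg * n%:R / h i <= A.
    apply: le_trans (ltW AA0); rewrite /A0 (bigD1 i)//= lerDl sumr_ge0// => j _.
    by rewrite divr_ge0 ?mulr_ge0// ltW.
  apply: (@le_trans _ _ ((1 + n%:R^-1) * (h i * (A / sg)))); last first.
    by rewrite ler_wpM2r ?expR_ge1Dx// mulr_ge0 ?divr_ge0// ltW.
  have -> : h i * A / sg = h i * (A / sg) by rewrite mulrA.
  rewrite [leRHS]mulrDl mul1r lerD2l.
  have -> : 2 * r = n%:R^-1 * (h i * (2 * r * sg * n%:R / h i / sg)) by field; rewrite !gt_eqF.
  by rewrite !ler_wpM2l ?invr_ge0 ?ler0n ?(ltW hi0)// ler_wpM2r// invr_ge0 ltW.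
have sp0 : 0 < Num.sqrt (2 * pi) :> R by rewrite sqrtr_gt0 mulr_gt0// pi_gt0.
set sp := Num.sqrt (2 * pi) in hrho sp0 *; set E := expR (- rho2 / 2) in hrho *.
have spn0 : 0 < sp ^+ n by rewrite exprn_gt0.
have sgn : 0 < sg ^+ n by rewrite exprn_gt0.
have E0 : 0 <= E by exact: expR_ge0.
apply: (@le_trans _ _ (sp ^- n * E * (expR 1 * (expR 1 * (\prod_i h i * (A / sg) ^+ n))))).
  by rewrite !ler_wpM2l// ?mulr_ge0 ?expR_ge0 ?invr_ge0 ?(ltW spn0).
have -> : sp ^- n * E * (expR 1 * (expR 1 * (\prod_i h i * (A / sg) ^+ n))) =
   (2 * expR 2 * \prod_i h i * E) * (A ^+ n / 2) / (sp * sg) ^+ n.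
  have -> : expR 2 = expR 1 * expR 1 :> R by rewrite -expRD.
  rewrite exprMn exprVn exprMn; field.
  by rewrite !gt_eqF.
rewrite ler_pdivrMr ?exprn_gt0 ?mulr_gt0//.
apply: (@le_trans _ _ (del * gam0 * (sp * sg) ^+ n * (A ^+ n / 2))).
  by rewrite ler_wpM2r// divr_ge0// ltW.
have -> : del * gam0 * (sp * sg) ^+ n * (A ^+ n / 2) = del * (gam0 / 2 * A ^+ n) * (sp * sg) ^+ n.
  by field.
by rewrite ler_wpM2r ?exprn_ge0 ?mulr_ge0 ?ltW// ltr_pM2l.
Qed.
End average_error.

(** * The converse bound *)

Section probability_bounds.
Context {d} {T : measurableType d} {R : realType} (P : probability T R).

Definition law (X : T -> measurableTypeR R) (mX : measurable_fun setT X) :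
    probability (measurableTypeR R) R :=
  distribution P (mfun_Sub (mem_set mX)).

Lemma union_bound (E : nat -> set T) (del : R) n : (forall i, measurable (E i)) ->
  (forall i, (P (E i) <= del%:E)%E) ->
  measurable [set w | exists i : 'I_n, E i w] /\
  (P [set w | exists i : 'I_n, E i w] <= (n%:R * del)%:E)%E.
Proof.
move=> mE hE; elim: n => [|n [mU hU]].
  rewrite (_ : [set w | _] = set0) ?measure0 ?mul0r//.
  by apply/seteqP; split => // w [[]].
rewrite (_ : [set w | _] = [set w | exists i : 'I_n, E i w] `|` E n); last first.
  apply/seteqP; split => w /=.
    move=> [i Ei]; have [ni|ni] := ltnP i n; first by left; exists (Ordinal ni).
    by right; rewrite (_ : n = i)//; apply/eqP; rewrite eqn_leq ni -ltnS ltn_ord.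
  by move=> [[i Ei]|En]; [exists (widen_ord (leqnSn n) i)|exists ord_max].
split; first exact: measurableU.
apply: (le_trans (measureU2 _ mU (mE n))).
by rewrite -natr1 mulrDl mul1r EFinD leeD//; exact: hE.
Qed.

Lemma measurable_section_prob d' (T' : measurableType d') (g : T' * T -> R) : measurable_fun setT g ->
  measurable_fun setT (fun w => P [set w' | g (w, w') <= 0]).
Proof.
move=> mg; have mA : measurable [set p | g p <= 0] by exact: measurable_le_set.
rewrite (_ : (fun w => _) = P \o xsection [set p | g p <= 0]); first exact: measurable_fun_xsection.
by apply/funext => w /=; congr (P _); apply/seteqP; split => w'; rewrite /xsection/= inE.
Qed.
End probability_bounds.

Section channel.
Context {d} {T : measurableType d} {R : realType}.
Local Notation mR := (measurableTypeR R).
Local Notation leb := (@lebesgue_measure R).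
Local Notation gam := (normal_prob 0 1 : probability mR R).
Variables (P : probability T R) (H Z : nat -> T -> R) (f : R -> R) (alpha c h0 : R).
Hypothesis mH : forall i, measurable_fun setT (H i).
Hypothesis mZ : forall i, measurable_fun setT (Z i).
Hypothesis iH : mutually_independent P H.
Hypotheses (mf : measurable_fun setT f) (f0 : forall h, 0 <= f h).
Hypothesis fneg : forall h, h < 0 -> f h = 0.
Hypothesis lH : forall i B, measurable B ->
  P (H i @^-1` B) = (\int[leb]_(x in B) (f x)%:E)%E.
Hypothesis H2 : (\int[P]_w ((H 0%N w) ^+ 2)%:E)%E = 1%E.
Hypotheses (alpha0 : 0 < alpha) (h00 : 0 < h0).
Hypothesis f_small : forall h, 0 < h < h0 -> f h = c * h `^ (alpha - 1).
Hypothesis iZ : mutually_independent P Z.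
Hypothesis lZ : forall i B, measurable B -> P (Z i @^-1` B) = normal_prob 0 1 B.

Let mH0 : measurable_fun setT (H 0%N : T -> mR) := mH 0%N.
Let eta : probability mR R := law P mH0.

Let etaE A : measurable A -> eta A = (\int[leb]_(x in A) (f x)%:E)%E.
Proof. by move=> mA; rewrite -(lH 0%N mA). Qed.

Let lHe i B : measurable B -> P (H i @^-1` B) = eta B.
Proof. by move=> mB; rewrite lH// -etaE. Qed.

Let eta2 : (\int[eta]_x (x ^+ 2)%:E)%E = 1%E.
Proof.
rewrite /eta /law ge0_integral_distribution//.
  by apply/measurable_EFinP; exact: measurable_funX.
by move=> x; rewrite lee_fin sqr_ge0.
Qed.

Let log3 := @integrable_log_cube R f alpha c h0 eta mf f0 fneg etaE eta2 alpha0 h00 f_small.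

Let eta_Rintegral (g : mR -> R) : eta.-integrable setT (EFin \o g) ->
  \int[eta]_x g x = \int[P]_w g (H 0%N w).
Proof.
move=> /integrableP[mg ig]; rewrite /Rintegral; congr fine.
rewrite /eta /law integral_distribution//; apply/integrableP; split.
  exact: (measurableT_comp mg mH0).
move: ig; rewrite /eta /law ge0_integral_distribution//; exact: measurableT_comp.
Qed.

Lemma ElnH2E : log_mean eta = ElnH2 P H.
Proof.
rewrite /log_mean eta_Rintegral//.
by have [] := integrable_cube (@measurable_log R) log3.
Qed.

Let m := ElnH2 P H.
Let A (x : mR) : R := ln (x ^+ 2) - m.
Let b (z : mR) : R := z ^+ 2 - 1.

Let mA : measurable_fun setT A.
Proof. by apply: measurable_funB => //; exact: measurable_log. Qed.
Let mb : measurable_fun setT b.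
Proof. by apply: measurable_funB => //; exact: measurable_funX. Qed.

Let A3 : eta.-integrable setT (EFin \o (fun x => `|A x| ^+ 3)).
Proof. exact: (integrable_cube_subc _ (@measurable_log R) log3). Qed.

Let A1 : \int[eta]_x A x = 0.
Proof.
have [_ h _] := @log_centered R f alpha c h0 eta mf f0 fneg etaE eta2 alpha0 h00 f_small.
by rewrite -h; apply: eq_Rintegral => x _; rewrite /A /m -ElnH2E.
Qed.

Let A2 : \int[eta]_x A x ^+ 2 = VarlnH2 P H.
Proof.
rewrite eta_Rintegral//; last by have [_] := integrable_cube mA A3.
Qed.

Lemma VarlnH2_ge0 : 0 <= VarlnH2 P H.
Proof. by rewrite -A2; apply: Rintegral_ge0 => x _; exact: sqr_ge0. Qed.

Let V := 2 + VarlnH2 P H.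

Lemma dispersion_gt0 : 0 < V.
Proof. by have := VarlnH2_ge0; rewrite /V; lra. Qed.

Let mX := measurable_pair_fun (VarlnH2 P H) 2 mA mb.

Definition info_cdf : nat -> R -> R := sum_cdf (pair_law eta gam mX).

Lemma info_cdf_berry_esseen : exists2 B : R, 0 <= B & forall (n : nat) z, (0 < n)%N ->
  `|info_cdf n z - normal_cdf n z| <= B / Num.sqrt n%:R.
Proof.
apply: berry_esseen.
exact: (standardized_pair mA mb A3 (@normal_square_cube R) A1 A2 (@normal_square_mean R)
  (@normal_square_variance R) dispersion_gt0).
Qed.

Definition radius2 n t w : R := n%:R + \sum_(i < n) (ln (H i w ^+ 2) - m) + Num.sqrt V * t.

Lemma radius2_prob n t :
  (\int[P]_w P [set w' | (\sum_(i < n) Z i w' ^+ 2 <= radius2 n t w)%R] = (info_cdf n t)%:E)%E.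
Proof.
have S0 : 0 < Num.sqrt V by rewrite sqrtr_gt0 dispersion_gt0.
rewrite /info_cdf -(@sum_prob_le _ _ _ P H Z eta gam mH mZ iH iZ lHe lZ _ mX n t).
apply: eq_integral => w _; congr (P _); apply/seteqP; split => w' /=;
  rewrite /pair_fun -mulr_suml ler_pdivrMr// sumrB /b sumrB /A big_const_ord iter_addr_0/radius2;
  lra.
Qed.

Lemma fading_gt0 n : (P [set w | exists i : 'I_n, (H i w <= 0)%R] = 0)%E /\
  measurable [set w | exists i : 'I_n, (H i w <= 0)%R].
Proof.
have mE i : measurable [set w | H i w <= 0] by exact: measurable_le_set.
have hE i : (P [set w | (H i w <= 0)%R] <= 0%:E)%E.
  rewrite (_ : [set w | _] = H i @^-1` `]-oo, 0]%classic); last first.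
    by apply/seteqP; split => w /=; rewrite in_itv.
  (* The density is known to vanish for negative arguments; the endpoint 0 is dropped as a null
     set. *)
  rewrite lH// -integral_itv_bndo_bndc; last exact/measurable_EFinP/measurable_funTS.
  by rewrite integral0_eq// => x /=; rewrite in_itv/= => x0; rewrite fneg.
have [mU hU] := union_bound n mE hE; split => //.
by apply/eqP; rewrite eq_le measure_ge0 andbT; rewrite mulr0 in hU.
Qed.

Lemma measurable_radius2 n t : measurable_fun setT (radius2 n t).
Proof.
apply: measurable_funD => //; apply: measurable_funD => //; apply: measurable_sum => i.
apply: measurable_funB => //; apply: (measurableT_comp (@measurable_ln R)).
exact: measurable_funX.
Qed.

Let p n t w := P [set w' | \sum_(i < n) Z i w' ^+ 2 <= radius2 n t w].

Lemma measurable_radius2_prob n t : measurable_fun setT (p n t).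
Proof.
pose g (x : T * T) := \sum_(i < n) Z i x.2 ^+ 2 - radius2 n t x.1.
have mg : measurable_fun setT g.
  apply: measurable_funB; last exact: (measurableT_comp (measurable_radius2 n t) measurable_fst).
  by apply: measurable_sum => i; apply: measurable_funX; exact: (measurableT_comp (mZ i) measurable_snd).
have := measurable_section_prob P mg; congr (measurable_fun _ _).
by apply/funext => w; congr (P _); apply/seteqP; split => w' /=; rewrite /g subr_le0.
Qed.

Lemma avg_err_ge0 n (s2 : R) (S : set 'rV[R]_n) (h : 'I_n -> R) a : (0 <= avg_err P Z s2 S h a)%E.
Proof.
rewrite /avg_err; case: (counting _) => // r; case: ifP => // r0.
by rewrite mule_ge0 ?lee_fin ?invr_ge0 ?(ltW r0)//; apply: esum_ge0.
Qed.

Lemma converse n (del s2 eps gam0 t : R) (S : set 'rV[R]_n) : (0 < n)%N -> 0 < del -> 0 < s2 ->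
  countable S -> IC_density S = gam0%:E -> 0 < gam0 -> (Pe P H Z s2 S <= eps%:E)%E ->
  2 * expR 2 * expR (- (n%:R - n%:R * m + Num.sqrt V * t) / 2) <=
    del * gam0 * (Num.sqrt (2 * pi) * Num.sqrt s2) ^+ n ->
  1 - 2 * del <= eps + info_cdf n t.
Proof.
move=> n0 del0 s20 cS hS g0 hPe hrho.
pose N := [set w | exists i : 'I_n, H i w <= 0]; have [PN mN] := fading_gt0 n; rewrite -/N in PN mN.
have mr w : measurable [set w' | \sum_(i < n) Z i w' ^+ 2 <= radius2 n t w].
  apply: measurable_le_set => //; apply: measurable_sum => i; exact: measurable_funX.
have pfin w : p n t w \is a fin_num by exact: (fin_num_measure P _ (mr w)).
(* A measurable minorant of the limiting conditional error, set to 0 where some gain is not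
   positive; comparison by [ge0_integral_mono] asks no measurability of the upper limit itself. *)
pose k w : R := \1_(~` N) w * Num.max 0 (1 - 2 * del - fine (p n t w)).
have mfp : measurable_fun setT (fun w => fine (p n t w)).
  by apply: measurableT_comp => //; exact: measurable_radius2_prob.
have k0 w : 0 <= k w by rewrite mulr_ge0// le_max lexx.
have mk : measurable_fun setT k.
  apply: measurable_funM; first by apply: measurable_indic; exact: measurableC.
  by apply: measurable_maxr => //; exact: measurable_funB.
have kle w : ((k w)%:E <= elimsup_pinfty (avg_err P Z s2 S (fun i : 'I_n => H i w)))%E.
  have e0 : (0 <= elimsup_pinfty (avg_err P Z s2 S (fun i : 'I_n => H i w)))%E.
    by apply: elimsup_ge => M; exists (M + 1); rewrite ?ltrDl//; exact: avg_err_ge0.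
  have [wN|wN] := pselect (N w); first by rewrite /k indicE memNset ?mul0r//; exact.
  rewrite /k indicE mem_set// mul1r; have [_|_] := leP 0 (1 - 2 * del - fine (p n t w)); last exact: e0.
  rewrite EFinB fineK// leeBlDr//.
  have hp (i : 'I_n) : 0 < H i w by rewrite ltNge; apply/negP => hi; apply: wN; exists i.
  apply: (avg_err_elimsup_lower mZ iZ lZ cS hp s20 n0 hS g0 del0).
  (* The product of the gains is the exponential of half the sum of ln H_i^2 contained in [radius2],
     and cancels against it. *)
  apply: le_trans hrho; rewrite -mulrA le_eqVlt; apply/orP; left; apply/eqP; congr (_ * _).
  have -> : \prod_(i < n) H i w = expR (\sum_(i < n) ln (H i w)).
    by rewrite expR_sum; apply: eq_bigr => i _; rewrite lnK// posrE hp.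
  rewrite -expRD; congr expR; rewrite /radius2 sumrB sumr_const card_ord.
  have -> : \sum_(i < n) ln (H i w ^+ 2) = 2 * \sum_(i < n) ln (H i w).
    by rewrite mulr_sumr; apply: eq_bigr => i _; rewrite lnXn// mulr_natl.
  by rewrite -[m *+ n]mulr_natl; lra.
have hk : (\int[P]_w (k w)%:E <= eps%:E)%E.
  by apply: le_trans hPe; apply: ge0_integral_mono => w; rewrite ?lee_fin.
have mN1 : measurable_fun setT (\1_N : T -> R) by exact: measurable_indic.
have : (\int[P]_w (1 - 2 * del)%:E <= \int[P]_w ((k w)%:E + (p n t w + (\1_N w)%:E)))%E.
  (* For 2 del > 1 the left-hand side is negative; otherwise the constant is nonnegative and the
     integrands compare pointwise. *)
  have [d1|d1] := leP (2 * del) 1; last first.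
    apply: (@le_trans _ _ 0%E); last first.
      by apply: integral_ge0 => w _; rewrite !adde_ge0 ?lee_fin ?measure_ge0.
    by rewrite integral_cst//= probability_setT mule1 lee_fin; lra.
  apply: ge0_integral_mono => w; first by rewrite lee_fin subr_ge0.
  rewrite -(fineK (pfin w)) -!EFinD lee_fin /k !indicE.
  have p0 : 0 <= fine (p n t w) by rewrite fine_ge0// measure_ge0.
  have [wN|wN] := pselect (N w).
    by rewrite (mem_set wN) memNset; [rewrite /= mul0r; lra|exact].
  rewrite mem_set// memNset//= mul1r.
  have : 1 - 2 * del - fine (p n t w) <= Num.max 0 (1 - 2 * del - fine (p n t w)) by rewrite le_max lexx orbT.
  lra.
rewrite integral_cst//= probability_setT mule1 ge0_integralD//; first last.
- apply: emeasurable_funD; last exact/measurable_EFinP.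
  exact: measurable_radius2_prob.
- by move=> w _; rewrite adde_ge0 ?lee_fin ?measure_ge0.
- exact/measurable_EFinP.
- by move=> w _; rewrite lee_fin.
rewrite ge0_integralD//; first last.
- exact/measurable_EFinP.
- exact: measurable_radius2_prob.
have -> : (\int[P]_w (\1_N w : R)%:E = 0)%E by rewrite integral_indic// setIT; exact: PN.
rewrite adde0 radius2_prob => hle.
by rewrite -lee_fin [leRHS]EFinD; apply: (le_trans hle); apply: leeD.
Qed.
End channel.

(** * Periodic constellations *)

Lemma ler_sum_subset (R : numDomainType) (U : eqType) (s1 s2 : seq U) (F : U -> R) : uniq s1 ->
  {subset s1 <= s2} -> (forall x, 0 <= F x) -> \sum_(x <- s1) F x <= \sum_(x <- s2) F x.
Proof.
move=> + + F0; elim: s1 s2 => [|x s1 IH] s2 /=; first by rewrite big_nil => _ _; exact: sumr_ge0.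
move=> /andP[xs1 us1] sub; have xs2 : x \in s2 by apply: sub; exact: mem_head.
rewrite big_cons (perm_big _ (perm_to_rem xs2)) big_cons lerD2l; apply: IH => // y ys1.
have yx : y != x by apply: contraNneq xs1 => <-.
have : y \in s2 by apply: sub; rewrite inE ys1 orbT.
by rewrite (perm_mem (perm_to_rem xs2)) inE (negbTE yx).
Qed.

(** Bernoulli's inequality in the form (1 + 1/m)^k (1 - k/m) <= 1, at k = n. It makes the numbers of
    points in consecutive grids comparable. *)
Lemma succ_exp_le (n m : nat) : (2 * n <= m)%N -> ((m + 1) ^ n <= 2 * m ^ n)%N.
Proof.
move=> nm; have [m0|m0] := posnP m; first by move: nm; rewrite m0; case: n.
have key k : (k <= m)%N -> ((m + 1) ^ k * (m - k) <= m ^ k.+1)%N.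
  elim: k => [|k IH] km; first by rewrite expn1 subn0 mul1n.
  rewrite expnSr -mulnA expnSr; apply: (@leq_trans ((m + 1) ^ k * (m - k) * m)); last first.
    by rewrite leq_mul2r IH ?orbT// ltnW.
  rewrite -mulnA leq_mul2l; apply/orP; right; nia.
have := key n; have -> : (n <= m)%N by lia.
move=> /(_ isT) h; rewrite -(leq_pmul2r m0).
apply: (@leq_trans (2 * ((m + 1) ^ n * (m - n)))); last by rewrite -mulnA leq_mul2l/= -expnSr.
rewrite mulnCA leq_mul2l; apply/orP; right; lia.
Qed.

Section tiling.
Context {R : realType}.
Local Notation mR := (measurableTypeR R).
Variables (n : nat) (l : seq (n.-tuple mR)) (L g : R).
Hypotheses (ul : uniq l) (L0 : 0 < L) (g0 : 0 <= g).
Hypothesis lL : forall p, p \in l -> forall j, 0 < tnth p j < L.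

Let b := L + g.
Let b0 : 0 < b. Proof. by rewrite ltr_pwDl. Qed.
Let Lb : L <= b. Proof. by rewrite lerDl. Qed.

Definition tile_pt (p : n.-tuple mR) (k : 'I_n -> int) : 'rV[R]_n :=
  \row_j (tnth p j + b * (k j)%:~R).

Definition tiled : set 'rV[R]_n :=
  [set x | exists2 p, p \in l & exists k : {ffun 'I_n -> int}, x = tile_pt p k].

Lemma countable_tiled : countable tiled.
Proof.
pose F (q : seq_sub l * {ffun 'I_n -> int}) := tile_pt (ssval q.1) q.2.
have sub : tiled `<=` F @` setT by move=> x [p pl [k ->]]; exists (SeqSub pl, k).
apply: (sub_countable (subset_card_le sub)); apply: (sub_countable (card_image_le _ _)).
exact: countableP.
Qed.

(** The indices below 2 m stand for the periods from - m to m - 1 in each coordinate. *)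
Definition grid_pt (m : nat) (q : n.-tuple mR * {ffun 'I_n -> 'I_(2 * m)}) : 'rV[R]_n :=
  tile_pt q.1 (fun j => (q.2 j : nat)%:Z - m%:Z).

Definition grid (m : nat) : seq 'rV[R]_n :=
  [seq grid_pt (p, u) | p <- l, u <- enum {ffun 'I_n -> 'I_(2 * m)}].

Lemma size_grid m : size (grid m) = (size l * (2 * m) ^ n)%N.
Proof. by rewrite size_allpairs -cardT card_ffun !card_ord. Qed.

(** Coordinates of points in different periods differ by more than the gap, because each period
    keeps its points strictly inside a box of side [L]. *)
Lemma tile_ptP p q j (k k' : int) : p \in l -> q \in l ->
  `|(tnth p j + b * k%:~R) - (tnth q j + b * k'%:~R)| <= g -> k = k'.
Proof.
move=> pl ql; have /andP[p0 pL] := lL pl j; have /andP[q0 qL] := lL ql j.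
rewrite ler_norml => /andP[h1 h2]; have bE : b = L + g by [].
have [kk|kk|//] := ltgtP k k'; exfalso.
  have : (k' - k)%:~R >= 1 :> R by rewrite ler1z -gtz0_ge1 subr_gt0.
  by rewrite intrB => hk; have := ler_wpM2l (ltW b0) hk; rewrite mulrBr mulr1; lra.
have : (k - k')%:~R >= 1 :> R by rewrite ler1z -gtz0_ge1 subr_gt0.
by rewrite intrB => hk; have := ler_wpM2l (ltW b0) hk; rewrite mulrBr mulr1; lra.
Qed.

Lemma tile_pt_inj p q (k k' : 'I_n -> int) : p \in l -> q \in l ->
  tile_pt p k = tile_pt q k' -> p = q /\ k =1 k'.
Proof.
move=> pl ql /rowP h.
have kk : k =1 k'.
  move=> j; apply: (tile_ptP (j := j) pl ql); have := h j; rewrite !mxE => ->.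
  by rewrite subrr normr0.
split=> //; apply: eq_from_tnth => j; have := h j; rewrite !mxE kk; exact: addIr.
Qed.

Lemma uniq_grid m : uniq (grid m).
Proof.
apply: allpairs_uniq => //; first exact: enum_uniq.
move=> [p u] [q v] /allpairsP[[p1 u1] /= [pl _ [-> ->]]] /allpairsP[[q1 v1] /= [ql _ [-> ->]]] /= h.
have [-> e] := tile_pt_inj pl ql h; congr pair; apply/ffunP => j; apply: val_inj => /=.
by have /(congr1 (fun z => z + m%:Z)) := e j; rewrite !subrK => -[].
Qed.

Lemma grid_cube m A x : m%:R * b <= A / 2 -> x \in grid m -> tiled x /\ cube A x.
Proof.
move=> mA /allpairsP[[p u] /= [pl _ ->]]; split.
  exists p => //; exists [ffun j => (u j : nat)%:Z - m%:Z].
  by apply/rowP => j; rewrite !mxE ffunE.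
move=> j; rewrite mxE; have /andP[p0 pL] := lL pl j.
have hu1 : (u j)%:R + 1 <= 2 * m%:R :> R by rewrite -natrM natr1 ler_nat; exact: ltn_ord.
have hu0 : 0 <= (u j)%:R :> R by [].
rewrite /= intrB -!pmulrn mulrBr ltr_norml.
have h1 := ler_wpM2l (ltW b0) hu1; have h2 := mulr_ge0 (ltW b0) hu0.
by move: h1 h2 mA Lb pL p0; rewrite mulrDr mulr1 [m%:R * b]mulrC mulrCA; lra.
Qed.

Lemma cube_grid m A x : A / 2 < m.+1%:R * b -> tiled x -> cube A x -> x \in grid m.+1.
Proof.
move=> Am [p pl [k ->]] hx.
have hk j : (0 <= k j + m.+1%:Z) && (k j < m.+1%:Z).
  have := hx j; rewrite mxE ltr_norml => /andP[h1 h2]; have /andP[p0 pL] := lL pl j.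
  have e1 : 0 < k j + m.+2%:Z.
    rewrite -(ltr0z R) -(pmulr_rgt0 _ b0) intrD -pmulrn -natr1 !mulrDr mulr1.
    by move: Am Lb h1 p0 pL; rewrite mulrC; lra.
  have e2 : k j < m.+1%:Z.
    rewrite -(ltr_int R) -(ltr_pM2l b0) -pmulrn.
    by move: Am h2 p0; rewrite mulrC; lra.
  by rewrite e2 andbT; move: e1; rewrite -[m.+2]addn1 PoszD addrA ltzD1.
have hu j : (absz (k j + m.+1%:Z)%R < 2 * m.+1)%N.
  have /andP[h1 h2] := hk j; rewrite -ltz_nat gez0_abs//.
  by rewrite mul2n -addnn PoszD ltrD2r.
pose u : {ffun 'I_n -> 'I_(2 * m.+1)} := [ffun j => Ordinal (hu j)].
apply/allpairsP; exists (p, u); split => //; first by rewrite mem_enum.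
apply/rowP => j; rewrite !mxE ffunE /=; congr (_ + _ * _%:~R).
by have /andP[h1 _] := hk j; rewrite gez0_abs// addrK.
Qed.

(** A cube is squeezed between two consecutive grids of whole periods. *)
Lemma tiled_cube A : 0 < A -> exists m, [/\ m%:R * b <= A / 2, A / 2 < m.+1%:R * b &
  finite_set (tiled `&` cube A) /\ let sq := finmap.enum_fset (fset_set (tiled `&` cube A)) in
  [/\ uniq sq, {subset grid m <= sq}, {subset sq <= grid m.+1} &
      forall x, x \in sq -> tiled x /\ cube A x]].
Proof.
move=> A0; have Ab : 0 <= A / 2 / b by rewrite !divr_ge0// ltW.
exists (Num.truncn (A / 2 / b)); set m := Num.truncn _.
have m1 : m%:R * b <= A / 2 by rewrite -ler_pdivlMr// truncn_le.
have m2 : A / 2 < m.+1%:R * b by rewrite -ltr_pdivrMr// truncnS_gt.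
have fS : finite_set (tiled `&` cube A).
  apply: (@sub_finite_set _ _ [set` grid m.+1]); last exact: finite_seq.
  by move=> x [tx cx]; exact: (cube_grid m2 tx cx).
have sqE x : (x \in finmap.enum_fset (fset_set (tiled `&` cube A))) = (x \in tiled `&` cube A) := in_fset_set fS x.
split => //; split => //=; split.
- exact: finmap.fset_uniq.
- move=> x /(grid_cube m1) hx.
  by rewrite sqE inE.
- move=> x; rewrite sqE inE => -[tx cx].
  exact: (cube_grid m2 tx cx).
- by move=> x; rewrite sqE inE.
Qed.

Let K : R := (size l)%:R.

(** The lower bound on [A] gives 2 n <= m, so that by [succ_exp_le] the two enclosing grids agree in
    size up to a factor 2. *)
Lemma tiled_cube_large A : 2 * b * (2 * n + 1)%:R < A -> exists m,
  finite_set (tiled `&` cube A) /\ let sq := finmap.enum_fset (fset_set (tiled `&` cube A)) in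
  [/\ uniq sq, {subset sq <= grid m.+1}, forall x, x \in sq -> tiled x /\ cube A x &
   [/\ K * (2 * m.+1)%:R ^+ n <= 2 * (size sq)%:R, K / (2 * b ^+ n) <= (size sq)%:R * (A ^+ n)^-1 &
    (size sq)%:R * (A ^+ n)^-1 <= 2 * K / b ^+ n]].
Proof.
have bn0 : 0 < b ^+ n by rewrite exprn_gt0.
move=> hA; have A0 : 0 < A by apply: le_lt_trans hA; rewrite !mulr_ge0// ltW.
have [m [m1 m2 [fS /= [us gs sg hs]]]] := tiled_cube A0.
set sq := finmap.enum_fset _ in us gs sg hs.
have nm : (2 * n <= m)%N.
  rewrite -ltnS -(ltr_nat R) -(ltr_pM2r b0); apply: le_lt_trans m2.
  by move: hA; rewrite [(2 * n + 1)%:R]natrD ![(2 * n)%:R]natrM; have := b0; lra.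
have hm := succ_exp_le nm; rewrite addn1 in hm.
have s1 : (size l * (2 * m) ^ n <= size sq)%N.
  by rewrite -size_grid uniq_leq_size// uniq_grid.
have s2 : (size sq <= size l * (2 * m.+1) ^ n)%N.
  by rewrite -size_grid uniq_leq_size.
have An0 : 0 < A ^+ n by rewrite exprn_gt0.
have hm2 : (2 * m.+1)%:R ^+ n <= 2 * (2 * m)%:R ^+ n :> R.
  by rewrite -!natrX -natrM ler_nat !expnMn mulnCA leq_mul2l hm orbT.
have k0 : 0 <= K by [].
have s1R : K * (2 * m)%:R ^+ n <= (size sq)%:R by rewrite -natrX -natrM ler_nat.
exists m; split => //=; split => //; split.
- by apply: le_trans (ler_wpM2l k0 hm2) _; rewrite mulrCA ler_wpM2l.
- rewrite ler_pdivrMr ?mulr_gt0// mulrAC ler_pdivlMr//.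
  apply: (@le_trans _ _ (K * (2 * (2 * m)%:R ^+ n * b ^+ n))).
    rewrite ler_wpM2l//; apply: (@le_trans _ _ ((2 * m.+1)%:R ^+ n * b ^+ n)).
      rewrite -exprMn lerXn2r ?nnegrE ?mulr_ge0 ?(ltW A0) ?(ltW b0)//.
      by rewrite natrM; lra.
    by rewrite ler_wpM2r// ltW.
  have -> : K * (2 * (2 * m)%:R ^+ n * b ^+ n) = (K * (2 * m)%:R ^+ n) * (2 * b ^+ n) by ring.
  by rewrite ler_wpM2r ?mulr_ge0 ?(ltW bn0).
- rewrite ler_pdivrMr// mulrAC ler_pdivlMr//.
  apply: (@le_trans _ _ (K * (2 * m.+1)%:R ^+ n * b ^+ n)).
    by rewrite ler_wpM2r ?(ltW bn0)// -natrX -natrM ler_nat.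
  rewrite -!mulrA mulrCA ler_wpM2l//.
  apply: (@le_trans _ _ (2 * (2 * m)%:R ^+ n * b ^+ n)); first by rewrite ler_wpM2r// ltW.
  rewrite -mulrA ler_wpM2l// -exprMn lerXn2r ?nnegrE ?mulr_ge0 ?(ltW A0) ?(ltW b0)//.
  by rewrite natrM; lra.
Qed.

(** Knowing the density up to a factor 4 is enough: a constant factor changes the logarithm of the
    volume-to-noise ratio by O(1 / n). *)
Lemma tiled_density : ((K / (2 * b ^+ n))%:E <= IC_density tiled)%E /\
  (IC_density tiled <= (2 * K / b ^+ n)%:E)%E.
Proof.
split.
  apply: elimsup_ge => M; pose A := Num.max M (2 * b * (2 * n + 1)%:R) + 1.
  have hA : 2 * b * (2 * n + 1)%:R < A by rewrite ltr_pwDr// le_max lexx orbT.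
  have [m [fS [_ _ _ [_ c1 _]]]] := tiled_cube_large hA; exists A; first by rewrite ltr_pwDr// le_max lexx.
  by rewrite /= /counting asboolT// -EFinM lee_fin.
apply: (@elimsup_le _ _ _ (2 * b * (2 * n + 1)%:R)) => A hA.
have [m [fS [_ _ _ [_ _ c2]]]] := tiled_cube_large hA.
by rewrite /= /counting asboolT// -EFinM lee_fin.
Qed.
End tiling.

(** * Union bound over one period *)

Section union_bound_error.
Context {d} {T : measurableType d} {R : realType}.
Local Notation mR := (measurableTypeR R).
Variables (P : probability T R) (Z : nat -> T -> R).
Hypothesis mZ : forall i, measurable_fun setT (Z i).
Variables (n : nat) (l : seq (n.-tuple mR)) (L r eta : R) (h : 'I_n -> R).
Hypotheses (n0 : (0 < n)%N) (ul : uniq l) (l0 : (0 < size l)%N) (L0 : 0 < L) (r0 : 0 < r).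
Hypotheses (eta0 : 0 < eta) (h_eta : forall i, eta <= h i).
Hypothesis lL : forall p, p \in l -> forall j, 0 < tnth p j < L.
Variable rho2 : R.

Let g := 2 * r / eta.
Let g0 : 0 <= g. Proof. by rewrite divr_ge0 ?mulr_ge0// ltW. Qed.
Let S := tiled l L g.
Let energy w := \sum_(i < n) Z i w ^+ 2.

Let menergy : measurable_fun setT energy.
Proof. by apply: measurable_sum => i; exact: measurable_funX. Qed.

Definition confusion (p q : n.-tuple mR) : set T :=
  [set w | \sum_(i < n) (Z i w + h i * (tnth p i - tnth q i)) ^+ 2 < \sum_(i < n) Z i w ^+ 2 /\
           \sum_(i < n) Z i w ^+ 2 <= rho2].

Lemma measurable_lt_set (f f' : T -> R) : measurable_fun setT f -> measurable_fun setT f' ->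
  measurable [set t | f t < f' t].
Proof.
move=> mf mf'; rewrite (_ : [set t | _] = ~` [set t | f' t <= f t]).
  by apply: measurableC; exact: measurable_le_set.
by apply/seteqP; split => t /=; [move=> h'; apply/negP; rewrite -ltNge|move/negP; rewrite -ltNge].
Qed.

Lemma measurable_confusion p q : measurable (confusion p q).
Proof.
apply: measurableI; last exact: measurable_le_set.
apply: measurable_lt_set => //; apply: measurable_sum => i; apply: measurable_funX.
exact: measurable_funD.
Qed.

Let err (x : 'rV[R]_n) : set T :=
  [set w | ~ voronoi (fade h @` S) (fade h x) (fade h x + noise_vec n Z 1 w)].

Let merr x : measurable (err x).
Proof. by apply: measurable_error_set => //; exact: countable_tiled. Qed.

Let F x : set T := err x `&` ([set w | energy w <= r ^+ 2] `&` [set w | energy w <= rho2]).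

Let mF x : measurable (F x).
Proof. by apply: measurableI => //; apply: measurableI; exact: measurable_le_set. Qed.

(** If the noise is at most [r] and the gains are at least [eta], a strictly closer rival differs
    from the transmitted point by at most 2 r / eta = g in each coordinate. It therefore lies in the
    same period, and the period index drops out. *)
Lemma error_confusion p (k : 'I_n -> int) : p \in l ->
  F (tile_pt L g p k) `<=` [set w | exists2 q, q \in rem p l & confusion p q w].
Proof.
move=> pl w [ew [wr wrho]].
have [x' [Sx' hx']] : exists x', S x' /\ \sum_(i < n) (Z i w + h i * ((tile_pt L g p k) ord0 i - x' ord0 i)) ^+ 2 < energy w.
  apply: contrapT => no; apply: ew => _ [x' Sx' <-]; rewrite leNgt; apply/negP => hlt; apply: no.
  exists x'; split => //; move: hlt; rewrite /sqnorm.
  rewrite (eq_bigr (fun i : 'I_n => (Z i w + h i * ((tile_pt L g p k) ord0 i - x' ord0 i)) ^+ 2)); last first.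
    by move=> i _; rewrite !mxE sqrtr1; congr (_ ^+ 2); ring.
  by rewrite [X in _ < X](eq_bigr (fun i : 'I_n => Z i w ^+ 2))// => i _; rewrite !mxE sqrtr1; congr (_ ^+ 2); ring.
have [q ql [k' x'E]] := Sx'.
have kk : k =1 k'.
  move=> j; apply: (@tile_ptP R n l L g L0 g0 lL p q j) => //.
  have sum_ge (a : 'I_n -> R) : a j ^+ 2 <= \sum_i a i ^+ 2.
    by rewrite (bigD1 j)//= lerDl sumr_ge0// => i _; exact: sqr_ge0.
  have le_r (a : R) : a ^+ 2 <= r ^+ 2 -> `|a| <= r.
    by move=> ha; rewrite -(@ler_pXn2r _ 2)// ?nnegrE ?normr_ge0 ?(ltW r0)// real_normK ?num_real.
  have z1 : `|Z j w| <= r by apply: le_r; apply: le_trans wr; exact: (sum_ge (fun i => Z i w)).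
  pose D := tile_pt L g p k ord0 j - x' ord0 j.
  have z2 : `|Z j w + h j * D| <= r.
    apply: le_r; apply: le_trans wr; apply: le_trans (ltW hx').
    exact: (sum_ge (fun i => Z i w + h i * ((tile_pt L g p k) ord0 i - x' ord0 i))).
  have hD : h j * `|D| <= 2 * r.
    have hj0 : 0 <= h j by apply: le_trans (h_eta j); exact: ltW.
    rewrite -[h j](ger0_norm hj0) -normrM (_ : h j * D = (Z j w + h j * D) - Z j w); last by ring.
    by apply: (le_trans (ler_normB _ _)); lra.
  have : `|D| <= g.
    rewrite /g ler_pdivlMr// mulrC; apply: le_trans hD.
    by rewrite ler_wpM2r.
  by rewrite /D x'E !mxE.
have E i : (tile_pt L g p k) ord0 i - x' ord0 i = tnth p i - tnth q i.
  by rewrite x'E !mxE kk; ring.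
exists q; last first.
  split=> //; move: hx'; congr (_ < _); apply: eq_bigr => i _; by rewrite E.
rewrite mem_rem_uniq// !inE ql andbT; apply/eqP => qp.
move: hx'; rewrite (eq_bigr (fun i : 'I_n => Z i w ^+ 2)) ?ltxx// => i _.
by rewrite E qp subrr mulr0 addr0.
Qed.

Lemma exists_seq_bound (U : eqType) (s : seq U) (E : U -> set T) : (forall q, measurable (E q)) ->
  measurable [set w | exists2 q, q \in s & E q w] /\
  (P [set w | exists2 q, q \in s & E q w] <= \sum_(q <- s) P (E q))%E.
Proof.
move=> mE; elim: s => [|a s [mU hU]].
  rewrite (_ : [set w | _] = set0) ?measure0 ?big_nil//.
  by apply/seteqP; split => // w [].
rewrite (_ : [set w | _] = E a `|` [set w | exists2 q, q \in s & E q w]); last first.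
  apply/seteqP; split => w /=.
    by move=> [q]; rewrite inE => /predU1P[->|qs] Eq; [left|right; exists q].
  by move=> [Ea|[q qs Eq]]; [exists a; rewrite ?mem_head|exists q; rewrite ?inE ?qs ?orbT].
split; first exact: measurableU.
by rewrite big_cons; apply: (le_trans (measureU2 _ (mE a) mU)); rewrite leeD.
Qed.

Let pr (E : set T) : R := fine (P E).
Let prE E : measurable E -> P E = (pr E)%:E.
Proof. by move=> mE; rewrite fineK// fin_num_measure. Qed.
Let pr0 E : 0 <= pr E. Proof. by rewrite fine_ge0. Qed.

Definition confusion_sum := \sum_(p <- l) \sum_(q <- rem p l) fine (P (confusion p q)).

(** The points of a cube are among those of a grid of whole periods, in which each point of [l]
    occurs equally often; this grid has at most twice as many points as the cube, hence the factor
    2. *)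
Lemma tiled_error_upper :
  (elimsup_pinfty (avg_err P Z 1 S h) <=
   P [set w | (rho2 < energy w)%R] + P [set w | (r ^+ 2 < energy w)%R] +
   (2 / (size l)%:R * confusion_sum)%:E)%E.
Proof.
have m1 := measurable_lt_set (measurable_cst rho2) menergy.
have m2 := measurable_lt_set (measurable_cst (r ^+ 2)) menergy.
rewrite (prE m1) (prE m2).
set q1 := pr _; set q2 := pr _.
have K0 : 0 < (size l)%:R :> R by rewrite ltr0n.
apply: (@elimsup_le _ _ _ (2 * (L + g) * (2 * n + 1)%:R)) => A hA.
have [m [fS /= [us gs hs [hK _ _]]]] := tiled_cube_large ul L0 g0 lL hA.
set sq := finmap.enum_fset _ in us gs hs hK.
have N0 : 0 < (size sq)%:R :> R.
  have : 0 < (size l)%:R * (2 * m.+1)%:R ^+ n :> R by rewrite mulr_gt0// exprn_gt0// ltr0n.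
  by move=> h1; have := lt_le_trans h1 hK; rewrite pmulr_rgt0.
have -> : avg_err P Z 1 S h A = ((\sum_(x <- sq) P (err x)) * ((size sq)%:R^-1)%:E)%E.
  rewrite /avg_err /counting asboolT// -[X in 0 < X]/((size sq)%:R) N0; congr (_ * _)%E.
  by rewrite esum_fset// fsbig_finite.
under eq_bigr do rewrite prE//.
rewrite sumEFin -EFinM -!EFinD lee_fin ler_pdivrMr//.
have errF x : pr (err x) <= q1 + q2 + pr (F x).
  rewrite -lee_fin !EFinD -!prE//.
  apply: (@le_trans _ _ (P (([set w | rho2 < energy w] `|` [set w | r ^+ 2 < energy w]) `|` F x))).
    apply: le_measure; rewrite ?inE//.
      by apply: measurableU => //; exact: measurableU.
    move=> w ew; have [h1|h1] := leP (energy w) rho2; last by left; left.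
    by have [h2|h2] := leP (energy w) (r ^+ 2); [right|left; right].
  apply: (le_trans (measureU2 _ _ _)) => //; first exact: measurableU.
  by rewrite leeD// measureU2.
have Fp p (k : 'I_n -> int) : p \in l -> pr (F (tile_pt L g p k)) <= \sum_(q <- rem p l) pr (confusion p q).
  move=> pl; have [mU hU] := exists_seq_bound (rem p l) (measurable_confusion p).
  rewrite -lee_fin -prE// -sumEFin (eq_bigr (fun q => P (confusion p q))); last first.
    by move=> q _; rewrite prE//; exact: measurable_confusion.
  apply: le_trans hU; apply: le_measure; rewrite ?inE//.
  exact: error_confusion.
have sumF : \sum_(x <- sq) pr (F x) <= (2 * m.+1)%:R ^+ n * confusion_sum.
  apply: le_trans (ler_sum_subset us gs (fun x => pr0 (F x))) _.
  rewrite /grid big_allpairs_dep /confusion_sum mulr_sumr big_seq [leRHS]big_seq.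
  apply: ler_sum => p pl.
  apply: (@le_trans _ _ (\sum_(u <- enum {ffun 'I_n -> 'I_(2 * m.+1)}) \sum_(q <- rem p l) pr (confusion p q))).
    by apply: ler_sum => u _; exact: Fp.
  rewrite big_const_seq count_predT iter_addr_0 -cardT card_ffun !card_ord.
  by rewrite -[leLHS]mulr_natl natrX.
apply: (@le_trans _ _ (\sum_(x <- sq) (q1 + q2 + pr (F x)))); first exact: ler_sum.
have -> : \sum_(x <- sq) (q1 + q2 + pr (F x)) = (q1 + q2) * (size sq)%:R + \sum_(x <- sq) pr (F x).
  by rewrite big_split/= big_const_seq count_predT iter_addr_0 mulr_natr.
rewrite [leRHS]mulrDl lerD2l.
apply: (le_trans sumF); have C0 : 0 <= confusion_sum.
  by apply: sumr_ge0 => p _; apply: sumr_ge0 => q _; exact: pr0.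
have -> : 2 / (size l)%:R * confusion_sum * (size sq)%:R = (2 * (size sq)%:R / (size l)%:R) * confusion_sum by ring.
by rewrite ler_wpM2r// ler_pdivlMr// mulrC.
Qed.
End union_bound_error.

(** * Greedy choice of the points of a period *)

Section greedy.
Context {R : realType}.
Local Notation mR := (measurableTypeR R).
Local Notation leb := (@lebesgue_measure R).

Lemma gauss_integral_affine (a c q : R) : 0 < c ->
  (\int[leb]_x (expR (- 2^-1 * (a + c * (x - q)) ^+ 2))%:E = (Num.sqrt (2 * pi) / c)%:E)%E.
Proof.
move=> c0; have sp0 : 0 < Num.sqrt (2 * pi) :> R by rewrite sqrtr_gt0 mulr_gt0// pi_gt0.
have mg : measurable_fun setT (fun x : mR => (gauss 1 x : R)%:E).
  by apply/measurable_EFinP; exact: measurable_gauss.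
have g0 x : (0 <= (gauss 1 x : R)%:E)%E by rewrite lee_fin gauss_ge0.
have := ge0_integral_affine (a - c * q) c0 mg g0; rewrite integral_gauss//.
set J := (\int[leb]_x (gauss 1 (c * x + (a - c * q)))%:E)%E => hJ.
transitivity ((Num.sqrt (2 * pi))%:E * J)%E.
  rewrite /J -ge0_integralZl//.
  - apply: eq_integral => x _; rewrite -EFinM; congr EFin.
    have -> : c * x + (a - c * q) = a + c * (x - q) by ring.
    rewrite gaussE !mulr1 [RHS]mulVKf; last by rewrite gt_eqF.
    by congr expR; rewrite mulNr [RHS]mulNr mulrC.
  - exact: (measurableT_comp mg (measurable_affine c (a - c * q))).
have -> : J = (c^-1)%:E.
  by rewrite -[LHS]mul1e -(mulVf (lt0r_neq0 c0)) EFinM -muleA -hJ mule1.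
by rewrite EFinM.
Qed.

(** The indicator of the ellipsoid is at most exp ((rho2 - |a + h (x - q)|^2) / 2), whose integral
    factorizes. At rho2 = n the bound exceeds the volume by a factor of order sqrt n only, a
    logarithmic loss in the exponent. *)
Lemma ellipsoid_volume n (a h : 'I_n -> R) (q : n.-tuple mR) (rho2 : R) : (forall i, 0 < h i) ->
  (\int[tprod leb n]_x (\1_[set x : n.-tuple mR | (\sum_i (a i + h i * (tnth x i - tnth q i)) ^+ 2 <= rho2)%R] x)%:E <=
   (Num.sqrt (2 * pi) ^+ n * (expR (rho2 / 2) * \prod_i (h i)^-1))%:E)%E.
Proof.
move=> h0; pose e i (x : R) := expR (- 2^-1 * (a i + h i * (x - tnth q i)) ^+ 2).
have me i : measurable_fun setT (e i).
  apply: measurableT_comp => //; apply: measurable_funM => //; apply: measurable_funX => //.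
  by apply: measurable_funD => //; apply: measurable_funM => //; apply: measurable_funB.
have e0 i x : 0 <= e i x by exact: expR_ge0.
have mpe : measurable_fun setT (fun x : n.-tuple mR => (\prod_i e i (tnth x i))%:E).
  by apply/measurable_EFinP; exact: measurable_prod_tnth.
apply: (@le_trans _ _ (\int[tprod leb n]_x ((expR (rho2 / 2))%:E * (\prod_i e i (tnth x i))%:E))%E).
  apply: ge0_integral_mono => x; first by rewrite lee_fin.
  rewrite -EFinM lee_fin indicE.
  case: (boolP (x \in _)) => [|_]; last by rewrite mulr_ge0 ?expR_ge0// prodr_ge0.
  rewrite inE /= => hx; rewrite /e -expR_sum -expRD -[leLHS]expR0 ler_expR.
  by rewrite -mulr_sumr; move: hx; lra.
rewrite (ge0_integralZl (tprod leb n) measurableT mpe); first last.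
- by rewrite lee_fin expR_ge0.
- by move=> x _; rewrite lee_fin prodr_ge0.
rewrite ge0_integral_tprod_prod//.
rewrite (eq_bigr (fun i => (Num.sqrt (2 * pi) / h i)%:E)); last by move=> i _; exact: gauss_integral_affine.
rewrite prodEFin -EFinM lee_fin big_split/= prodr_const card_ord.
by rewrite le_eqVlt; apply/orP; left; apply/eqP; ring.
Qed.

Lemma open_box_volume n (L : R) : 0 < L ->
  (\int[tprod leb n]_x (\prod_(i < n) \1_(`]0%R, L[%classic : set R) (tnth x i))%:E = (L ^+ n)%:E)%E.
Proof.
move=> L0; rewrite (@ge0_integral_tprod_prod R n (fun=> \1_(`]0%R, L[%classic : set R)))//.
  rewrite (eq_bigr (fun=> L%:E)) => [|i _]; first by rewrite prodEFin prodr_const card_ord.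
  transitivity (lebesgue_measure (`]0%R, L[%classic : set R)); first by rewrite integral_indic// setIT.
  by rewrite lebesgue_measure_itv/= lte_fin L0 sube0.
Qed.

Lemma point_null n (y : n.-tuple mR) : (0 < n)%N ->
  (\int[tprod leb n]_x (\prod_(i < n) \1_([set tnth y i : R]) (tnth x i : R))%:E = 0 :> \bar R)%E.
Proof.
move=> n0; rewrite (@ge0_integral_tprod_prod R n (fun i => \1_([set tnth y i : R])))//.
case: n n0 y => // n _ y; rewrite big_ord_recl integral_indic// setIT.
rewrite [X in (X * _)%E](_ : _ = 0%E) ?mul0e//; exact: lebesgue_measure_set1.
Qed.

(** Every unordered pair is counted once, with the later choice first, as the greedy construction
    adds points at the head. *)
Fixpoint pairs_sum (U : Type) (Psi : U -> U -> \bar R) (l : seq U) : \bar R :=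
  if l is x :: l' then (\sum_(y <- l') Psi x y + pairs_sum Psi l')%E else 0%E.

Lemma pairs_sumE (U : eqType) (phi : U -> U -> \bar R) (l : seq U) : uniq l ->
  (\sum_(p <- l) \sum_(q <- rem p l) phi p q = pairs_sum (fun x y => phi x y + phi y x) l)%E.
Proof.
elim: l => [|x l IH] /=; first by rewrite big_nil.
move=> /andP[xl ul]; rewrite big_cons eqxx -IH// big_split/= -addeA; congr (_ + _)%E.
rewrite -big_split/= big_seq [RHS]big_seq; apply: eq_bigr => p pl.
by rewrite ifN ?big_cons//; apply: contraNneq xl => ->.
Qed.

(* Each new point is taken where the accumulated potential of the previous ones is below twice its
   average over the box. *)
Lemma greedy n (Psi : n.-tuple mR -> n.-tuple mR -> \bar R) (I0 L : R) : (0 < n)%N -> 0 < L -> 0 < I0 ->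
  (forall y, measurable_fun setT (Psi^~ y)) -> (forall x y, (0 <= Psi x y)%E) ->
  (forall y, (\int[tprod leb n]_x Psi x y <= I0%:E)%E) ->
  forall k, exists l : seq (n.-tuple mR), [/\ size l = k, uniq l,
    forall p, p \in l -> forall j, 0 < tnth p j < L &
    (pairs_sum Psi l <= (2 * k%:R ^+ 2 * I0 / L ^+ n)%:E)%E].
Proof.
move=> n0 L0 I00 mPsi Psi0 hI; elim=> [|k [l [sl ul lL hl]]].
  by exists [::]; split => //=; rewrite expr0n/= mulr0 !mul0r.
have Ln0 : 0 < L ^+ n by rewrite exprn_gt0.
(* Twice a bound on the average potential over the box; [k.+1] in place of [k] keeps the threshold
   positive when no point has been chosen yet. *)
pose bet : R := 2 * k.+1%:R * I0 / L ^+ n.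
have bet0 : 0 < bet by rewrite divr_gt0// !mulr_gt0.
pose Phi x := (\sum_(y <- l) Psi x y)%E.
have [x [xL [xl hx]]] : exists x : n.-tuple mR, (forall j, 0 < tnth x j < L) /\ x \notin l /\ (Phi x <= bet%:E)%E.
  apply: contrapT => no.
  have mPhi : measurable_fun setT Phi by apply: emeasurable_sum => y; exact: mPsi.
  have Phi0 x : (0 <= Phi x)%E by apply: sume_ge0 => y _; exact: Psi0.
  pose B (x : n.-tuple mR) : R := \prod_(i < n) \1_(`]0%R, L[%classic : set R) (tnth x i).
  (* The indicator of the point [y]: such terms have integral 0 and exclude the points already
     chosen. *)
  pose D (y x : n.-tuple mR) : R := \prod_(i < n) \1_([set tnth y i : R]) (tnth x i : R).
  have mB : measurable_fun setT (fun x => (B x)%:E).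
    apply/measurable_EFinP; apply: (@measurable_prod_tnth R n (fun=> \1_(`]0%R, L[%classic : set R))) => i.
    exact: measurable_indic.
  have mD y : measurable_fun setT (fun x => (D y x)%:E).
    apply/measurable_EFinP; apply: (@measurable_prod_tnth R n (fun i => \1_([set tnth y i : R]))) => i.
    exact: measurable_indic.
  have B0 x : (0 <= (B x)%:E)%E by rewrite lee_fin prodr_ge0.
  have D0 y x : (0 <= (D y x)%:E)%E by rewrite lee_fin prodr_ge0.
  have hpt x : (bet%:E * (B x)%:E <= Phi x + \sum_(y <- l) bet%:E * (D y x)%:E)%E.
    have s0 : (0 <= \sum_(y <- l) bet%:E * (D y x)%:E)%E.
      by apply: sume_ge0 => y _; rewrite mule_ge0// lee_fin ltW.
    have [xL|xL] := pselect (forall j, 0 < tnth x j < L); last first.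
      rewrite (_ : B x = 0) ?mule0 ?adde_ge0//.
      have [j hj] : exists j, ~ 0 < tnth x j < L by apply: contrapT => h; apply: xL => j; apply: contrapT => hj; apply: h; exists j.
      by rewrite /B (bigD1 j)//= indicE memNset ?mul0r//= in_itv/=.
    have B1 : B x = 1.
      by rewrite /B big1// => i _; rewrite indicE mem_set//= in_itv/= xL.
    rewrite B1 mule1; have [xl|xl] := boolP (x \in l); last first.
      have : (bet%:E < Phi x)%E.
        by rewrite ltNge; apply/negP => h; apply: no; exists x.
      by move=> /ltW h; apply: (le_trans h); rewrite leeDl.
    apply: (@le_trans _ _ (bet%:E * (D x x)%:E)%E).
      by rewrite (_ : D x x = 1) ?mule1// /D big1// => i _; rewrite indicE mem_set.
    rewrite (perm_big _ (perm_to_rem xl))/= big_cons addeCA leeDl// adde_ge0//.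
    by apply: sume_ge0 => y _; rewrite mule_ge0// lee_fin ltW.
  have : (\int[tprod leb n]_x (bet%:E * (B x)%:E) <= \int[tprod leb n]_x (Phi x + \sum_(y <- l) bet%:E * (D y x)%:E))%E.
    by apply: ge0_integral_mono => // x; rewrite mule_ge0// lee_fin ltW.
  have b0e : (0 <= bet%:E)%E by rewrite lee_fin ltW.
  have mbD y : measurable_fun setT (fun x => bet%:E * (D y x)%:E)%E by exact: measurable_funeM.
  have bD0 y x : setT x -> (0 <= bet%:E * (D y x)%:E)%E by move=> _; exact: mule_ge0.
  rewrite (ge0_integralZl (tprod leb n) measurableT mB)// open_box_volume//.
  rewrite ge0_integralD//; last 2 first.
  - by move=> x _; apply: sume_ge0 => y _; exact: bD0.
  - by apply: emeasurable_sum => y; exact: mbD.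
  rewrite (ge0_integral_sum (tprod leb n) measurableT (f := fun y x => Psi x y))//.
  rewrite (ge0_integral_sum (tprod leb n) measurableT mbD bD0).
  rewrite [X in (_ <= _ + X)%E -> _]big1 ?adde0; last first.
    move=> y _; rewrite (ge0_integralZl (tprod leb n) measurableT (mD y))//.
    by rewrite /D point_null// mule0.
  move=> h1; have : (bet%:E * (L ^+ n)%:E <= (k%:R * I0)%:E)%E.
    apply: (le_trans h1); apply: (@le_trans _ _ (\sum_(y <- l) I0%:E)%E); first by apply: lee_sum => y _; exact: hI.
    by rewrite sumEFin lee_fin big_const_seq count_predT iter_addr_0 sl mulr_natl.
  rewrite -EFinM lee_fin /bet divfK ?gt_eqF// -natr1; apply/negP; rewrite -ltNge.
  by have : 0 <= k%:R :> R by []; move: I00; nra.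
exists (x :: l); split => /=; [by rewrite sl|by rewrite xl|by move=> p; rewrite inE => /predU1P[->|/lL]|].
(* The induction closes by 2 (k + 1) + 2 k^2 <= 2 (k + 1)^2. *)
apply: (le_trans (leeD hx hl)); rewrite -EFinD lee_fin /bet -mulrDl ler_pM2r ?invr_gt0//.
by rewrite -mulrDl ler_pM2r// -natr1; have : 0 <= k%:R :> R by []; nra.
Qed.
End greedy.

(** * The achievability bound *)

Section random_coding.
Context {d} {T : measurableType d} {R : realType}.
Local Notation mR := (measurableTypeR R).
Local Notation leb := (@lebesgue_measure R).
Variables (P : probability T R) (H Z : nat -> T -> R).
Hypothesis mH : forall i, measurable_fun setT (H i).
Hypothesis mZ : forall i, measurable_fun setT (Z i).
Variables (n : nat) (rad : T -> R) (I1 : R).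
Hypotheses (n0 : (0 < n)%N) (mrad : measurable_fun setT rad) (I10 : 0 < I1).
Hypothesis radE : forall w, (forall i : 'I_n, 0 < H i w) ->
  expR (rad w / 2) * \prod_(i < n) (H i w)^-1 = I1.

Let I0 := Num.sqrt (2 * pi) ^+ n * I1.
Let I00 : 0 < I0.
Proof. by rewrite mulr_gt0// exprn_gt0// sqrtr_gt0 mulr_gt0// pi_gt0. Qed.

Let PP : probability (T * T)%type R := (P \x P)%E.

Section confusion_measure.
Variable eta : R.
Hypothesis eta0 : 0 < eta.

(** A single set in points, fading and noise, so that Tonelli's theorem can integrate over a point
    before averaging over the channel. The threshold keeps the gains positive, as [radE]
    requires. *)
Definition joint_confusion : set ((n.-tuple mR * n.-tuple mR) * (T * T)) :=
  [set x | (forall i : 'I_n, eta <= H i x.2.1) /\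
    (\sum_(i < n) (Z i x.2.2 + H i x.2.1 * (tnth x.1.1 i - tnth x.1.2 i)) ^+ 2 <
       \sum_(i < n) Z i x.2.2 ^+ 2 /\ \sum_(i < n) Z i x.2.2 ^+ 2 <= rad x.2.1)].

Lemma measurable_joint_confusion : measurable joint_confusion.
Proof.
have mf1 := (@measurable_fst _ _ (n.-tuple mR * n.-tuple mR)%type (T * T)%type).
have mf2 := (@measurable_snd _ _ (n.-tuple mR * n.-tuple mR)%type (T * T)%type).
have mw : measurable_fun setT (fun x : (n.-tuple mR * n.-tuple mR) * (T * T) => x.2.1).
  exact: (measurableT_comp measurable_fst mf2).
have mw' : measurable_fun setT (fun x : (n.-tuple mR * n.-tuple mR) * (T * T) => x.2.2).
  exact: (measurableT_comp measurable_snd mf2).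
have mp i : measurable_fun setT (fun x : (n.-tuple mR * n.-tuple mR) * (T * T) => tnth x.1.1 i : R).
  exact: (measurableT_comp (measurable_tnth i) (measurableT_comp measurable_fst mf1)).
have mq i : measurable_fun setT (fun x : (n.-tuple mR * n.-tuple mR) * (T * T) => tnth x.1.2 i : R).
  exact: (measurableT_comp (measurable_tnth i) (measurableT_comp measurable_snd mf1)).
have mHw i := measurableT_comp (mH i) mw; have mZw i := measurableT_comp (mZ i) mw'.
have me : measurable_fun setT (fun x : (n.-tuple mR * n.-tuple mR) * (T * T) => \sum_(i < n) Z i x.2.2 ^+ 2).
  by apply: measurable_sum => i; apply: measurable_funX; exact: mZw.
apply: measurableI.
  rewrite (_ : (fun _ => _) = \bigcap_(i in [set: 'I_n]) [set x : (n.-tuple mR * n.-tuple mR) * (T * T) | eta <= H i x.2.1]).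
    by apply: fin_bigcap_measurable => // i _; apply: measurable_le_set => //; exact: mHw.
  by apply/seteqP; split => t /= ht i; [move=> _|]; exact: ht.
apply: measurableI; last by apply: measurable_le_set => //; exact: (measurableT_comp mrad mw).
apply: measurable_lt_set => //; apply: measurable_sum => i; apply: measurable_funX.
apply: measurable_funD; first exact: mZw.
by apply: measurable_funM; [exact: mHw|exact: measurable_funB].
Qed.

Definition phi (p q : n.-tuple mR) : \bar R :=
  (\int[PP]_x (\1_joint_confusion ((p, q), x))%:E)%E.

Lemma phi_ge0 p q : (0 <= phi p q)%E.
Proof. by apply: integral_ge0 => x _; rewrite lee_fin. Qed.

Lemma phiE p q : phi p q = (\int[P]_w P [set w' | joint_confusion ((p, q), (w, w'))])%E.
Proof.
have mJ : measurable_fun setT (fun x : T * T => (\1_joint_confusion ((p, q), x) : R)%:E).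
  apply/measurable_EFinP; apply: measurableT_comp (pair1_measurable (p, q)).
  by apply: measurable_indic; exact: measurable_joint_confusion.
rewrite /phi /PP fubini_tonelli1//.
apply: eq_integral => w _; rewrite /fubini_F.
rewrite (eq_integral (fun w' => (\1_[set w' | joint_confusion ((p, q), (w, w'))] w' : R)%:E)).
  rewrite integral_indic// ?setIT//.
  have -> : [set w' | joint_confusion ((p, q), (w, w'))] = (fun w' => ((p, q), (w, w'))) @^-1` joint_confusion by [].
  rewrite -[X in measurable X]setTI.
  apply: (measurableT_comp (pair1_measurable (p, q)) (pair1_measurable w)) => //.
  exact: measurable_joint_confusion.
move=> w' _; congr EFin; rewrite !indicE; congr (_%:R).
Qed.


Let mu (u : n.-tuple mR -> n.-tuple mR * n.-tuple mR) : measurable_fun setT u ->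
  measurable_fun setT (fun x : n.-tuple mR * (T * T) => (\1_joint_confusion (u x.1, x.2) : R)%:E).
Proof.
move=> mu; apply/measurable_EFinP.
have mi : measurable_fun setT (\1_joint_confusion : (n.-tuple mR * n.-tuple mR) * (T * T) -> R).
  by apply: measurable_indic; exact: measurable_joint_confusion.
apply: (measurableT_comp mi).
apply: measurable_fun_pair; last exact: measurable_snd.
exact: (measurableT_comp mu measurable_fst).
Qed.

(** The map [u] puts the integrated point into either role, transmitted or rival, and the sign [s]
    adjusts the centre. For each channel state the confusion set lies in an ellipsoid whose volume
    bound [I0] is the same for all states by [radE]. *)
Lemma phi_integral (u : n.-tuple mR -> n.-tuple mR * n.-tuple mR) (q : n.-tuple mR) (s : R) :
  measurable_fun setT u ->
  (forall x w, joint_confusion (u x, w) ->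
     \sum_(i < n) (s * Z i w.2 + H i w.1 * (tnth x i - tnth q i)) ^+ 2 <= rad w.1) ->
  (\int[tprod leb n]_x phi (u x).1 (u x).2 <= I0%:E)%E.
Proof.
move=> mu_ hu; have mf := mu mu_.
rewrite [leLHS](_ : _ = \int[tprod leb n]_x \int[PP]_w (\1_joint_confusion (u x, w) : R)%:E)%E; last first.
  by apply: eq_integral => x _; rewrite /phi; case: (u x).
rewrite (@fubini_tonelli _ _ _ _ _ (tprod leb n) PP
  (fun x => (\1_joint_confusion (u x.1, x.2) : R)%:E))//.
apply: (@le_trans _ _ (\int[PP]_w (cst I0%:E w))%E); last first.
  by rewrite integral_cst//= probability_setT mule1.
apply: ge0_integral_mono => w; first by apply: integral_ge0 => x _; rewrite lee_fin.
have [hw|hw] := pselect (forall i : 'I_n, eta <= H i w.1); last first.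
  rewrite integral0_eq ?lee_fin ?(ltW I00)// => x _; rewrite indicE memNset// => -[hw' _].
  exact: hw hw'.
have hw0 (i : 'I_n) : 0 < H i w.1 by exact: lt_le_trans (hw i).
rewrite /cst /I0 -(radE hw0).
apply: le_trans (ellipsoid_volume (fun i : 'I_n => s * Z i w.2) q (rad w.1) hw0).
apply: ge0_integral_mono => x; first by rewrite lee_fin.
rewrite lee_fin !indicE.
case: (boolP ((u x, w) \in _)) => [|_]; last by rewrite ler0n.
by rewrite inE => /hu h; rewrite mem_set.
Qed.

Lemma phi_integral1 q : (\int[tprod leb n]_x phi x q <= I0%:E)%E.
Proof.
apply: (@phi_integral (fun x => (x, q)) q 1); first exact: pair2_measurable.
move=> x w [_ [h1 h2]]; apply: le_trans h2; apply: le_trans (ltW h1).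
by rewrite le_eqVlt; apply/orP; left; apply/eqP; apply: eq_bigr => i _; rewrite mul1r.
Qed.

Lemma phi_integral2 q : (\int[tprod leb n]_x phi q x <= I0%:E)%E.
Proof.
apply: (@phi_integral (fun x => (q, x)) q (-1)); first exact: pair1_measurable.
move=> x w [_ [h1 h2]]; apply: le_trans h2; apply: le_trans (ltW h1).
rewrite le_eqVlt; apply/orP; left; apply/eqP; apply: eq_bigr => i _.
by rewrite -[RHS]sqrrN; congr (_ ^+ 2); ring.
Qed.

Lemma measurable_phi1 q : measurable_fun setT (phi^~ q).
Proof.
apply: (@measurable_fun_fubini_tonelli_F _ _ _ _ _ PP
  (fun x => (\1_joint_confusion ((x.1, q), x.2) : R)%:E)).
  exact: (mu (pair2_measurable q)).
by move=> x; rewrite lee_fin.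
Qed.

Lemma measurable_phi2 q : measurable_fun setT (phi q).
Proof.
apply: (@measurable_fun_fubini_tonelli_F _ _ _ _ _ PP
  (fun x => (\1_joint_confusion ((q, x.1), x.2) : R)%:E)).
  exact: (mu (pair1_measurable q)).
by move=> x; rewrite lee_fin.
Qed.

(** Both orders of a pair enter the potential [Psi], since either point may be the transmitted
    one. *)
Lemma good_points (L : R) K : 0 < L -> exists l : seq (n.-tuple mR), [/\ size l = K, uniq l,
  forall p, p \in l -> forall j, 0 < tnth p j < L &
  (\sum_(p <- l) \sum_(q <- rem p l) phi p q <= (4 * K%:R ^+ 2 * I0 / L ^+ n)%:E)%E].
Proof.
move=> L0; pose Psi x y := (phi x y + phi y x)%E.
have I20 : 0 < 2 * I0 by rewrite mulr_gt0.
have mPsi y : measurable_fun setT (Psi^~ y).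
  by apply: emeasurable_funD; [exact: measurable_phi1|exact: measurable_phi2].
have Psi0 x y : (0 <= Psi x y)%E by rewrite adde_ge0// phi_ge0.
have hI y : (\int[tprod leb n]_x Psi x y <= (2 * I0)%:E)%E.
  rewrite ge0_integralD//; first last.
  - exact: measurable_phi2.
  - by move=> x _; exact: phi_ge0.
  - exact: measurable_phi1.
  - by move=> x _; exact: phi_ge0.
  rewrite (_ : 2 * I0 = I0 + I0); last by ring.
  by rewrite EFinD; apply: leeD; [exact: phi_integral1|exact: phi_integral2].
have [l [sl ul lL hl]] := greedy n0 L0 I20 mPsi Psi0 hI K.
exists l; split => //; rewrite pairs_sumE//; apply: le_trans hl _.
by rewrite lee_fin le_eqVlt; apply/orP; left; apply/eqP; ring.
Qed.

Let energy w := \sum_(i < n) Z i w ^+ 2.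
Let menergy : measurable_fun setT energy.
Proof. by apply: measurable_sum => i; exact: measurable_funX. Qed.

Lemma measurable_energy_gt : measurable_fun setT (fun w => P [set w' | rad w < energy w']).
Proof.
have mA : measurable [set x : T * T | rad x.1 < energy x.2].
  by apply: measurable_lt_set; [exact: (measurableT_comp mrad measurable_fst)|exact: (measurableT_comp menergy measurable_snd)].
rewrite (_ : (fun w => _) = P \o xsection [set x : T * T | rad x.1 < energy x.2]).
  exact: measurable_fun_xsection.
by apply/funext => w /=; congr (P _); apply/seteqP; split => w'; rewrite /xsection/= inE.
Qed.

Lemma avg_err_le1 (S : set 'rV[R]_n) (h : 'I_n -> R) a : countable S ->
  (avg_err P Z 1 S h a <= 1)%E.
Proof.
move=> cS; rewrite /avg_err /counting; case: asboolP => // fS.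
case: ifP => // c0; rewrite esum_fset// fsbig_finite//=.
rewrite lee_pdivrMr// mul1e.
apply: (@le_trans _ _ (\sum_(x <- finmap.enum_fset (fset_set (S `&` cube a))) 1%E)%E).
  by apply: lee_sum => x _; apply: probability_le1; exact: measurable_error_set.
by rewrite (eq_bigr (fun=> 1%R%:E)) ?sumEFin ?big_const_seq ?count_predT ?iter_addr_0.
Qed.

Lemma Pe_tiled_upper (l : seq (n.-tuple mR)) (L r : R) : uniq l -> (0 < size l)%N -> 0 < L -> 0 < r ->
  (forall p, p \in l -> forall j, 0 < tnth p j < L) ->
  (Pe P H Z 1 (tiled l L (2 * r / eta)) <= \int[P]_w P [set w' | (rad w < energy w')%R] +
    P [set w' | (r ^+ 2 < energy w')%R] + P [set w | exists i : 'I_n, (H i w < eta)%R] +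
    (2 / (size l)%:R)%:E * \sum_(p <- l) \sum_(q <- rem p l) phi p q)%E.
Proof.
move=> ul l0 L0 r0 lL; set S := tiled _ _ _.
have cS : countable S by exact: countable_tiled.
pose bad := [set w | exists i : 'I_n, (H i w < eta)%R].
have mbad : measurable bad.
  rewrite (_ : bad = ~` \bigcap_(i in [set: 'I_n]) [set w | eta <= H i w]).
    by apply: measurableC; apply: fin_bigcap_measurable => // i _; exact: measurable_le_set.
  apply/seteqP; split => w /=.
    by move=> [i hi] /(_ i I) /=; rewrite leNgt hi.
  move=> h; apply: contrapT => hb; apply: h => i _ /=; rewrite leNgt; apply/negP => hi.
  by apply: hb; exists i.
pose cc p q w := P [set w' | joint_confusion ((p, q), (w, w'))].
have cc0 p q w : (0 <= cc p q w)%E by exact: measure_ge0.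
have mcc p q : measurable_fun setT (cc p q).
  rewrite (_ : cc p q = P \o xsection [set x : T * T | joint_confusion ((p, q), x)]).
    apply: measurable_fun_xsection.
    have -> : [set x : T * T | joint_confusion ((p, q), x)] = (fun x => ((p, q), x)) @^-1` joint_confusion by [].
    rewrite -[X in measurable X]setTI; apply: (pair1_measurable (p, q)) => //.
    exact: measurable_joint_confusion.
  by apply/funext => w /=; congr (P _); apply/seteqP; split => w'; rewrite /xsection/= inE.
have K0 : 0 < (size l)%:R :> R by rewrite ltr0n.
pose q2 := P [set w' | (r ^+ 2 < energy w')%R].
have q20 : (0 <= q2)%E by exact: measure_ge0.
pose CC w := ((2 / (size l)%:R)%:E * \sum_(p <- l) \sum_(q <- rem p l) cc p q w)%E.
have CC0 w : (0 <= CC w)%E.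
  by rewrite mule_ge0// ?lee_fin ?divr_ge0// sume_ge0// => p _; exact: sume_ge0.
pose U w := (P [set w' | (rad w < energy w')%R] + q2 + (\1_bad w)%:E + CC w)%E.
have mP1 := measurable_energy_gt.
have m1b : measurable_fun setT (fun w => (\1_bad w : R)%:E).
  by apply/measurable_EFinP; exact: measurable_indic.
have msum : measurable_fun setT (fun w => \sum_(p <- l) \sum_(q <- rem p l) cc p q w)%E.
  by apply: emeasurable_sum => p; apply: emeasurable_sum.
have mCC : measurable_fun setT CC by exact: measurable_funeM.
apply: (@le_trans _ _ (\int[P]_w U w)%E).
  apply: ge0_integral_mono => w.
    by apply: elimsup_ge => M; exists (M + 1); rewrite ?ltrDl//; exact: avg_err_ge0.
  (* In a state with a small gain the error is bounded by 1, which the indicator of [bad] covers. *)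
  have [wb|wb] := pselect (bad w).
    apply: (@le_trans _ _ 1%E).
      by apply: (@elimsup_le _ _ _ 0) => a _; exact: avg_err_le1.
    rewrite /U indicE mem_set//= -[leLHS]adde0; apply: leeD => //.
    by rewrite -[leLHS]add0e leeD// adde_ge0.
  have wh (i : 'I_n) : eta <= H i w.
    by rewrite leNgt; apply/negP => hi; apply: wb; exists i.
  apply: (le_trans (tiled_error_upper P mZ ul l0 L0 r0 eta0 wh lL (rad w))).
  rewrite /U indicE memNset//= adde0; apply: leeD => //.
  rewrite /CC EFinM /confusion_sum; apply: lee_wpmul2l; first by rewrite lee_fin divr_ge0.
  rewrite -sumEFin; apply: lee_sum => p _; rewrite -sumEFin; apply: lee_sum => q _.
  rewrite fineK; last by apply: fin_num_measure; exact: measurable_confusion.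
  rewrite /cc le_eqVlt; apply/orP; left; apply/eqP; congr (P _).
  by apply/seteqP; split => w' /=; [move=> [h1 h2]; split|move=> [_]].
rewrite /U ge0_integralD//; last 2 first.
- by move=> w _; rewrite !adde_ge0// lee_fin.
- by apply: emeasurable_funD => //; apply: emeasurable_funD.
rewrite ge0_integralD//; last 2 first.
- by move=> w _; rewrite adde_ge0.
- by apply: emeasurable_funD.
rewrite ge0_integralD//.
rewrite integral_cst//= probability_setT mule1 integral_indic// setIT.
apply: leeD => //; rewrite /CC (ge0_integralZl P measurableT msum); first last.
- by rewrite lee_fin divr_ge0.
- by move=> w _; apply: sume_ge0 => p _; exact: sume_ge0.
apply: lee_wpmul2l; first by rewrite lee_fin divr_ge0.
rewrite ge0_integral_sum//; last 2 first.
- by move=> p; apply: emeasurable_sum.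
- by move=> p w _; apply: sume_ge0.
apply: lee_sum => p _; rewrite ge0_integral_sum//.
by apply: lee_sum => q _; rewrite phiE.
Qed.
End confusion_measure.

Lemma energy_tail (del : R) : 0 < del ->
  exists2 r, 0 < r & (P [set w | (r ^+ 2 < \sum_(i < n) Z i w ^+ 2)%R] <= del%:E)%E.
Proof.
move=> del0; pose F (k : nat) : set T := [set w | k.+1%:R ^+ 2 < \sum_(i < n) Z i w ^+ 2].
have mF k : measurable (F k).
  by apply: measurable_lt_set => //; apply: measurable_sum => i; exact: measurable_funX.
have [||k Pk] := @vanishing_tail R _ _ P F del mF _ _ del0; last by exists k.+1%:R.
- move=> k l kl w; apply: le_lt_trans.
  by rewrite lerXn2r ?nnegrE// ler_nat.
- apply/seteqP; split => // w /(_ (Num.truncn (\sum_(i < n) Z i w ^+ 2)) I); rewrite /F /=.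
  set e := \sum_(i < n) _ => h; have := truncnS_gt e; set t := (_.+1)%:R in h * => h1.
  have t1 : 1 <= t by rewrite ler1n.
  by have := lt_trans h h1; rewrite expr2; apply/negP; rewrite -leNgt ler_peMr// (le_trans ler01).
Qed.

Lemma fading_tail (del : R) : 0 < del -> (P [set w | exists i : 'I_n, (H i w <= 0)%R] = 0)%E ->
  exists2 eta, 0 < eta & (P [set w | exists i : 'I_n, (H i w < eta)%R] <= del%:E)%E.
Proof.
move=> del0 PN; have mex (D : nat -> set T) : (forall i, measurable (D i)) -> measurable [set w | exists i : 'I_n, D i w].
  move=> mD; rewrite (_ : [set w | _] = \bigcup_(i in [set: 'I_n]) D i); first exact: fin_bigcup_measurable.
  by apply/seteqP; split => w [i]; [exists i|move=> _; exists i].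
pose N := [set w | exists i : 'I_n, H i w <= 0].
pose G (k : nat) := [set w | exists i : 'I_n, H i w < k.+1%:R^-1].
have mN : measurable N by apply: (mex (fun i => [set w | H i w <= 0])) => i; exact: measurable_le_set.
have mG k : measurable (G k).
  by apply: (mex (fun i => [set w | H i w < k.+1%:R^-1])) => i; exact: measurable_lt_set.
have mF k : measurable (G k `\` N) by exact: measurableD.
have [||k Pk] := @vanishing_tail R _ _ P (fun k => G k `\` N) del mF _ _ del0.
- move=> k l kl w [[i hi] nN]; split => //; exists i; apply: (lt_le_trans hi).
  by rewrite lef_pV2 ?posrE// ler_nat.
- apply/seteqP; split => // w hw.
  have Hp (i : 'I_n) : 0 < H i w.
    by rewrite ltNge; apply/negP => hi; have [_] := hw 0%N I; apply; exists i.
  have [[i hi] _] := hw (\max_(i < n) Num.truncn (H i w)^-1)%N I.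
  move: hi; apply/negP; rewrite -leNgt -[leRHS]invrK lef_pV2 ?posrE ?invr_gt0//.
  apply: le_trans (ltW (truncnS_gt _)) _; rewrite ler_nat ltnS.
  exact: (leq_bigmax i).
- exists k.+1%:R^-1; first by rewrite invr_gt0.
  apply: (@le_trans _ _ (P ((G k `\` N) `|` N))); last first.
    apply: (le_trans (measureU2 _ (mF k) mN)); rewrite -[leRHS]adde0; apply: leeD => //.
    by rewrite le_eqVlt; apply/orP; left; apply/eqP; exact: PN.
  apply: le_measure; rewrite ?inE//; first exact: mG.
    exact: measurableU.
  by move=> w Gw; have [Nw|Nw] := pselect (N w); [right|left].
Qed.

(** The cut-offs [r] and [eta] come first and fix the gap; only then is [L] taken so large that the
    gap at most doubles the volume of a period. The three [del] pay for large noise, small gains and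
    confusion. *)
Lemma achievability (g0 del : R) : 0 < g0 -> 0 < del -> 32 * g0 * I0 <= del ->
  (P [set w | exists i : 'I_n, (H i w <= 0)%R] = 0)%E ->
  exists (S : set 'rV[R]_n) (g1 : R), [/\ countable S, IC_density S = g1%:E, g0 / 2 <= g1 &
    (Pe P H Z 1 S <= \int[P]_w P [set w' | (rad w < \sum_(i < n) Z i w' ^+ 2)%R] + (3 * del)%:E)%E].
Proof.
move=> g00 del0 hdel PN.
have [r r0 hr] := energy_tail del0; have [eta eta0 heta] := fading_tail del0 PN.
pose g := 2 * r / eta; have g_ge0 : 0 <= g by rewrite divr_ge0 ?mulr_ge0// ltW.
have ln20 : 0 < ln 2 :> R by rewrite ln_gt0// ltr1n.
(* The terms 1 and g0^-1 ensure g0 b^n >= 1, so that rounding up at most doubles [K]; the last one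
   gives (1 + g / L)^n <= exp (n g / L) <= 2. *)
pose L := Num.max (Num.max 1 g0^-1) (n%:R * g / ln 2).
have L1 : 1 <= L by rewrite /L !le_max lexx.
have Lg0 : g0^-1 <= L by rewrite /L !le_max lexx orbT.
have Lg : n%:R * g / ln 2 <= L by rewrite /L le_max lexx orbT.
have L0 : 0 < L by rewrite (lt_le_trans ltr01).
have Ln0 : 0 < L ^+ n by rewrite exprn_gt0.
have LnL : L <= L ^+ n by rewrite -[leLHS]expr1 ler_weXn2l.
pose b := L + g; have b0 : 0 < b by rewrite ltr_pwDl.
have bn0 : 0 < b ^+ n by rewrite exprn_gt0.
have bL : b ^+ n <= 2 * L ^+ n.
  rewrite -ler_pdivrMr// -expr_div_n.
  apply: (@le_trans _ _ (expR (g / L) ^+ n)).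
    rewrite lerXn2r ?nnegrE ?expR_ge0 ?divr_ge0 ?(ltW b0) ?(ltW L0)//.
    by rewrite /b mulrDl divff ?gt_eqF// expR_ge1Dx.
  rewrite -expRM_natr -[leRHS](@lnK R) ?posrE// ler_expR.
  rewrite mulrC mulrA ler_pdivrMr//; move: Lg; rewrite ler_pdivrMr//.
  by rewrite mulrC [L * _]mulrC.
pose K := (Num.truncn (g0 * b ^+ n)).+1.
have gb1 : 1 <= g0 * b ^+ n.
  rewrite -ler_pdivrMl// mulr1; apply: (le_trans Lg0); apply: (le_trans LnL).
  by rewrite lerXn2r ?nnegrE ?(ltW b0) ?(ltW L0)// lerDl.
have K1 : g0 * b ^+ n <= K%:R by rewrite ltW// truncnS_gt.
have K2 : K%:R <= 2 * (g0 * b ^+ n).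
  rewrite /K -natr1 mulr2n mulrDl mul1r lerD//.
  by rewrite truncn_le// (le_trans ler01).
have [l [sl ul lL hl]] := good_points eta0 K L0.
have l0 : (0 < size l)%N by rewrite sl.
have [d1 d2] := tiled_density ul L0 g_ge0 lL.
exists (tiled l L g).
have dfin : IC_density (tiled l L g) \is a fin_num.
  rewrite fin_numE; apply/andP; split; apply/eqP => h.
    by move: d1; rewrite h leeNy_eq.
  by move: d2; rewrite h leye_eq.
exists (fine (IC_density (tiled l L g))); split.
- exact: countable_tiled.
- by rewrite fineK.
- rewrite -lee_fin fineK//; apply: le_trans d1; rewrite lee_fin sl -/b.
  rewrite invfM mulrA ler_pdivlMr// mulrAC ler_wpM2r ?invr_ge0//.
- apply: (le_trans (Pe_tiled_upper eta0 ul l0 L0 r0 lL)).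
  set J := integral _ _ _; move: J => J.
  rewrite -!addeA; apply: leeD; first exact: lexx.
  rewrite (_ : 3 * del = del + (del + del)); last by ring.
  rewrite !EFinD; apply: leeD; first exact: hr.
  apply: leeD; first exact: heta.
  rewrite sl; apply: (@le_trans _ _ ((2 / K%:R)%:E * (4 * K%:R ^+ 2 * I0 / L ^+ n)%:E)%E).
    by apply: lee_wpmul2l => //; rewrite lee_fin divr_ge0.
  rewrite -EFinM lee_fin; apply: le_trans hdel.
  have Kn0 : K%:R != 0 :> R by rewrite pnatr_eq0.
  (* The 32 of the hypothesis is this 8, times 2 from K <= 2 g0 b^n, times 2 from b^n <= 2 L^n. *)
  have -> : 2 / K%:R * (4 * K%:R ^+ 2 * I0 / L ^+ n) = 8 * I0 * K%:R / L ^+ n.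
    by field; rewrite Kn0 gt_eqF.
  rewrite ler_pdivrMr//.
  apply: (@le_trans _ _ (8 * I0 * (2 * (g0 * (2 * L ^+ n))))).
    apply: ler_wpM2l; first exact: (mulr_ge0 (ler0n R 8) (ltW I00)).
    by apply: (le_trans K2); rewrite ler_wpM2l// ler_wpM2l// ltW.
  by rewrite le_eqVlt; apply/orP; left; apply/eqP; ring.
Qed.
End random_coding.

(** * The normal distribution function *)

Section normal_quantile.
Context {R : realType}.
Local Notation mR := (measurableTypeR R).
Local Notation leb := (@lebesgue_measure R).

Lemma normal_cdfE (k : nat) (z : R) : (0 < k)%N ->
  (normal_cdf k z)%:E = (\int[leb]_u (step (z - u) * gauss k%:R u)%:E)%E.
Proof.
case: k => // k _; have k0 : 0 < k.+1%:R :> R by rewrite ltr0n.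
by rewrite /normal_cdf smoothE//; [exact: (cdflike_bounded (@cdflike_step R))|exact: step_ge0].
Qed.

Lemma normal_cdf_itv (z : R) :
  (normal_cdf 1 z)%:E = (\int[leb]_(u in `]-oo, z]) (gauss 1 u)%:E)%E.
Proof.
rewrite normal_cdfE// [RHS]integral_mkcond; apply: eq_integral => u _.
rewrite patchE /step subr_ge0; case: ifPn => h.
  by rewrite mul1r mem_set//= in_itv.
by rewrite mul0r memNset//= in_itv/=; exact/negP.
Qed.

Lemma normal_cdf_scale (n : nat) (z : R) : (0 < n)%N -> normal_cdf n z = normal_cdf 1 (z / Num.sqrt n%:R).
Proof.
move=> n0; have n0' : 0 < n%:R :> R by rewrite ltr0n.
have s0 : 0 < Num.sqrt n%:R :> R by rewrite sqrtr_gt0.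
apply: EFin_inj; rewrite !normal_cdfE//.
have mF : measurable_fun setT (fun u : mR => (step (z - u) * gauss n%:R u)%:E).
  apply/measurable_EFinP; apply: measurable_funM; last exact: measurable_gauss.
  by apply: (measurableT_comp (@measurable_step R)); exact: measurable_funB.
have F0 u : (0 <= (step (z - u) * gauss n%:R u : R)%:E)%E.
  by rewrite lee_fin mulr_ge0 ?step_ge0 ?gauss_ge0.
rewrite (ge0_integral_affine 0 s0 mF F0).
have maff := measurableT_comp mF (measurable_affine (Num.sqrt n%:R) 0).
rewrite -(ge0_integralZl leb measurableT maff)//; last by move=> x _; exact: F0.
apply: eq_integral => u _; rewrite /= -EFinM; congr EFin.
have stepE : step (z - Num.sqrt n%:R * u) = step (z / Num.sqrt n%:R - u) :> R.
  rewrite /step (_ : z - Num.sqrt n%:R * u = Num.sqrt n%:R * (z / Num.sqrt n%:R - u)) ?pmulr_rge0//.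
  by field; rewrite gt_eqF.
rewrite addr0 stepE gauss_scale// (_ : Num.sqrt n%:R * u / Num.sqrt n%:R = u); last first.
  by field; rewrite gt_eqF.
by field; rewrite gt_eqF.
Qed.

Lemma Qfun_normal_cdf (q : R) : Qfun q = 1 - normal_cdf 1 q.
Proof.
have mI : measurable (`]-oo, q[%classic : set mR) by exact: measurable_itv.
rewrite /Qfun (_ : `[q, +oo[%classic = ~` `]-oo, q[%classic :> set mR); last first.
  by apply/seteqP; split => x /=; rewrite !in_itv/= andbT leNgt => /negP.
have -> : normal_prob 0 1 (~` `]-oo, q[%classic) = (1 - (normal_cdf 1 q)%:E)%E.
  rewrite probability_setC// normal_cdf_itv; congr (_ - _)%E.
  rewrite (@normal_prob_density R)// integral_itv_bndo_bndc//.
  by apply/measurable_EFinP/measurable_funTS; exact: measurable_gauss.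
by rewrite -EFinB.
Qed.

(** On [q - 1, q + 1] the Gaussian density is at least its value at |q| + 1. *)
Lemma normal_cdf_increment (q x y : R) : q - 1 <= x -> x <= y -> y <= q + 1 ->
  gauss 1 (`|q| + 1) * (y - x) <= normal_cdf 1 y - normal_cdf 1 x.
Proof.
move=> qx xy yq; set kap := gauss 1 _.
have sub : ((normal_cdf 1 x)%:E + (kap * (y - x))%:E <= (normal_cdf 1 y)%:E)%E.
  rewrite !normal_cdf_itv.
  have mg : measurable_fun setT (fun u : mR => (gauss 1 u : R)%:E).
    by apply/measurable_EFinP; exact: measurable_gauss.
  have -> : `]-oo, y]%classic = `]-oo, x]%classic `|` `]x, y]%classic :> set mR.
    apply/seteqP; split => u /=; rewrite !in_itv/=.
      by have [ux|ux] := leP u x; [left|right].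
    by case=> [ux|/andP[]//]; exact: le_trans xy.
  rewrite ge0_integral_setU//=; last 3 first.
  - exact: measurable_funTS.
  - by move=> u _; rewrite lee_fin gauss_ge0.
  - rewrite disj_set2E; apply/eqP; rewrite -subset0 => u /=; rewrite !in_itv/= => -[h1 /andP[h2 _]].
    by have := le_lt_trans h1 h2; rewrite ltxx.
  apply: leeD => //.
  apply: (@le_trans _ _ (\int[leb]_(u in `]x, y]) (cst kap%:E u))%E).
    rewrite integral_cst//= lebesgue_measure_itv/= lte_fin.
    by case: ltP xy => [_ _|yx xy]; [|rewrite mule0 (_ : y - x = 0) ?mulr0//; apply/eqP; rewrite subr_eq0 eq_le xy yx].
  apply: ge0_le_integral => //.
  - by move=> u _; rewrite lee_fin gauss_ge0.
  - exact: measurable_funTS.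
  move=> u; rewrite /= in_itv/= => /andP[xu uy]; rewrite lee_fin /kap !gaussE.
  rewrite ler_wpM2l ?invr_ge0 ?sqrtr_ge0// ler_expR ler_pM2r ?invr_gt0// lerN2.
  rewrite -[u ^+ 2]real_normK ?num_real// lerXn2r ?nnegrE ?addr_ge0//.
  have := ler_norm q; have := ler_norm (- q); rewrite normrN => h1 h2.
  by rewrite ler_norml; apply/andP; split; lra.
move: sub; rewrite -EFinD lee_fin; lra.
Qed.

Lemma normal_cdf_nd : {homo @normal_cdf R 1 : x y / x <= y}.
Proof. exact: (@cdflike_normal R 1).1. Qed.

(** Quantitative strict monotonicity at [q], which turns estimates on values of the distribution
    function into estimates on its arguments. The slope is controlled only within distance 1, hence
    the minimum. *)
Lemma normal_cdf_gap (q : R) : exists2 kap : R, 0 < kap & forall x y, x <= y -> x = q \/ y = q ->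
  kap * Num.min 1 (y - x) <= normal_cdf 1 y - normal_cdf 1 x.
Proof.
exists (gauss 1 (`|q| + 1)).
  by rewrite gaussE mulr_gt0 ?expR_gt0// invr_gt0 sqrtr_gt0 !mulr_gt0// pi_gt0.
move=> x y xy xyq.
have m0 : 0 <= Num.min 1 (y - x) by rewrite le_min ler01 subr_ge0.
have m1 : Num.min 1 (y - x) <= 1 by rewrite ge_min lexx.
have m2 : Num.min 1 (y - x) <= y - x by rewrite ge_min lexx orbT.
move: (Num.min 1 (y - x)) m0 m1 m2 => m m0 m1 m2.
case: xyq => [xq|yq].
  have xm : x + m <= y by rewrite -lerBrDl.
  have h : gauss 1 (`|q| + 1) * (x + m - x) <= normal_cdf 1 (x + m) - normal_cdf 1 x.
    apply: normal_cdf_increment; first by rewrite xq gerBl.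
      by rewrite lerDl.
    by rewrite xq lerD2l.
  rewrite addrAC subrr add0r in h; apply: (le_trans h).
  by apply: lerB => //; exact: normal_cdf_nd.
have xm : x <= y - m by rewrite lerBrDr -lerBrDl.
have h : gauss 1 (`|q| + 1) * (y - (y - m)) <= normal_cdf 1 y - normal_cdf 1 (y - m).
  apply: normal_cdf_increment; first by rewrite yq lerD2l lerN2.
    by rewrite gerBl.
  by rewrite yq lerDl.
rewrite subKr in h; apply: (le_trans h).
by apply: lerB => //; exact: normal_cdf_nd.
Qed.
End normal_quantile.

(** * Second-order expansion *)

Section expansions.
Context {R : realType}.
Implicit Types (v c x : R).

Lemma expR_quadratic x : `|x| <= 1 -> expR x <= 1 + x + (1 + expR 1) * x ^+ 2.
Proof.
move=> x1; have := expR_remainder2 x; rewrite ler_distl => /andP[_ h]; apply: (le_trans h).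
have : `|x| ^+ 3 * expR `|x| <= x ^+ 2 * expR 1.
  apply: ler_pM; rewrite ?exprn_ge0 ?expR_ge0 ?ler_expR// exprSr -[x ^+ 2]real_normK ?num_real//.
  by rewrite ler_piMr ?exprn_ge0.
by have := sqr_ge0 x; lra.
Qed.

Lemma ln_le_sqrt (n : nat) : (0 < n)%N -> ln n%:R <= 2 * Num.sqrt n%:R :> R.
Proof.
move=> n0; have n0' : 0 < n%:R :> R by rewrite ltr0n.
have s0 : 0 < Num.sqrt n%:R :> R by rewrite sqrtr_gt0.
have := expR_ge1Dx (ln (Num.sqrt n%:R : R)); rewrite lnK ?posrE// => h.
have -> : ln n%:R = 2 * ln (Num.sqrt n%:R) :> R.
  by rewrite -[in LHS](sqr_sqrtr (ltW n0')) lnXn// mulr_natl.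
lra.
Qed.

Lemma eventually_large (a : R) : exists N : nat, forall n, (N <= n)%N -> (0 < n)%N /\ a <= n%:R.
Proof.
exists (Num.truncn a).+1 => n hn; split; first exact: leq_trans hn.
by apply: (le_trans (ltW (truncnS_gt _))); rewrite ler_nat.
Qed.

Lemma ln_ge1 (n : nat) : expR 1 <= n%:R :> R -> 1 <= ln n%:R :> R.
Proof.
move=> h; rewrite -[leLHS](@expRK R 1) ler_ln ?posrE ?expR_gt0//.
exact: lt_le_trans (expR_gt0 _) h.
Qed.

Lemma second_order_small v c : exists (D : R) (N : nat), 0 <= D /\ forall n, (N <= n)%N -> 
  [/\ (0 < n)%N, 1 <= ln (n%:R : R), D / Num.sqrt n%:R <= 1 &
   `|v / Num.sqrt n%:R| + `|c| * (ln n%:R / n%:R) <= D / Num.sqrt n%:R].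
Proof.
pose D : R := `|v| + 2 * `|c|; have D0 : 0 <= D by rewrite addr_ge0// mulr_ge0.
have [N hN] := eventually_large (Num.max (expR 1) (D ^+ 2)).
exists D, N; split => // n /hN[n0]; rewrite ge_max => /andP[h1 h2].
have n0' : 0 < n%:R :> R by rewrite ltr0n.
have s0 : 0 < Num.sqrt n%:R :> R by rewrite sqrtr_gt0.
split => //; first exact: ln_ge1.
  by rewrite ler_pdivrMr// mul1r -(ger0_norm D0) -sqrtr_sqr ler_wsqrtr.
have hl : ln n%:R / n%:R <= 2 / Num.sqrt n%:R :> R.
  rewrite -[X in _ / X <= _](sqr_sqrtr (ltW n0')) expr2 invfM mulrA.
  by rewrite ler_wpM2r ?invr_ge0 ?(ltW s0)// ler_pdivrMr//; exact: ln_le_sqrt.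
rewrite [leRHS]mulrDl normrM normfV (gtr0_norm s0) lerD2l.
by rewrite [2 * _]mulrC -mulrA ler_wpM2l.
Qed.

(** The exponent is O(1 / sqrt n), so its square is O(1 / n), within the error term ln n / n. *)
Lemma expR_second_order v c : exists (C : R) (N : nat), forall n, (N <= n)%N ->
  expR (v / Num.sqrt n%:R + (ln n%:R + c) / n%:R) <= 1 + v / Num.sqrt n%:R + C * (ln n%:R / n%:R).
Proof.
have [D [N [D0 hN]]] := second_order_small v (1 + `|c|).
exists (1 + `|c| + (1 + expR 1) * D ^+ 2), N => n /hN[n0 l1 Ds hD].
have n0' : 0 < n%:R :> R by rewrite ltr0n.
have s0 : 0 < Num.sqrt n%:R :> R by rewrite sqrtr_gt0.
set y := v / _ in hD *; set l := ln n%:R in l1 hD *.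
have n1 : 0 <= n%:R^-1 :> R by rewrite invr_ge0.
have cl : `|l + c| <= (1 + `|c|) * l.
  apply: (le_trans (ler_normD _ _)); rewrite (ger0_norm (le_trans ler01 l1)) mulrDl mul1r lerD2l.
  by rewrite ler_peMr.
have hx : `|y + (l + c) / n%:R| <= D / Num.sqrt n%:R.
  apply: (le_trans (ler_normD _ _)); apply: le_trans hD; rewrite lerD2l normrM (ger0_norm n1).
  by rewrite (ger0_norm (addr_ge0 ler01 (normr_ge0 c))) [leRHS]mulrA ler_wpM2r.
apply: (le_trans (expR_quadratic (le_trans hx Ds))).
rewrite [X in _ <= _ + X]mulrDl addrA -[leLHS]addrA -[leRHS]addrA !addrA -[_ + y + _ / _ + _]addrA -[_ + _ + _ + _ * D ^+ 2 * _]addrA lerD2l; apply: lerD.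
  by rewrite mulrA ler_wpM2r//; apply: le_trans cl; exact: ler_norm.
rewrite -mulrA ler_wpM2l ?addr_ge0 ?expR_ge0//.
apply: (@le_trans _ _ (D ^+ 2 / n%:R)).
  rewrite -[X in _ <= _ / X](sqr_sqrtr (ltW n0')) -expr_div_n -[leLHS]real_normK ?num_real//.
  by rewrite lerXn2r ?nnegrE// divr_ge0// ltW.
by rewrite ler_wpM2l ?sqr_ge0// ler_peMl.
Qed.

(** Positivity of the lower bound is what [mu_star_between] needs to bound the admissible noise
    variances. *)
Lemma lower_bound_pos v C : exists N : nat, forall n, (N <= n)%N ->
  0 < 1 + v / Num.sqrt n%:R - C * (ln (n%:R : R) / n%:R).
Proof.
have [D [N [D0 hN]]] := second_order_small (2 * v) (2 * C).
exists N => n /hN[n0 l1 Ds hD].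
have := le_trans hD Ds; set y := v / _; set z := _ / n%:R.
have z0 : 0 <= z by rewrite divr_ge0 ?ler0n// (le_trans ler01).
rewrite -mulrA normrM [`|2 * C|]normrM (@ger0_norm _ 2)// -/y => h.
have := ler_norm (- y); rewrite normrN; have := ler_wpM2r z0 (ler_norm C).
lra.
Qed.

Lemma sqrt_expR x : 0 < x -> Num.sqrt x = expR (ln x / 2).
Proof.
move=> x0; rewrite -{1}(@lnK _ x) ?posrE// (_ : ln x = ln x / 2 + ln x / 2); last by field.
by rewrite expRD -expr2 sqrtr_sqr ger0_norm ?expR_ge0//; congr expR; field.
Qed.

Lemma vnr_expR (n : nat) (g m s2 : R) : (0 < n)%N -> 0 < s2 ->
  expR (- 2 * (ln g / n%:R) + m) / (2 * pi * expR 1 * s2) =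
  expR ((- 2 * ln g + n%:R * m - n%:R * ln (2 * pi * s2) - n%:R) / n%:R).
Proof.
move=> n0 s20; have n0' : n%:R != 0 :> R by rewrite pnatr_eq0 -lt0n.
have p0 : 0 < 2 * pi * s2 by rewrite !mulr_gt0// pi_gt0.
have -> : 2 * pi * expR 1 * s2 = expR (1 + ln (2 * pi * s2)).
  by rewrite expRD lnK ?posrE//; ring.
by rewrite -expRN -expRD; congr expR; field.
Qed.
End expansions.

(** * Choice of the radius parameter *)

Section second_order.
Context {d} {T : measurableType d} {R : realType}.
Variables (P : probability T R) (H Z : nat -> T -> R) (eps q V B : R) (F : nat -> R -> R).
Let m := ElnH2 P H.
Let Phi : R -> R := normal_cdf 1.
Hypotheses (V0 : 0 < V) (B0 : 0 <= B) (hq : Phi q = 1 - eps).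
Hypothesis hF : forall (n : nat) z, (0 < n)%N -> `|F n z - normal_cdf n z| <= B / Num.sqrt n%:R.
Hypothesis conv : forall n (del s2 g t : R) (S : set 'rV[R]_n), (0 < n)%N -> 0 < del -> 0 < s2 ->
  countable S -> IC_density S = g%:E -> 0 < g -> (Pe P H Z s2 S <= eps%:E)%E ->
  2 * expR 2 * expR (- (n%:R - n%:R * m + Num.sqrt V * t) / 2) <=
    del * g * (Num.sqrt (2 * pi) * Num.sqrt s2) ^+ n ->
  1 - 2 * del <= eps + F n t.
Hypothesis ach : forall n (del g0 t : R), (0 < n)%N -> 0 < del -> 0 < g0 ->
  32 * g0 * (Num.sqrt (2 * pi) ^+ n * expR ((n%:R - n%:R * m + Num.sqrt V * t) / 2)) <= del ->
  exists (S : set 'rV[R]_n) (g : R), [/\ countable S, IC_density S = g%:E, g0 / 2 <= g &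
    (Pe P H Z 1 S <= (1 - F n t + 3 * del)%:E)%E].

Let W := Num.sqrt V.
Let W0 : 0 < W. Proof. by rewrite sqrtr_gt0. Qed.

Lemma vnr_lower : exists (C : R) (N : nat), forall n, (N <= n)%N ->
  forall (S : set 'rV[R]_n) (s2 g : R), countable S -> IC_density S = g%:E -> 0 < g -> 0 < s2 ->
  (Pe P H Z s2 S <= eps%:E)%E ->
  1 + W * q / Num.sqrt n%:R - C * (ln n%:R / n%:R) <=
    expR (- 2 * (ln g / n%:R) + m) / (2 * pi * expR 1 * s2).
Proof.
have [kap kap0 hgap] := normal_cdf_gap q.
(* [B] is the Berry-Esseen constant and 2 the loss 2 del at del = 1 / sqrt n. *)
pose a := (B + 2) / kap; have a0 : 0 <= a by rewrite divr_ge0 ?addr_ge0// ltW.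
pose c2 : R := 2 * (ln 2 + 2); have c20 : 0 <= c2.
  by rewrite mulr_ge0// addr_ge0// ln_ge0// ler1n.
(* From n >= (a + 1)^2 on, a / sqrt n < 1 excludes the value 1 in the minimum of
   [normal_cdf_gap]. *)
have [N hN] := eventually_large (Num.max (expR 1) ((a + 1) ^+ 2)).
exists (1 + c2 + W * a), N => n /hN[n0]; rewrite ge_max => /andP[h1 h2] S s2 g cS hS g0 s20 hPe.
have n0' : 0 < n%:R :> R by rewrite ltr0n.
have l1 : 1 <= ln n%:R :> R by exact: ln_ge1.
set s := Num.sqrt n%:R; have s0 : 0 < s by rewrite sqrtr_gt0.
have ss : s ^+ 2 = n%:R by rewrite sqr_sqrtr// ltW.
have as1 : a + 1 <= s.
  by rewrite -(@ger0_norm _ (a + 1)) ?addr_ge0// -sqrtr_sqr ler_wsqrtr.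
rewrite vnr_expR//; set E := - 2 * ln g + _ - _ - _.
(* [E] is n times the logarithm of the volume-to-noise ratio at variance [s2]. This [t] meets the
   condition of [conv] with equality for del = 1 / sqrt n; the converse then bounds t, and with it
   E, from below. *)
pose t := (E + ln n%:R + c2) / W.
have Wt : W * t = E + ln n%:R + c2 by rewrite mulrC divfK// gt_eqF.
have si0 : 0 < s^-1 by rewrite invr_gt0.
have p0 : 0 < 2 * pi :> R by rewrite mulr_gt0// pi_gt0.
have hcond : 2 * expR 2 * expR (- (n%:R - n%:R * m + Num.sqrt V * t) / 2) <=
    s^-1 * g * (Num.sqrt (2 * pi) * Num.sqrt s2) ^+ n.
  rewrite -/W Wt -sqrtrM ?(ltW p0)// (sqrt_expR (mulr_gt0 p0 s20)) -expRM_natr /s (sqrt_expR n0') -expRN.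
  rewrite -{1}(@lnK _ 2) ?posrE// -[X in _ <= _ * X * _](@lnK _ g) ?posrE// -!expRD ler_expR.
  rewrite /E /c2; lra.
have := conv n0 si0 s20 cS hS g0 hPe hcond.
have := hF t n0; rewrite normal_cdf_scale// -/s ler_distl => /andP[_ hF2] hc.
have hPhi : Phi q - Phi (t / s) <= (B + 2) / s.
  by rewrite hq /Phi; move: hc hF2; rewrite mulrDl; lra.
have ht : q - a / s <= t / s.
  have [qt|tq] := leP q (t / s).
    by apply: le_trans qt; rewrite gerBl divr_ge0// ltW.
  have := hgap _ _ (ltW tq) (or_intror erefl); rewrite -/(Phi q) -/(Phi (t / s)) => hg.
  have := le_trans hg hPhi; rewrite mulrC -ler_pdivlMr// (_ : (B + 2) / s / kap = a / s); last first.
    by rewrite /a mulrAC.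
  have as2 : a / s < 1 by rewrite ltr_pdivrMr// mul1r (lt_le_trans _ as1)// ltrDl.
  rewrite ge_min => /orP[h|h]; last by lra.
  by have := le_lt_trans h as2; rewrite ltxx.
have ht2 : s * q - a <= t.
  move: ht; rewrite -(ler_pM2r s0) divfK ?gt_eqF// mulrBl divfK ?gt_eqF//.
  by rewrite mulrC.
have hE : W * (s * q - a) - ln n%:R - c2 <= E.
  by have := ler_wpM2l (ltW W0) ht2; rewrite Wt; lra.
apply: le_trans (expR_ge1Dx _); rewrite -addrA lerD2l.
have n1 : 0 < n%:R^-1 :> R by rewrite invr_gt0.
apply: (@le_trans _ _ ((W * (s * q - a) - ln n%:R - c2) / n%:R)); last first.
  by rewrite ler_wpM2r// ltW.
have -> : W * q / s = W * (s * q) / n%:R.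
  by rewrite -ss; field; rewrite gt_eqF.
rewrite [X in _ - X <= _]mulrA -mulrBl ler_wpM2r ?(ltW n1)// mulrBr -!addrA lerD2l.
have k0 : 0 <= c2 + W * a by rewrite addr_ge0// mulr_ge0// ltW.
have := ler_wpM2l k0 l1; lra.
Qed.

Lemma vnr_upper : exists (C : R) (N : nat), forall n, (N <= n)%N ->
  exists (S : set 'rV[R]_n) (g : R), [/\ countable S, IC_density S = g%:E, 0 < g,
    (Pe P H Z 1 S <= eps%:E)%E &
    expR (- 2 * (ln g / n%:R) + m) / (2 * pi * expR 1 * 1) <=
      1 + W * q / Num.sqrt n%:R + C * (ln n%:R / n%:R)].
Proof.
have [kap kap0 hgap] := normal_cdf_gap q.
(* Raising t by [a] increases the normal distribution function at t / sqrt n by at least (B + 3) /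
   sqrt n, which pays for the Berry-Esseen error and the loss 3 del. *)
pose a := (B + 3) / kap; have a0 : 0 <= a by rewrite divr_ge0 ?addr_ge0// ltW.
pose c2 : R := 2 * (ln 2 + ln 32).
have [C [N1 hC]] := expR_second_order (W * q) (c2 + W * a).
have [N2 hN] := eventually_large (a ^+ 2).
exists C, (maxn N1 N2) => n; rewrite geq_max => /andP[/hC hC1 /hN[n0 h1]].
have n0' : 0 < n%:R :> R by rewrite ltr0n.
move: hC1; set s := Num.sqrt n%:R => hC1; have s0 : 0 < s by rewrite sqrtr_gt0.
have ss : s ^+ 2 = n%:R by rewrite sqr_sqrtr// ltW.
have as1 : a <= s by rewrite -(ger0_norm a0) -sqrtr_sqr ler_wsqrtr.
pose t := s * q + a.
have si0 : 0 < s^-1 by rewrite invr_gt0.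
have p0 : 0 < 2 * pi :> R by rewrite mulr_gt0// pi_gt0.
(* The log-density that meets the condition of [ach] with equality for del = 1 / sqrt n. In [c2], ln
   32 comes from this condition and ln 2 from the halved density in its conclusion. *)
pose lg := - (ln 32 + ln n%:R / 2 + ln (2 * pi) / 2 * n%:R + (n%:R - n%:R * m + W * t) / 2) : R.
have hcond : 32 * expR lg * (Num.sqrt (2 * pi) ^+ n * expR ((n%:R - n%:R * m + Num.sqrt V * t) / 2)) <= s^-1.
  rewrite -/W /s (sqrt_expR p0) -expRM_natr (sqrt_expR n0') -expRN.
  rewrite -{1}(@lnK _ 32) ?posrE// -!expRD ler_expR /lg; lra.
have [S [g [cS hS hg hPe]]] := ach n0 si0 (expR_gt0 lg) hcond.
have g0 : 0 < g by apply: lt_le_trans hg; rewrite divr_gt0// expR_gt0.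
exists S, g; split => //.
  apply: (le_trans hPe); rewrite lee_fin.
  have := hF t n0; rewrite normal_cdf_scale// -/s ler_distl => /andP[hF1 _].
  have ts : t / s = q + a / s by rewrite /t mulrDl mulrAC divff ?mul1r// gt_eqF.
  have qt : q <= t / s by rewrite ts lerDl divr_ge0// ltW.
  have := hgap _ _ qt (or_introl erefl); rewrite ts addrAC subrr add0r.
  have as2 : a / s <= 1 by rewrite ler_pdivrMr// mul1r.
  rewrite (min_idPr as2) -ts -/(Phi q) hq (_ : kap * (a / s) = (B + 3) / s); last first.
    by rewrite /a; field; rewrite !gt_eqF.
  by move: hF1; rewrite /Phi mulrDl; lra.
rewrite vnr_expR//; apply: le_trans hC1; rewrite ler_expR mulr1.
have -> : W * q / s + (ln n%:R + (c2 + W * a)) / n%:R = (W * (s * q) + ln n%:R + c2 + W * a) / n%:R.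
  by rewrite -ss; field; rewrite gt_eqF.
rewrite ler_wpM2r ?invr_ge0 ?(ltW n0')//.
have : lg - ln 2 <= ln g.
  by rewrite -ler_expR lnK ?posrE// expRD expRN lnK ?posrE.
rewrite /lg /c2 /t mulrDr; lra.
Qed.
End second_order.

(** * Assembling the two bounds *)

Lemma integral_prob_compl {d} {T : measurableType d} {R : realType} (P : probability T R)
  (p1 p2 : T -> \bar R) (x : R) : (forall w, 0 <= p1 w)%E -> (forall w, 0 <= p2 w)%E ->
  measurable_fun setT p1 -> measurable_fun setT p2 -> (forall w, p1 w + p2 w = 1)%E ->
  (\int[P]_w p1 w = x%:E)%E -> (\int[P]_w p2 w = (1 - x)%:E)%E.
Proof.
move=> p10 p20 m1 m2 h12 h1; have : (\int[P]_w (p1 w + p2 w) = 1)%E.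
  rewrite (_ : (fun w => _) = cst 1%E); last exact/funext.
  by rewrite integral_cst//= probability_setT mule1.
rewrite ge0_integralD// h1; set J := integral _ _ _; case: J => [j| |]//=.
by move=> [h]; congr EFin; lra.
Qed.

Lemma prob_le_gt {d} {T : measurableType d} {R : realType} (P : probability T R) (X : T -> R) (r : R) :
  measurable_fun setT X -> (P [set w | (X w <= r)%R] + P [set w | (r < X w)%R] = 1)%E.
Proof.
move=> mX; have mr : measurable [set w | X w <= r] by exact: measurable_le_set.
rewrite (_ : [set w | r < X w] = ~` [set w | X w <= r]); last first.
  by apply/seteqP; split => w /=; rewrite ltNge => /negP.
rewrite probability_setC// -(fineK (fin_num_measure P _ mr)).
by rewrite -EFinB -EFinD; congr EFin; rewrite addrC subrK.
Qed.

(** [VNR] refers to a supremum of variances. The positive [lb] turns the lower bound, valid at every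
    admissible variance, into an upper bound on these variances, and so excludes the supremum +oo,
    where [VNR] is 0 by convention. For the upper bound variance 1 suffices, because the supremum is
    then at least 1. *)
Lemma mu_star_between (R : realType) (d : measure_display) (T : measurableType d)
  (P : probability T R) (H Z : nat -> T -> R) (n : nat) (eps lb ub : R) :
  0 < lb ->
  (forall (S : set 'rV[R]_n) (s2 g : R), countable S -> IC_density S = g%:E -> 0 < g -> 0 < s2 ->
     (Pe P H Z s2 S <= eps%:E)%E ->
     lb <= expR (- 2 * (ln g / n%:R) + ElnH2 P H) / (2 * pi * expR 1 * s2)) ->
  (exists (S : set 'rV[R]_n) (g : R), [/\ countable S, IC_density S = g%:E, 0 < g,
     (Pe P H Z 1 S <= eps%:E)%E &
     expR (- 2 * (ln g / n%:R) + ElnH2 P H) / (2 * pi * expR 1 * 1) <= ub]) ->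
  (lb%:E <= mu_star P n H Z eps <= ub%:E)%E.
Proof.
move=> lb0 hlb [S0 [g0 [cS0 dS0 g00 PS0 hub]]].
have K0 : 0 < 2 * pi * expR 1 :> R by rewrite !mulr_gt0 ?pi_gt0 ?expR_gt0.
have vnr (S : set 'rV[R]_n) (g s1 : R) : countable S -> IC_density S = g%:E -> 0 < g -> 0 < s1 ->
    (Pe P H Z s1 S <= eps%:E)%E ->
    (lb%:E <= VNR P H Z S eps)%E /\
    (VNR P H Z S eps <= (expR (- 2 * (ln g / n%:R) + ElnH2 P H) / (2 * pi * expR 1 * s1))%:E)%E.
  move=> cS dS gp s10 PS; rewrite /VNR /NLD dS /=.
  set X := expR _; have X0 : 0 < X by exact: expR_gt0.
  have ub1 : ubound [set s2%:E | s2 in [set s2 : R | 0 < s2 /\ (Pe P H Z s2 S <= eps%:E)%E]]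
      (X / (2 * pi * expR 1 * lb))%:E.
    move=> _ [s2 [s20 P2] <-]; rewrite lee_fin ler_pdivlMr ?(mulr_gt0 K0)//.
    have := hlb S s2 g cS dS gp s20 P2; rewrite -/X ler_pdivlMr ?(mulr_gt0 K0)//.
    by congr (_ <= X); ring.
  have h1 := ge_ereal_sup ub1; rewrite -/(sigma2_eps P H Z S eps) in h1.
  have h2 : (s1%:E <= sigma2_eps P H Z S eps)%E by apply: ereal_sup_ubound; exists s1.
  move: h1 h2; case: (sigma2_eps P H Z S eps) => [s|//|//]; rewrite !lee_fin => h1 h2.
  have s0 : 0 < s by exact: lt_le_trans h2.
  split.
    move: h1; rewrite ler_pdivlMr ?(mulr_gt0 K0)// ler_pdivlMr ?(mulr_gt0 K0)//.
    by congr (_ <= X); ring.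
  by rewrite ler_pM2l// lef_pV2 ?posrE ?(mulr_gt0 K0)// ler_pM2l.
apply/andP; split.
  apply: le_ereal_inf_tmp => _ [S [cS [/andP[d0 dy] [s2 [s20 PS]]]] <-].
  have dfin : IC_density S \is a fin_num by rewrite ge0_fin_numE// ltW.
  have dE := esym (fineK dfin).
  exact: (vnr S _ s2 cS dE (fine_gt0 (introT andP (conj d0 dy))) s20 PS).1.
apply: (@le_trans _ _ (VNR P H Z S0 eps)).
  apply: ereal_inf_lbound; exists S0 => //; split => //; rewrite dS0 lte_fin ltry g00; split => //.
  by exists 1.
by apply: (le_trans (vnr S0 g0 1 cS0 dS0 g00 ltr01 PS0).2); rewrite lee_fin.
Qed.

Theorem theorem4p7 (R : realType) (d : measure_display) (T : measurableType d)
  (P : probability T R) (H Z : nat -> T -> R) (f : R -> R)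
  (alpha c h0 : R) (eps q : R) :
  (* fading and noise are measurable *)
  (forall i, measurable_fun setT (H i)) ->
  (forall i, measurable_fun setT (Z i)) ->
  (* {H_i} i.i.d. nonnegative with PDF f *)
  mutually_independent P H ->
  measurable_fun setT f -> (forall h, 0 <= f h) -> (forall h, h < 0 -> f h = 0) ->
  (forall i B, measurable B ->
     P (H i @^-1` B) = (\int[lebesgue_measure]_(x in B) (f x)%:E)%E) ->
  (* E H^2 = 1 *)
  (\int[P]_w ((H 0%N w) ^+ 2)%:E)%E = 1%E ->
  (* regular fading: f(h) proportional to h^(alpha-1) for all small h > 0 *)
  0 < alpha -> 0 < c -> 0 < h0 ->
  (forall h, 0 < h < h0 -> f h = c * h `^ (alpha - 1)) ->
  (* {Z_i} i.i.d. standard normal (the noise is sigma * Z_i) *)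
  mutually_independent P Z ->
  (forall i B, measurable B -> P (Z i @^-1` B) = normal_prob 0 1 B) ->
  (* error probability and Q^{-1}(eps) *)
  0 < eps < 1 -> Qfun q = eps ->
  exists C : R, exists N : nat, forall n : nat, (N <= n)%N ->
    mu_star P n H Z eps \is a fin_num /\
    `| fine (mu_star P n H Z eps)
       - (1 + Num.sqrt ((2 + VarlnH2 P H) / n%:R) * q) |
      <= C * (ln (n%:R) / n%:R).

Proof.
move=> mH mZ iH mf f0 fneg lH H2 alpha0 _ h00 f_small iZ lZ /andP[eps0 eps1] hq.
set V := 2 + VarlnH2 P H.
pose F : nat -> R -> R := info_cdf P mH.
have V0 : 0 < V by exact: (dispersion_gt0 mH mf f0 fneg lH H2 alpha0 h00 f_small).
have [B B0 hB] := info_cdf_berry_esseen mH mf f0 fneg lH H2 alpha0 h00 f_small.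
have hPhi : normal_cdf 1 q = 1 - eps by rewrite -hq Qfun_normal_cdf; ring.
have conv n del s2 := @converse _ _ _ _ _ _ _ _ _ _ mH mZ iH mf f0 fneg lH H2 alpha0 h00 f_small iZ lZ n del s2 eps.
have ach (n : nat) (del g0 t : R) : (0 < n)%N -> 0 < del -> 0 < g0 ->
    32 * g0 * (Num.sqrt (2 * pi) ^+ n *
      expR ((n%:R - n%:R * ElnH2 P H + Num.sqrt V * t) / 2)) <= del ->
    exists (S : set 'rV[R]_n) (g : R), [/\ countable S, IC_density S = g%:E, g0 / 2 <= g &
      (Pe P H Z 1 S <= (1 - F n t + 3 * del)%:E)%E].
  move=> n0 del0 g00 hdel.
  have [PN _] := fading_gt0 mH mf fneg lH n.
  have mrad := measurable_radius2 P mH n t.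
  have radE w : (forall i : 'I_n, 0 < H i w) ->
      expR (radius2 P H n t w / 2) * \prod_(i < n) (H i w)^-1 =
      expR ((n%:R - n%:R * ElnH2 P H + Num.sqrt V * t) / 2).
    move=> hp; have -> : \prod_(i < n) (H i w)^-1 = expR (- \sum_(i < n) ln (H i w)).
      by rewrite -sumrN expR_sum; apply: eq_bigr => i _; rewrite expRN lnK// posrE hp.
    rewrite -expRD; congr expR; rewrite /radius2 -/V sumrB sumr_const card_ord.
    have -> : \sum_(i < n) ln (H i w ^+ 2) = 2 * \sum_(i < n) ln (H i w).
      by rewrite mulr_sumr; apply: eq_bigr => i _; rewrite lnXn// mulr_natl.
    by rewrite -[ElnH2 P H *+ n]mulr_natl; field.
  have [S [g [cS dS hg hPe]]] := achievability mH mZ n0 mrad (expR_gt0 _) radE g00 del0 hdel PN.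
  exists S, g; split => //; apply: (le_trans hPe).
  (* The event that the noise energy exceeds the radius is complementary to the one of
     [radius2_prob], so its mean probability is 1 - F n t. *)
  have rp := radius2_prob mH mZ iH mf f0 fneg lH H2 alpha0 h00 f_small iZ lZ n t.
  rewrite (integral_prob_compl _ _ (measurable_radius2_prob P mH mZ n t)
    (measurable_energy_gt P mZ n mrad) _ rp) ?EFinD// => w.
  by rewrite prob_le_gt//; apply: measurable_sum => i; exact: measurable_funX.
have [C1 [N1 lower]] := vnr_lower V0 B0 hPhi hB conv.
have [C2 [N2 upper]] := vnr_upper B0 hPhi hB ach.
have [N3 pos] := lower_bound_pos (Num.sqrt V * q) C1.
have [N4 large] := eventually_large (expR 1 : R).
exists (Num.max C1 C2), (maxn (maxn N1 N2) (maxn N3 N4)) => n.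
rewrite !geq_max => /andP[/andP[n1 n2] /andP[n3 n4]].
have [n0 ne] := large n n4; have l1 := ln_ge1 ne.
have n0' : 0 < n%:R :> R by rewrite ltr0n.
have := mu_star_between (pos n n3) (lower n n1) (upper n n2).
set x := Num.sqrt V * q / _; set y := _ / n%:R => /andP[h1 h2].
have y0 : 0 <= y by rewrite divr_ge0 ?(le_trans ler01 l1)// ltW.
have fin : mu_star P n H Z eps \is a fin_num.
  by apply/fin_numPlt; rewrite (lt_le_trans (ltNyr _) h1) (le_lt_trans h2 (ltry _)).
split => //.
rewrite -(fineK fin) !lee_fin in h1 h2.
rewrite (_ : Num.sqrt (V / n%:R) * q = x); last first.
  by rewrite sqrtrM ?(ltW V0)// sqrtrV ?(ltW n0')// /x mulrAC.
move: h1 h2; set u := fine _ => h1 h2.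
have := ler_wpM2r y0 (_ : C1 <= Num.max C1 C2); rewrite le_max lexx => /(_ isT) k1.
have := ler_wpM2r y0 (_ : C2 <= Num.max C1 C2); rewrite le_max lexx orbT => /(_ isT) k2.
by rewrite ler_distl; apply/andP; split; lra.
Qed.
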